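(* Assume that $(\Sigma\times X,\widehat F)$ admits $\widehat\phi$-holonomies, and assume further that $F_\omega=F_{(\omega_i)_{i\le 0}}$, i.e. $F_\omega=F_{\omega'}$ whenever $\omega_i=\omega'_i$ for all $i\le 0$. Then $$\widehat P(\widehat\phi)=\max\Big\{\widehat h_{\widehat\eta}(\widehat F)+\int\widehat\phi\,d\widehat\eta:\ \widehat\eta\text{ is an }\widehat F\text{-invariant Borel probability measure on }\Sigma\times X\Big\}.$$
   Context: Setting: $\Sigma$ is a two-sided compact (finite alphabet), topologically transitive topological Markov shift with left shift $T:\Sigma\to\Sigma$; $X$ is a compact metric space; $\omega\mapsto F_\omega$ is a Hölder continuous map from $\Sigma$ into the space $C_\alpha(X,X)$ of $\alpha$-Hölder maps of $X$, where each $F_\omega$ is an $\alpha$-Hölder homeomorphism of $X$. The skew product is $\widehat F:\Sigma\times X\to\Sigma\times X$, $\widehat F(\omega,t)=(T\omega,F_\omega(t))$, and $F^k_\omega:=F_{T^{k-1}\omega}\circ\cdots\circ F_\omega$, $F^0_\omega=\mathrm{Id}$. $\widehat\phi:\Sigma\times X\to\mathbb R$ is Hölder continuous, $\phi_t(\omega):=\widehat\phi(\omega,t)$, and $\widehat\phi^{(n)}:=\sum_{k=0}^{n-1}\widehat\phi\circ\widehat F^k$. Words: $\underline w=(w_0,\dots,w_{n-1})$ ranges over admissible words of length $|\underline w|=n$, with $[\underline w]=\{\omega\in\Sigma:\omega_i=w_i,\ 0\le i\le n-1\}$. Pressure out of equilibrium (POE): $$\widehat P(\widehat\phi):=\limsup_{n\to\infty}\sup_{t\in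 X}\frac1n\log\sum_{|\underline w|=n}e^{\widehat\phi^{(n)}(\theta_{\underline w},t)},$$ where $\theta_{\underline w}=\theta_{\underline w}(t)\in[\underline w]$ maximizes $\omega\mapsto\widehat\phi^{(n)}(\omega,t)$ on $[\underline w]$. $\widehat\phi$-holonomies: there is $C>0$ such that for all $n\ge0$, $t\in X$ and $\omega,\omega'\in\Sigma$ with $\omega_i=\omega'_i$ for $0\le i\le n$, one has $|\widehat\phi^{(n)}(\omega,t)-\widehat\phi^{(n)}(\omega',t)|\le C$. Metric entropy out of equilibrium: let $\Sigma^-=\{(\omega_i)_{i\le-1}:\omega\in\Sigma\}$ and, for $\omega^-\in\Sigma^-$, $V^u_{\le-1}(\omega^-)=\{\omega\in\Sigma:\omega_i=\omega^-_i\ \forall i\le-1\}$. Let $\widehat{\mathcal C}=\{[a]\times X\}_a$ ($a$ ranging over symbols) and $\widehat{\mathcal C}_n=\bigvee_{i=0}^{n-1}\widehat F^{-i}\widehat{\mathcal C}$. For an $\widehat F$-invariant Borel probability $\widehat\eta$ on $\Sigma\times X$, let $\widehat\eta=\int\eta_{(\omega^-,t)}\,d\tau(\omega^-,t)$ be its disintegration along the measurable partition $\{V^u_{\le-1}(\omega^-)\times\{t\}\}_{\omega^-\in\Sigma^-,\,t\in X}$. Then $$\widehat h_{\widehat\eta}(\widehat F):=\limsup_{n\to\infty}\int\frac1n \mathrm H_{\eta_{(\omega^-,t)}}(\widehat{\mathcal C}_n)\,d\tau(\omega^-,t),$$ where $\mathrm H_\nu(\mathcal P)=-\sum_{A\in\mathcal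 P}\nu(A)\log\nu(A)$. *)

(* Defs.v *)
From HB Require Import structures.
From mathcomp Require Import all_boot all_order all_algebra.
From mathcomp Require Import all_classical all_reals all_analysis.

Set Implicit Arguments.
Unset Strict Implicit.
Unset Printing Implicit Defensive.

Import Order.TTheory GRing.Theory Num.Theory.
Import numFieldNormedType.Exports.

Local Open Scope classical_set_scope.
Local Open Scope ring_scope.

Section prod_metric.
Context {R : realType} (U V : metricType R).

Definition prod_dist (x y : U * V) : R :=
  Num.max (mdist x.1 y.1) (mdist x.2 y.2).

Lemma prod_dist_ge0 x y : 0 <= prod_dist x y.
Proof. by rewrite le_max mdist_ge0. Qed.

Lemma prod_dist_eq0 x y : prod_dist x y = 0 -> x = y.
Proof.
case: x y => [x1 x2] [y1 y2] /eqP; rewrite eq_le => /andP[].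
rewrite /prod_dist /= ge_max => /andP[h1 h2] _.
by congr pair; apply: mdist_positivity; apply/eqP;
  rewrite eq_le mdist_ge0 andbT.
Qed.

Lemma ball_prod_dist (x : U * V) (d : R) :
  ball x d = [set y | prod_dist x y < d].
Proof.
apply/seteqP; split => y /=; rewrite /prod_dist gt_max.
- by move=> [/=]; rewrite !ballEmdist /= => -> ->.
- by case/andP => h1 h2; split; rewrite ballEmdist.
Qed.

HB.instance Definition _ := @PseudoMetric_isMetric.Build R (U * V)%type
  prod_dist prod_dist_ge0 prod_dist_eq0 ball_prod_dist.

End prod_metric.

Section holder.
Context {R : realType}.

Definition holder (U V : metricType R) (a : R) (f : U -> V) : Prop :=
  exists C : R, forall x y, mdist (f x) (f y) <= C * mdist x y `^ a.

Definition holder_continuous (U V : metricType R) (f : U -> V) : Prop :=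
  exists2 a : R, 0 < a <= 1 & holder a f.

Definition homeomorphism (U V : topologicalType) (f : U -> V) : Prop :=
  continuous f /\
  exists g : V -> U, [/\ continuous g, cancel f g & cancel g f].

Definition unif_dist (T : Type) (V : metricType R) (f g : T -> V) : R :=
  sup [set mdist (f t) (g t) | t in [set: T]].

(* Hölder continuity of a family of maps, a space of maps being equipped with
   the uniform distance. *)
Definition holder_family (U V : metricType R) (T : Type) (F : U -> T -> V) :=
  exists2 b : R, 0 < b <= 1 &
  exists C : R, forall x y, unif_dist (F x) (F y) <= C * mdist x y `^ b.

End holder.

Definition topologically_transitive (T : topologicalType) (f : T -> T) : Prop :=
  forall U V : set T, open U -> open V -> U !=set0 -> V !=set0 ->
  exists n, (iter n f @` U) `&` V !=set0.

(* The set S of I-indexed sequences, with the distance 2 ^ (- N) where N is the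
   least weight of an index at which two sequences differ. *)
Record symbolic (R : realType) (I : Type) (wt : I -> nat) (A : finType)
  (S : set (I -> A)) := Symbolic { coord :> I -> A; coordP : S coord }.
Arguments symbolic R {I} wt {A} S.
Arguments Symbolic {R I wt A S coord}.

Section symbolic_metric.
Context {R : realType} {I : Type} (wt : I -> nat) {A : finType}
  (S : set (I -> A)).
Local Notation space := (symbolic R wt S).

HB.instance Definition _ := gen_eqMixin space.
HB.instance Definition _ := gen_choiceMixin space.

Definition sym_dist (x y : space) : R :=
  sup [set (2^-1 : R) ^+ wt i | i in [set i | x i != y i]].

Let diff_ubound (x y : space) :
  has_ubound [set (2^-1 : R) ^+ wt i | i in [set i | x i != y i]].
Proof.
exists 1 => _ [i _ <-]; rewrite exprn_ile1 ?invr_ge0 //.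
by rewrite invf_le1 ?ler1n ?ltr0n.
Qed.

Lemma sym_dist_ge (x y : space) i :
  x i != y i -> (2^-1 : R) ^+ wt i <= sym_dist x y.
Proof. by move=> xy; apply: ub_le_sup; [exact: diff_ubound|exists i]. Qed.

Lemma sym_dist_le (x y : space) (r : R) : 0 <= r ->
  (forall i, x i != y i -> (2^-1 : R) ^+ wt i <= r) -> sym_dist x y <= r.
Proof.
move=> r0 h; rewrite /sym_dist.
set E := (X in sup X); have [E0|/set0P E0] := eqVneq E set0.
  by rewrite E0 sup0.
by apply: ge_sup => // _ [i + <-]; exact: h.
Qed.

Lemma sym_dist_ge0 (x y : space) : 0 <= sym_dist x y.
Proof.
have [[i xy]|/forallNP xy] := pselect (exists i, x i != y i).
  by apply: le_trans (sym_dist_ge xy); rewrite exprn_ge0 ?invr_ge0.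
rewrite /sym_dist (_ : [set _ | _ in _] = set0) ?sup0 //.
by rewrite -subset0 => r [i xi _]; exact: (xy i xi).
Qed.

Lemma sym_distxx (x : space) : sym_dist x x = 0.
Proof.
apply/eqP; rewrite eq_le sym_dist_ge0 andbT.
by apply: sym_dist_le => // i; rewrite eqxx.
Qed.

Lemma sym_dist_eq0 (x y : space) : sym_dist x y = 0 -> x = y.
Proof.
move=> d0; have xy : coord x = coord y.
  apply/funext => i; apply/eqP/negPn/negP => /sym_dist_ge.
  by rewrite d0 leNgt exprn_gt0 // invr_gt0 ltr0n.
case: x y xy {d0} => [x px] [y py] /= xy; rewrite xy in px *.
by congr Symbolic; exact: Prop_irrelevance.
Qed.

Lemma sym_distC (x y : space) : sym_dist x y = sym_dist y x.
Proof.
rewrite /sym_dist; congr sup; apply/seteqP.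
by split => _ [i + <-] => /=; rewrite eq_sym => xy; exists i.
Qed.

Lemma sym_dist_triangle (y x z : space) :
  sym_dist x z <= sym_dist x y + sym_dist y z.
Proof.
apply: sym_dist_le => [|i xz]; first by rewrite addr_ge0 ?sym_dist_ge0.
have [xy|xy] := eqVneq (x i) (y i).
  rewrite -[leLHS]add0r lerD ?sym_dist_ge0 //; apply: sym_dist_ge.
  by rewrite -xy.
by rewrite -[leLHS]addr0 lerD ?sym_dist_ge0 //; exact: sym_dist_ge.
Qed.

HB.instance Definition _ := @isMetric.Build R space
  sym_dist sym_distxx sym_dist_eq0 sym_distC sym_dist_triangle.

End symbolic_metric.

Section markov_shift.
Context {R : realType} {A : finType} (M : rel A).

Definition markov_seq : set (int -> A) :=
  [set w | forall i, M (w i) (w (i + 1))].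

Definition shift_space := symbolic R absz markov_seq.
HB.instance Definition _ := Metric.on shift_space.

Lemma shiftP (w : shift_space) : markov_seq (fun i => w (i + 1)).
Proof. by move=> i; exact: (coordP w). Qed.

Definition left_shift (w : shift_space) : shift_space := Symbolic (shiftP w).

Definition neg_int := {i : int | i <= -1}.

Definition restrict_neg (w : int -> A) : neg_int -> A := fun i => w (val i).

Definition past_space :=
  symbolic R (fun i : neg_int => absz (val i)) (restrict_neg @` markov_seq).
HB.instance Definition _ := Metric.on past_space.

Definition past (w : shift_space) : past_space :=
  Symbolic (imageP restrict_neg (coordP w)).

Definition cylinder n (u : n.-tuple A) : set shift_space :=
  [set w | forall i : 'I_n, w i%:Z = tnth u i].

End markov_shift.
Arguments shift_space R {A} M.
Arguments past_space R {A} M.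

(* The Borel measurable space of T. The point x only records that T is
   nonempty, as measurable types are pointed. *)
Definition borel (T : topologicalType) (x : T) : Type := T.

Section borel_measurable.
Context {T : topologicalType} (x : T).

HB.instance Definition _ := Choice.on (borel x).
HB.instance Definition _ := isPointed.Build (borel x) x.

Lemma borel_setC (B : set T) : <<s @open T >> B -> <<s @open T >> (~` B).
Proof. by move=> mB; rewrite -setTD; exact: sigma_algebraCD. Qed.

HB.instance Definition _ := @isMeasurable.Build (sigma_display (@open T))
  (borel x) <<s @open T >> (@sigma_algebra0 _ setT _) borel_setC
  (@sigma_algebra_bigcup _ setT _).

End borel_measurable.

Lemma continuous_borel (S T : topologicalType) (x : S) (y : T) (f : S -> T) :
  continuous f -> measurable_fun setT (f : borel x -> borel y).
Proof.
move=> cf.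
apply: (@measurability _ _ (borel x) (borel y) setT f (@open T)) => //.
move=> _ [B oB <-]; rewrite setTI; apply: sub_sigma_algebra.
exact: (open_comp (fun z _ => cf z)).
Qed.

HB.instance Definition _ d d' (S : measurableType d) (T : measurableType d')
  (R : realType) := gen_eqMixin (R.-pker S ~> T).
HB.instance Definition _ d d' (S : measurableType d) (T : measurableType d')
  (R : realType) := gen_choiceMixin (R.-pker S ~> T).

Section partitions.
Context {T : Type}.

Definition preimage_partition (f : T -> T) (P : set (set T)) : set (set T) :=
  [set f @^-1` B | B in P].

Definition join_partition (P Q : set (set T)) : set (set T) :=
  [set B `&` C | B in P & C in Q].

Definition partition_entropy (R : realType) (nu : set T -> \bar R)
    (P : set (set T)) : R :=
  - \sum_(B \in P) (fine (nu B) * ln (fine (nu B))).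

End partitions.

Section skew_product.
Context {R : realType} {A : finType} {M : rel A} {X : metricType R}.
Local Notation Sigma := (shift_space R M).
Variable F : Sigma -> X -> X.

Definition skew (z : Sigma * X) : Sigma * X := (left_shift z.1, F z.1 z.2).

Definition birkhoff (phi : Sigma * X -> R) n (z : Sigma * X) : R :=
  \sum_(k < n) phi (iter k skew z).

Definition holonomies (phi : Sigma * X -> R) : Prop :=
  exists2 C : R, 0 < C & forall n (t : X) (w w' : Sigma),
    (forall i : int, 0 <= i <= n%:Z -> w i = w' i) ->
    `|birkhoff phi n (w, t) - birkhoff phi n (w', t)| <= C.

Definition depends_on_past : Prop := forall w w' : Sigma,
  (forall i : int, i <= 0 -> w i = w' i) -> F w = F w'.

Variable z0 : Sigma * X.

Definition theta (phi : Sigma * X -> R) n (u : n.-tuple A) (t : X) : Sigma :=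
  xget z0.1 [set w | cylinder u w /\ forall w' : Sigma, cylinder u w' ->
    birkhoff phi n (w', t) <= birkhoff phi n (w, t)].

(* Admissible words are those with a nonempty cylinder; the base point [z0] is
   only a default value for [theta] on the other words. *)
Definition pressure (phi : Sigma * X -> R) : \bar R :=
  limn_esup (fun n => ereal_sup
    [set (n%:R^-1 * ln (\sum_(u : n.-tuple A | `[< @cylinder R A M n u !=set0 >])
       expR (birkhoff phi n (theta phi u t, t))))%:E | t in [set: X]]).

Definition unstable_proj (z : Sigma * X) : past_space R M * X :=
  (past z.1, z.2).

Lemma unstable_proj_le (z y : Sigma * X) :
  mdist (unstable_proj z) (unstable_proj y) <= mdist z y.
Proof.
rewrite [leLHS]/mdist [leRHS]/mdist /= /prod_dist /= ge_max !le_max lexx orbT.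
rewrite andbT; apply/orP; left; rewrite [leLHS]/mdist [leRHS]/mdist /=.
apply: sym_dist_le => [|i zy]; first exact: sym_dist_ge0.
exact: (@sym_dist_ge R int absz A (markov_seq M) z.1 y.1 (val i)).
Qed.

Lemma continuous_unstable_proj : continuous unstable_proj.
Proof.
move=> z; apply/metricType_numDomainType.cvgrPdist_lt => e e0.
near=> y; rewrite (le_lt_trans (unstable_proj_le z y)) //.
near: y; exact: (metricType_numDomainType.cvgr_dist_lt (@cvg_id _ (nbhs z))).
Unshelve. all: by end_near. Qed.

Definition unstable_borel : borel z0 -> borel (unstable_proj z0) :=
  unstable_proj.

HB.instance Definition _ := @isMeasurableFun.Build _ _ (borel z0)
  (borel (unstable_proj z0)) unstable_borel
  (continuous_borel continuous_unstable_proj).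

Definition invariant_measure (eta : probability (borel z0) R) : Prop :=
  forall B : set (borel z0), measurable B -> eta (skew @^-1` B) = eta B.

Definition transverse (eta : probability (borel z0) R) :=
  distribution eta unstable_borel.

(* Disintegration along the fibres V^u_{<= -1}(w^-) x {t} of [unstable_proj]. *)
Definition is_disintegration (eta : probability (borel z0) R)
    (kappa : R.-pker borel (unstable_proj z0) ~> borel z0) : Prop :=
  (\forall y \ae transverse eta, kappa y (unstable_proj @^-1` [set y]) = 1%E) /\
  forall B : set (borel z0), measurable B ->
    eta B = (\int[transverse eta]_y kappa y B)%E.

Definition constant_kernel (eta : probability (borel z0) R) :
    borel (unstable_proj z0) -> {measure set (borel z0) -> \bar R} :=
  kprobability (measurable_cst (eta : pprobability (borel z0) R)).

HB.instance Definition _ (eta : probability (borel z0) R) :=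
  ProbabilityKernel.on (constant_kernel eta).

(* A disintegration exists and is unique up to null sets; the constant kernel
   is a junk value. *)
Definition disintegration (eta : probability (borel z0) R) :
    R.-pker borel (unstable_proj z0) ~> borel z0 :=
  xget (constant_kernel eta : R.-pker _ ~> _) (is_disintegration eta).

Definition symbol_partition : set (set (Sigma * X)) :=
  range (fun a : A => [set z : Sigma * X | z.1 0 = a]).

Definition skew_partition n : set (set (Sigma * X)) :=
  \big[join_partition/[set setT]]_(i < n)
    preimage_partition (iter i skew) symbol_partition.

Definition metric_entropy (eta : probability (borel z0) R) : \bar R :=
  limn_esup (fun n => \int[transverse eta]_y
    (n%:R^-1 * partition_entropy (disintegration eta y) (skew_partition n))%:E)%E.

End skew_product.

Definition is_maximum d (T : porderType d) (S : set T) (x : T) : Prop :=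
  S x /\ ubound S x.

(* Main.v *)
Require Import Defs.
From HB Require Import structures.
From mathcomp Require Import all_boot all_order all_algebra.
From mathcomp Require Import all_classical all_reals all_analysis.
From mathcomp Require Import measurable_realfun.
From mathcomp Require Import ring lra zify.

Set Implicit Arguments.
Unset Strict Implicit.
Unset Printing Implicit Defensive.

Import Order.TTheory GRing.Theory Num.Theory.
Import numFieldNormedType.Exports.

Local Open Scope classical_set_scope.
Local Open Scope ring_scope.

(* Write pi(w, t) = (past of w, t), x_k for the k-th letter of w, and S_n for
   Birkhoff sums. The cylinders of length n are the atoms of the partition, so
   the entropy of eta is the growth rate of h_n, the mean entropy of x_0 ...
   x_(n-1) conditionally on pi.

   Upper bound: in the fibre over (w^-, t) the Gibbs inequality gives
   H(x_0 ... x_(n-1)) + mean of S_n phi <= log sum_u exp S_n phi (theta_u, t).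
   Integrating over the fibres, for invariant eta, h_n + n int phi is at most
   the supremum over t of the right-hand side.

   Equilibrium measure: replace the past of each theta_u by a past depending on
   u_0 only; by the holonomies this changes S_N phi boundedly. Let eta be a limit
   of the orbit averages of the Gibbs weights on these points. After j >= 1 steps
   the point pi reached from the word u depends on u_0 ... u_(j-1) only, because
   F depends on the past. Hence, if a function g(z) = G(x_0 ... x_(n-1), x_n, pi z)
   satisfies sum_a exp(- G(w, a, y)) <= 1, then, up to a bounded factor,
   exp(- S_N g) is a subprobability on words, and the Gibbs inequality bounds
   log Z_N by the average of S_N (phi + g). So the pressure is at most
   int (phi + g) d eta for all continuous G, hence, by L1 density, also for the
   logarithms of the conditional probabilities of eta; for these, int g d eta
   tends to h_(n+1) - h_n. *)

(** * Random sequences with prescribed cylinder probabilities *)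

(** Both kinds of measures that must be produced, the one representing a positive functional and the
    conditional measures on the fibres, come from a single construction: a uniform variable on the
    unit interval is decoded into a sequence of letters with prescribed, consistent word
    probabilities. It is applied once on the Cantor space and once to the futures of a given past.

    The obstacle in the lower bound is that the entropy along unstable fibres is not visibly
    semicontinuous in the measure: a weak limit controls only integrals of continuous functions,
    whereas conditional measures depend merely measurably on the fibre. The Gibbs inequality removes
    the entropy before the limit is taken, leaving the integral of a continuous [G]. Logarithms of
    conditional probabilities enter only afterwards; they are cut off from below to be bounded, and
    the continuous approximations are renormalised so that the constraint on [G] holds exactly.

    Windows of every length n are kept so that each increment h_(n+1) - h_n is at least P - int phi.
    Summing, h_n is at least n (P - int phi) for every n, which bounds the upper limit directly. *)

Section coding.
Context d (Y : measurableType d) (R : realType) (A : finType) (a0 : A).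
Variable p : seq A -> Y -> R.
Hypothesis mp : forall w, measurable_fun setT (p w).

(* The unit interval is divided into consecutive intervals of length [p w y], for
   the words [w] of length [k] in lexicographic order; [code] reads off the word
   of a point, last letter first, and [lower] is the left end of its interval. *)
Definition cumul (w : seq A) (y : Y) (k : nat) : R :=
  \sum_(b : A | (enum_rank b < k)%N) p (rcons w b) y.

Definition in_digit (l : R) (w : seq A) (a : A) (y : Y) (u : R) : bool :=
  l + cumul w y (enum_rank a) <= u < l + cumul w y (enum_rank a).+1.

Definition digit (l : R) (w : seq A) (yu : Y * R) : A :=
  odflt a0 [pick a | in_digit l w a yu.1 yu.2].

Fixpoint lower (w : seq A) (y : Y) : R :=
  if w is a :: w' then lower w' y + cumul (rev w') y (enum_rank a) else 0.

Fixpoint code (k : nat) (yu : Y * R) : seq A :=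
  if k is k'.+1 then
    let w := code k' yu in digit (lower w yu.1) (rev w) yu :: w
  else [::].

Lemma size_code k yu : size (code k yu) = k.
Proof. by elim: k => //= k ->. Qed.

Lemma measurable_cumul w k : measurable_fun setT (fun y => cumul w y k).
Proof.
rewrite (_ : (fun y => _) = fun y =>
    \sum_(b : A) if (enum_rank b < k)%N then p (rcons w b) y else 0).
  apply: measurable_sum => b.
  by case: (_ < _)%N; [exact: mp|exact: measurable_cst].
by apply/funext => y; rewrite /cumul big_mkcond.
Qed.

Lemma measurable_lower w : measurable_fun setT (lower w).
Proof.
elim: w => [|a w ih] /=; first exact: measurable_cst.
by apply: measurable_funD => //; exact: measurable_cumul.
Qed.

Lemma measurable_in_digit v w a :
  measurable_fun setT (fun yu : Y * R => in_digit (lower v yu.1) w a yu.1 yu.2).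
Proof.
apply: measurable_and; apply: measurable_fun_ler || apply: measurable_fun_ltr;
  try exact: measurable_snd;
  apply: measurable_funD;
  by [apply: (measurableT_comp (measurable_lower _)); exact: measurable_fst
     |apply: (measurableT_comp (measurable_cumul _ _)); exact: measurable_fst].
Qed.

(** The event depends on the point only through finitely many Boolean tests, so it is a finite union
    over their outcomes. This is what makes a digit defined by [pick] measurable. *)
Lemma measurable_finite_invariant d' (T : measurableType d') (I : finType)
    (f : I -> T -> bool) (Q : {ffun I -> bool} -> bool) :
  (forall i, measurable_fun setT (f i)) ->
  measurable [set x | Q [ffun i => f i x]].
Proof.
move=> mf; rewrite (_ : [set _ | _] = \bigcup_(v in [set v | Q v])
  \bigcap_(i in [set: I]) [set x | f i x = v i]); last first.
  apply/seteqP; split => x /=.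
    move=> Qx; exists [ffun i => f i x] => //= i _ /=; by rewrite ffunE.
  move=> [v /= Qv fv]; rewrite (_ : [ffun _ => _] = v) //.
  by apply/ffunP => i; rewrite ffunE; exact: fv.
apply: fin_bigcup_measurable => [|v _]; first exact: finite_finset.
apply: fin_bigcap_measurable => [|i _]; first exact: finite_finset.
by rewrite -[X in measurable X]setTI; exact: (mf i measurableT [set v i]).
Qed.

Lemma measurable_code k w : measurable [set yu | code k yu = w].
Proof.
elim: k w => [|k ih] [|a w] /=.
- by rewrite (_ : [set _ | _] = setT) //; apply/seteqP.
- by rewrite (_ : [set _ | _] = set0) //; apply/seteqP; split.
- by rewrite (_ : [set _ | _] = set0) //; apply/seteqP; split.
rewrite (_ : [set _ | _] = [set yu | code k yu = w] `&`
    [set yu | digit (lower w yu.1) (rev w) yu == a]); last first.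
  by apply/seteqP; split => yu /=; [case=> + <- => <-|case=> -> /eqP ->].
apply: measurableI => //.
have := @measurable_finite_invariant _ _ _ _
  (fun v : {ffun A -> bool} => odflt a0 [pick b | v b] == a)
  (measurable_in_digit w (rev w)).
rewrite (_ : [set _ | _] = [set yu | digit (lower w yu.1) (rev w) yu == a]) //.
have eqP yu : [pick b | [ffun i => in_digit (lower w yu.1) (rev w) i yu.1 yu.2] b]
    = [pick b | in_digit (lower w yu.1) (rev w) b yu.1 yu.2].
  by apply: eq_pick => b; rewrite /= ffunE.
by apply/seteqP; split => yu /=; rewrite /digit eqP.
Qed.

Section fixed_fibre.
Variable y : Y.
Hypothesis p_ge0 : forall w, 0 <= p w y.
Hypothesis p_nil : p [::] y = 1.
Hypothesis p_rcons : forall w, p w y = \sum_a p (rcons w a) y.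

Lemma cumul0 w : cumul w y 0 = 0.
Proof. by rewrite /cumul big_pred0. Qed.

Lemma cumul_le w i j : (i <= j)%N -> cumul w y i <= cumul w y j.
Proof.
move=> ij; rewrite /cumul [leLHS]big_mkcond [leRHS]big_mkcond /=.
apply: ler_sum => a _; case: ifPn => ai; last by case: ifP.
by rewrite (leq_trans ai ij).
Qed.

Lemma cumulS w a :
  cumul w y (enum_rank a).+1 = cumul w y (enum_rank a) + p (rcons w a) y.
Proof.
rewrite /cumul (bigD1 a) //= addrC; congr (_ + _); apply: eq_bigl => b.
rewrite ltnS ltn_neqAle andbC; congr (_ && _).
by rewrite -(inj_eq (@enum_rank_inj A)).
Qed.

Lemma cumul_card w : cumul w y #|A| = p w y.
Proof. by rewrite p_rcons; apply: eq_bigl => b; rewrite ltn_ord. Qed.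

Lemma in_digit_exists l w u :
  l <= u < l + p w y -> exists a, in_digit l w a y u.
Proof.
case/andP => lu ul.
have step m : u < l + cumul w y m ->
    exists2 k, (k < m)%N & l + cumul w y k <= u < l + cumul w y k.+1.
  elim: m => [|m ih]; first by rewrite cumul0 addr0 ltNge lu.
  move=> um; have [/ih[k km kP]|mu] := ltP u (l + cumul w y m).
    by exists k => //; exact: ltn_trans km _.
  by exists m => //; rewrite mu.
have [|k kA kP] := step #|A|; first by rewrite cumul_card.
exists (enum_val (Ordinal kA)).
by rewrite /in_digit enum_valK.
Qed.

Lemma in_digit_inj l w u a b :
  in_digit l w a y u -> in_digit l w b y u -> a = b.
Proof.
have half (c e : A) : in_digit l w c y u -> in_digit l w e y u ->
    ~~ (enum_rank c < enum_rank e)%N.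
  move=> /andP[_ uc] /andP[eu _]; apply/negP => ce.
  have := lt_le_trans uc (le_trans _ eu).
  by rewrite ltxx lerD2l cumul_le // => /(_ isT).
move=> ha hb; apply: enum_rank_inj; apply: val_inj; apply/eqP.
by rewrite eqn_leq leqNgt half //= leqNgt half.
Qed.

(** By consistency of [p], the intervals of the one-letter extensions of a word tile the interval of
    that word: [in_digit_exists] covers it and [in_digit_inj] separates the pieces. The reversal
    appears because [code] lists the last letter first. *)
Lemma codeP w u : 0 <= u < 1 ->
  (code (size w) (y, u) == w) = (lower w y <= u < lower w y + p (rev w) y).
Proof.
move=> u01; elim: w => [|a w ih]; first by rewrite /= add0r p_nil u01.
have inP : (lower (a :: w) y <= u < lower (a :: w) y + p (rev (a :: w)) y) =
    in_digit (lower w y) (rev w) a y u.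
  by rewrite rev_cons /in_digit cumulS addrA.
rewrite inP /= eqseq_cons andbC; apply/andP/idP.
  move=> [/eqP cw /eqP]; rewrite cw /digit /=.
  case: pickP => /= [b bin <- //|].
  (* The default letter [a0] is never reached: by induction [u] lies in the interval of [w], so some
     digit fits. *)
  move: ih; rewrite cw eqxx => /esym /in_digit_exists[b bin] /(_ b).
  by rewrite bin.
move=> ain; have /eqP cw : code (size w) (y, u) == w.
  rewrite ih; case/andP: (ain) => h1 h2; apply/andP; split.
    apply: le_trans h1; rewrite lerDl -(cumul0 (rev w)) cumul_le //.
  by apply: lt_le_trans h2 _; rewrite lerD2l -cumul_card cumul_le.
rewrite cw eqxx; split => //; apply/eqP; rewrite /digit /=.
by case: pickP => /= [b bin|/(_ a)]; [exact: in_digit_inj bin ain|rewrite ain].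
Qed.

Lemma lower_bounds w : 0 <= lower w y /\ lower w y + p (rev w) y <= 1.
Proof.
elim: w => [|a w [ih1 ih2]] /=; first by rewrite add0r p_nil.
split; first by rewrite addr_ge0 // -(cumul0 (rev w)) cumul_le.
apply: le_trans ih2; rewrite rev_cons -addrA -cumulS lerD2l.
by rewrite -cumul_card cumul_le.
Qed.

Lemma uniform_prob_itvco (a b : R) : 0 <= a -> a <= b -> b <= 1 ->
  uniform_prob (@ltr01 R) `[a, b[%classic = (b - a)%:E.
Proof.
move=> a0' ab b1.
rewrite /uniform_prob integral_uniform_pdf setIidl; last first.
  move=> u /=; rewrite !in_itv /= => /andP[au ub].
  by rewrite (le_trans a0' au) (le_trans (ltW ub) b1).
rewrite (eq_integral (cst 1%E)) => [|u]; last first.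
  rewrite inE /= in_itv /= => /andP[au ub].
  by rewrite /uniform_pdf (le_trans a0' au) (le_trans (ltW ub) b1) subr0 invr1.
rewrite integral_cst //= mul1e lebesgue_measure_itv /= lte_fin.
by move: ab; rewrite le_eqVlt => /predU1P[->|->] //; rewrite ltxx subrr.
Qed.

Lemma code_law w :
  uniform_prob (@ltr01 R) [set u | code (size w) (y, u) = w] = (p (rev w) y)%:E.
Proof.
have [l0 l1] := lower_bounds w.
have mE : measurable [set u : R | code (size w) (y, u) = w].
  rewrite (_ : [set _ | _] = xsection [set yu | code (size w) yu = w] y).
    by apply: measurable_xsection; exact: measurable_code.
  by apply/seteqP; split => u; rewrite /xsection /= inE.
pose P : probability _ R := uniform_prob (@ltr01 R).
have Pitv a b : 0 <= a -> a <= b -> b <= 1 -> P `[a, b[%classic = (b - a)%:E.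
  exact: uniform_prob_itvco.
have P01 : P (~` `[0, 1[%classic) = 0%E.
  by rewrite probability_setC // Pitv // subr0 subee.
change (P [set u | code (size w) (y, u) = w] = (p (rev w) y)%:E).
(* [codeP] describes the code only on [0, 1), and the rest of the line is a null set. *)
rewrite (measureDI P mE (measurable_itv `[0, 1[)).
rewrite [X in (X + _)%E](_ : _ = 0%E) ?add0e; last first.
  apply: (@subset_measure0 _ _ _ P _ (~` `[0, 1[%classic)) => //.
  - exact: measurableD.
  - exact: measurableC.
transitivity (P `[lower w y, lower w y + p (rev w) y[%classic); last first.
  by rewrite Pitv // ?lerDl // addrAC subrr add0r.
congr (P _).
apply/seteqP; split => u /=; rewrite !in_itv /=.
  by case=> /eqP + u01; rewrite codeP.
move=> /andP[h1 h2].
have u01 : 0 <= u < 1 by rewrite (le_trans l0 h1) (lt_le_trans h2 l1).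
by split => //; apply/eqP; rewrite codeP // h1.
Qed.

End fixed_fibre.

Definition random_seq (yu : Y * R) (k : nat) : A := head a0 (code k.+1 yu).

Lemma mkseq_random_seq yu k : mkseq (random_seq yu) k = rev (code k yu).
Proof.
elim: k => // k ih; rewrite /mkseq -addn1 iotaD map_cat -/(mkseq _ _) ih add0n.
by rewrite addn1 [code k.+1 _]/= rev_cons -cats1.
Qed.

Lemma measurable_random_seq k a : measurable [set yu | random_seq yu k = a].
Proof.
rewrite (_ : [set _ | _] = \bigcup_(w : k.-tuple A) [set yu | code k.+1 yu = a :: w]).
  apply: fin_bigcup_measurable => [|w _]; first exact: finite_finset.
  exact: measurable_code.
apply/seteqP; split => yu /=; last by move=> [w _ /= [<- _]].
have/eqP sk := size_code k yu.
by move=> <-; exists (Tuple sk).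
Qed.

(** The consistency conditions are asked at the single point [y], because the densities used for the
    disintegration satisfy them only for almost every [y]. *)
Lemma random_seq_law y w :
  (forall v, 0 <= p v y) -> p [::] y = 1 ->
  (forall v, p v y = \sum_a p (rcons v a) y) ->
  uniform_prob (@ltr01 R) [set u | mkseq (random_seq (y, u)) (size w) = w] =
    (p w y)%:E.
Proof.
move=> p0 p1 pS; rewrite -[w in RHS]revK -code_law //; congr uniform_prob.
apply/seteqP; split => u /=; rewrite size_rev mkseq_random_seq.
  by move=> {2}<-; rewrite revK.
by move=> ->; rewrite revK.
Qed.

End coding.

(** * Riesz representation on a compact metric space *)

Definition bounded_fct (R : realType) (T : Type) (f : T -> R) : Prop :=
  exists M, forall x, `|f x| <= M.

Section bounded_functions.
Context (R : realType) (T : Type).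
Implicit Types f g : T -> R.

Lemma bounded_fct_cst (c : R) : bounded_fct (fun _ : T => c).
Proof. by exists `|c|. Qed.

Lemma bounded_fctD f g :
  bounded_fct f -> bounded_fct g -> bounded_fct (fun x => f x + g x).
Proof.
move=> [M fM] [N gN]; exists (M + N) => x.
by rewrite (le_trans (ler_normD _ _)) // lerD.
Qed.

Lemma bounded_fctM f g :
  bounded_fct f -> bounded_fct g -> bounded_fct (fun x => f x * g x).
Proof.
by move=> [M fM] [N gN]; exists (M * N) => x; rewrite normrM ler_pM.
Qed.

Lemma bounded_fctN f : bounded_fct f -> bounded_fct (fun x => - f x).
Proof. by move=> [M fM]; exists M => x; rewrite normrN. Qed.

Lemma bounded_fctB f g :
  bounded_fct f -> bounded_fct g -> bounded_fct (fun x => f x - g x).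
Proof. by move=> bf bg; apply: bounded_fctD => //; exact: bounded_fctN. Qed.

Lemma bounded_fct_sum (I : Type) (r : seq I) (f : I -> T -> R) :
  (forall i, bounded_fct (f i)) -> bounded_fct (fun x => \sum_(i <- r) f i x).
Proof.
move=> bf; elim: r => [|i r ih].
  by exists 0 => x; rewrite big_nil normr0.
rewrite (_ : (fun x => _) = fun x => f i x + \sum_(j <- r) f j x).
  exact: bounded_fctD.
by apply/funext => x; rewrite big_cons.
Qed.

Lemma bounded_fct_indic (E : set T) : bounded_fct (\1_E : T -> R).
Proof.
by exists 1 => x; rewrite indicE normr_nat lern1 leq_b1.
Qed.

Lemma bounded_fct_comp (U : Type) (h : U -> T) f :
  bounded_fct f -> bounded_fct (f \o h).
Proof. by move=> [M fM]; exists M => x /=. Qed.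

End bounded_functions.

Section probability_expectation.
Context d (T : measurableType d) (R : realType) (P : probability T R).
Implicit Types f g : T -> R.

Lemma bounded_integrable f :
  measurable_fun setT f -> bounded_fct f -> P.-integrable setT (EFin \o f).
Proof.
move=> mf [M fM]; apply: measurable_bounded_integrable => //.
  exact: fin_num_fun_lty.
exists M; split; first exact: num_real.
by move=> N MN x _; exact: le_trans (fM x) (ltW MN).
Qed.

Lemma Rintegral_prob_cst (c : R) : \int[P]_x c = c.
Proof.
rewrite Rintegral_cst // [X in fine X](_ : _ = 1%E) ?mulr1 //.
exact: probability_setT.
Qed.

Lemma Rintegral_close f g (e : R) :
  measurable_fun setT f -> bounded_fct f ->
  measurable_fun setT g -> bounded_fct g ->
  (forall x, `|f x - g x| <= e) -> `|\int[P]_x f x - \int[P]_x g x| <= e.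
Proof.
move=> mf bf mg bg fg.
have If := bounded_integrable mf bf; have Ig := bounded_integrable mg bg.
rewrite -RintegralB // -(Rintegral_prob_cst e).
have mfg : measurable_fun setT (fun x => f x - g x).
  exact: measurable_funB.
apply: le_trans (le_normr_Rintegral _ _) _ => //.
  by apply: bounded_integrable => //; exact: bounded_fctB.
apply: le_Rintegral => //.
- apply: bounded_integrable; first exact: measurableT_comp.
  by have [M h] := bounded_fctB bf bg; exists M => x; rewrite normr_id.
- by apply: bounded_integrable; [exact: measurable_cst|exact: bounded_fct_cst].
Qed.

Lemma Rintegral_sum (I : Type) (r : seq I) (f : I -> T -> R) :
  (forall i, measurable_fun setT (f i)) -> (forall i, bounded_fct (f i)) ->
  \int[P]_x (\sum_(i <- r) f i x) = \sum_(i <- r) \int[P]_x f i x.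
Proof.
move=> mf bf; elim: r => [|i r ih].
  under eq_Rintegral do rewrite big_nil.
  by rewrite big_nil Rintegral_prob_cst.
under eq_Rintegral do rewrite big_cons.
rewrite big_cons RintegralD ?ih //; first exact: bounded_integrable.
apply: bounded_integrable; first exact: measurable_sum.
exact: bounded_fct_sum.
Qed.

Lemma Rintegral_indic (E : set T) :
  measurable E -> \int[P]_x (\1_E x) = fine (P E).
Proof. by move=> mE; rewrite /Rintegral integral_indic // setIT. Qed.

Lemma Rintegral_distribution d' (U : measurableType d') (X : {mfun T >-> U})
    (g : U -> R) : measurable_fun setT g -> bounded_fct g ->
  \int[distribution P X]_y g y = \int[P]_x g (X x).
Proof.
move=> mg bg; congr fine; rewrite integral_distribution //.
  exact/measurable_EFinP.
apply: bounded_integrable; last exact: bounded_fct_comp.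
exact: measurableT_comp.
Qed.

Lemma EFin_Rintegral f : measurable_fun setT f -> bounded_fct f ->
  (\int[P]_x (f x)%:E)%E = (\int[P]_x f x)%:E.
Proof.
move=> mf bf; rewrite /Rintegral fineK //.
by apply: integrable_fin_num => //; exact: bounded_integrable.
Qed.

End probability_expectation.

Section cantor_cylinders.

Lemma cylinder_nbhs (x : cantor_space) n :
  nbhs x [set y : cantor_space | mkseq y n = mkseq x n].
Proof.
elim: n => [|n ih].
  by apply: filterS (filterT : nbhs x setT) => y _.
have : nbhs x [set y : cantor_space | y n = x n].
  apply: (@proj_continuous nat (fun=> bool) n x [set x n]).
  exact: discrete_set1.
apply: filterS2 ih => y /= yn1 yn.
by rewrite /mkseq -addn1 iotaD !map_cat /= -!/(mkseq _ _) yn1 add0n yn.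
Qed.

(** Otherwise, points outside [V] sharing longer and longer prefixes with [x] would converge to [x]
    coordinatewise, hence in the product topology. *)
Lemma cylinder_sub_nbhs (x : cantor_space) (V : set cantor_space) : nbhs x V ->
  exists n, forall y : cantor_space, mkseq y n = mkseq x n -> V y.
Proof.
move=> xV; apply: contrapT => /forallNP noV.
have {}noV n : exists y : cantor_space, mkseq y n = mkseq x n /\ ~ V y.
  by have /existsNP[y /not_implyP] := noV n; exists y.
pose u n := projT1 (cid (noV n)).
have uP n : mkseq (u n) n = mkseq x n /\ ~ V (u n).
  by rewrite /u; case: cid.
have ux : u @ \oo --> x.
  apply/cvg_sup => i U [? /= [[W oW <-]]] /= Wx /filterS; apply.
  exists i.+1 => // n /= ni; have [un _] := uP n.
  suff -> : u n i = x i by [].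
  by rewrite -(nth_mkseq false (u n) ni) un nth_mkseq.
have [N _ /(_ N (leqnn N))] := ux V xV.
by have [] := uP N.
Qed.

(** Compactness: otherwise there is a bad pair for each prefix length. Near a cluster point of the
    first members, both members of a late pair share with that point a prefix on which [h] varies by
    less than e / 2. *)
Lemma cantor_uniform (R : realType) (h : cantor_space -> R) (e : R) :
  continuous h -> 0 < e -> exists n, forall x y : cantor_space,
    mkseq x n = mkseq y n -> `|h x - h y| <= e.
Proof.
move=> ch e0; apply: contrapT => /forallNP no.
have {}no n : exists xy : cantor_space * cantor_space,
    mkseq xy.1 n = mkseq xy.2 n /\ e < `|h xy.1 - h xy.2|.
  have /existsNP[x /existsNP[y /not_implyP[xy /negP]]] := no n.
  by rewrite -ltNge => exy; exists (x, y).
pose u n := projT1 (cid (no n)).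
have uP n : mkseq (u n).1 n = mkseq (u n).2 n /\ e < `|h (u n).1 - h (u n).2|.
  by rewrite /u; case: cid.
have [x [_ cx]] : [set: cantor_space] `&`
    cluster ((fun n => (u n).1) @ \oo) !=set0.
  by apply: cantor_space_compact; exact: filterT.
have [m hm] : exists m, forall y : cantor_space,
    mkseq y m = mkseq x m -> `|h x - h y| < e / 2.
  apply: (@cylinder_sub_nbhs x [set y | `|h x - h y| < e / 2]).
  have e2 : 0 < e / 2 by rewrite divr_gt0.
  by have /cvgrPdist_lt/(_ _ e2) := ch x.
have [n mn xn] : exists2 n, (m <= n)%N & mkseq (u n).1 m = mkseq x m.
  have [_ [[n mn <-] xn]] := cx [set (u n).1 | n in [set n | (m <= n)%N]] _
    (filterS (fun n mn => ex_intro2 _ _ n mn erefl) (nbhs_infty_ge m))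
    (cylinder_nbhs x m).
  by exists n.
have [unn] := uP n; apply/negP; rewrite -leNgt.
have yn : mkseq (u n).2 m = mkseq x m.
  have tk (z : cantor_space) : mkseq z m = take m (mkseq z n).
    by rewrite -map_take take_iota (minn_idPl mn).
  by rewrite tk -unn -tk.
rewrite (_ : h _ - h _ = (h x - h (u n).2) - (h x - h (u n).1)); last by ring.
rewrite (le_trans (ler_normB _ _)) // [leRHS]splitr lerD // ltW //; exact: hm.
Qed.

End cantor_cylinders.

(** The axioms concern all bounded functions, continuous or not. Limits of orbit averages have this
    stronger property, and evaluating [L] at discontinuous indicators is what makes the Riesz
    theorem below short. *)
Definition positive_functional (R : realType) (K : Type) (L : (K -> R) -> R) :=
  [/\ forall f g, bounded_fct f -> bounded_fct g ->
        L (fun x => f x + g x) = L f + L g,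
      forall c f, bounded_fct f -> L (fun x => c * f x) = c * L f,
      forall f, bounded_fct f -> (forall x, 0 <= f x) -> 0 <= L f
    & L (fun=> 1) = 1].

Section positive_functional_theory.
Context (R : realType) (K : Type) (L : (K -> R) -> R).
Hypothesis HL : positive_functional L.

Lemma functional_cst c : L (fun=> c) = c.
Proof.
case: HL => _ LZ _ L1.
rewrite -[RHS]mulr1 -L1 -LZ; last exact: bounded_fct_cst.
by congr L; apply/funext => x; rewrite mulr1.
Qed.

Lemma functionalN f : bounded_fct f -> L (fun x => - f x) = - L f.
Proof.
case: HL => _ LZ _ _ bf; rewrite -[RHS]mulN1r -LZ //.
by congr L; apply/funext => x; rewrite mulN1r.
Qed.

Lemma functionalB f g : bounded_fct f -> bounded_fct g ->
  L (fun x => f x - g x) = L f - L g.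
Proof.
case: (HL) => LD _ _ _ bf bg; rewrite LD ?functionalN //.
exact: bounded_fctN.
Qed.

Lemma functional_le f g : bounded_fct f -> bounded_fct g ->
  (forall x, f x <= g x) -> L f <= L g.
Proof.
case: (HL) => _ _ Lp _ bf bg fg; rewrite -subr_ge0 -functionalB //.
by apply: Lp => [|x]; [exact: bounded_fctB|rewrite subr_ge0].
Qed.

Lemma functional_close f g e : bounded_fct f -> bounded_fct g ->
  (forall x, `|f x - g x| <= e) -> `|L f - L g| <= e.
Proof.
move=> bf bg fg; rewrite -functionalB // -(functional_cst e) ler_norml.
have bfg := bounded_fctB bf bg; have be := bounded_fct_cst K e.
rewrite -functionalN //; apply/andP; split; apply: functional_le => //.
- exact: bounded_fctN.
- by move=> x; have := fg x; rewrite ler_norml => /andP[].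
- by move=> x; have := fg x; rewrite ler_norml => /andP[].
Qed.

Lemma functional_sum (I : Type) (r : seq I) (f : I -> K -> R) :
  (forall i, bounded_fct (f i)) ->
  L (fun x => \sum_(i <- r) f i x) = \sum_(i <- r) L (f i).
Proof.
case: (HL) => LD _ _ _ bf; elim: r => [|i r ih].
  by rewrite big_nil -[RHS]functional_cst; congr L; apply/funext => x; rewrite big_nil.
rewrite big_cons -ih -LD //; last exact: bounded_fct_sum.
by congr L; apply/funext => x; rewrite big_cons.
Qed.

End positive_functional_theory.

(* [borel x0] carries no topology, hence this second pointed copy of [K]. *)
Definition pointed_at (K : Type) (x0 : K) : Type := K.
HB.instance Definition _ (R : realType) (K : pseudoMetricType R) (x0 : K) :=
  PseudoMetric.copy (pointed_at x0) K.
HB.instance Definition _ (R : realType) (K : pseudoMetricType R) (x0 : K) :=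
  isPointed.Build (pointed_at x0) x0.

(** The measurable structure of [R] is not of the form [borel y], so [continuous_borel] does not
    apply; open rays generate it. *)
Lemma continuous_borel_real (R : realType) (T : topologicalType) (x : T)
    (g : T -> R) :
  continuous g -> measurable_fun setT (g : borel x -> R).
Proof.
move=> cg; apply: (measurability _ (RGenOInfty.measurableE R)) => //.
move=> _ [_ [r ->] <-]; rewrite setTI; apply: sub_sigma_algebra.
by apply: (open_comp (fun z _ => cg z)); exact: rray_open.
Qed.

Lemma continuous_bounded_fct (R : realType) (T : topologicalType) (g : T -> R) :
  compact [set: T] -> continuous g -> bounded_fct g.
Proof.
move=> cT cg; have cgw : {within [set: T], continuous g}.
  exact: continuous_subspaceT.
have [T0|T0] := pselect ([set: T] !=set0); last first.
  by exists 0 => x; case: T0; exists x.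
have [a _ ga] := compact_EVT_max T0 cT cgw.
have [b _ gb] := compact_EVT_min T0 cT cgw.
exists (Num.max (g a) (- g b)) => x; rewrite ler_norml lerNl !le_max lerN2.
by rewrite ga ?gb ?orbT // in_setT.
Qed.

Section riesz.
Context (R : realType) (K : metricType R) (x0 : K) (L : (K -> R) -> R).
Hypothesis cK : compact [set: K].
Hypothesis HL : positive_functional L.

Lemma compact_metric_cantor_surj :
  exists2 c : cantor_space -> K, continuous c & forall x, exists z, c z = x.
Proof.
have [f cf] := @cantor_surj R (pointed_at x0) cK (@metric_hausdorff R K).
exists f => // x; have [z _ zx] := @surj _ _ _ _ f x I.
by exists z.
Qed.

(* As [L] is also defined on discontinuous functions, a section [rho] of a
   continuous surjection [c] from the Cantor space gives consistent masses
   [L \1_(rho^-1 cylinder)]; the measure is the image under [c] of the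
   corresponding law on the Cantor space. *)
Theorem riesz_representation : exists eta : probability (borel x0) R,
  forall g : K -> R, continuous g -> (\int[eta]_x (g x)%:E)%E = (L g)%:E.
Proof.
have [c cc surjc] := compact_metric_cantor_surj.
pose rho x := projT1 (cid (surjc x)).
have rhoK x : c (rho x) = x by rewrite /rho; case: cid.
pose p (w : seq bool) (_ : unit) : R :=
  L \1_[set x | mkseq (rho x) (size w) = w].
pose P : probability _ R := uniform_prob (@ltr01 R).
pose s (u : R) : cantor_space := random_seq false p (tt, u).
have ms k b : measurable [set u : R | s u k = b].
  have mp w : measurable_fun setT (p w) by [].
  have := measurable_xsection tt (measurable_random_seq false mp k b).
  rewrite (_ : xsection _ _ = [set u : R | s u k = b]) //.
  by apply/seteqP; split => u; rewrite /xsection /= inE.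
have ms_cyl w : measurable [set u : R | mkseq (s u) (size w) = w].
  elim/last_ind: w => [|w b ih]; first by rewrite (_ : [set _ | _] = setT) //; apply/seteqP.
  rewrite (_ : [set _ | _] = [set u : R | mkseq (s u) (size w) = w] `&`
    [set u : R | s u (size w) = b]).
    apply: measurableI; [apply ih|apply ms].
  apply/seteqP; split => u /=; rewrite size_rcons mkseqS.
    by move=> /rcons_inj[].
  by move=> [-> ->].
have mcs : measurable_fun setT (c \o s : measurableTypeR R -> borel x0).
  apply: (@measurability _ _ _ (borel x0) setT _ (@open K)) => //.
  move=> _ [B oB <-]; rewrite setTI.
  (* An open subset of the Cantor space is the union of the cylinders it contains, and words are
     countable. *)
  pose D := [set w : seq bool | [set z : cantor_space | mkseq z (size w) = w] `<=` c @^-1` B].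
  rewrite (_ : _ @^-1` _ = \bigcup_(w in D) [set u : R | mkseq (s u) (size w) = w]).
    rewrite bigcup_mkcond; apply: countable_bigcupT_measurable => [|w].
      exact: countableP.
    by case: ifP => _; [exact: ms_cyl|exact: measurable0].
  apply/seteqP; split => u /=.
    move=> Bu; have [|n hn] := @cylinder_sub_nbhs (s u) (c @^-1` B).
      by apply: (cc (s u)); apply: open_nbhs_nbhs.
    exists (mkseq (s u) n); last by rewrite /= size_mkseq.
    by move=> z /=; rewrite size_mkseq => /hn.
  by move=> [w Dw /Dw].
have law w : P [set u | mkseq (s u) (size w) = w] = (p w tt)%:E.
  apply: random_seq_law => // [v||v].
  - case: HL => _ _ Lp _; apply: Lp; first exact: bounded_fct_indic.
    by move=> x; rewrite indicE ler0n.
  - case: HL => _ _ _ <-; congr L; apply/funext => x.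
    by rewrite indicE mem_set.
  - rewrite -functional_sum //; last by move=> b; exact: bounded_fct_indic.
    congr L; apply/funext => x; rewrite big_bool /= !indicE -natrD.
    have inb (b : bool) : (x \in [set x | mkseq (rho x) (size (rcons v b)) = rcons v b])
        = (mkseq (rho x) (size v) == v) && (rho x (size v) == b).
      by rewrite -eqseq_rcons -mkseqS -(size_rcons v b); apply/idP/eqP; rewrite in_setE.
    rewrite !inb (_ : (x \in _) = (mkseq (rho x) (size v) == v)); last first.
      by apply/idP/eqP; rewrite in_setE.
    by case: eqP => //=; case: (rho x _).
pose Z : {mfun _ >-> borel x0} := mfun_Sub (mem_set mcs).
exists (distribution P Z) => g cg.
have mg : measurable_fun setT (g : borel x0 -> R).
  exact: continuous_borel_real.
have bg : bounded_fct g by exact: continuous_bounded_fct.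
rewrite EFin_Rintegral //; congr EFin; apply/eqP; rewrite -subr_eq0 -normr_le0.
apply/ler_addgt0Pr => e e0; rewrite add0r.
have e20 : 0 < e / 2 by rewrite divr_gt0.
(* The step function [ap], constant on cylinders of length [n], is the bridge: its integral along
   [s] and the value of [L] on [ap \o rho] are the same combination of cylinder masses. Replacing
   [g] by [ap] costs e / 2 on each side. *)
have [|n hn] := @cantor_uniform R (g \o c) (e / 2) _ e20.
  by move=> z; apply: continuous_comp; [exact: cc|exact: cg].
pose v (w : n.-tuple bool) : R := g (c (nth false w)).
pose ap (z : cantor_space) : R :=
  \sum_(w : n.-tuple bool) v w * \1_[set z' | mkseq z' (size w) = w] z.
have apP z : `|g (c z) - ap z| <= e / 2.
  rewrite /ap (bigD1 [tuple of mkseq z n]) //= big1 ?addr0; last first.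
    move=> w wz; rewrite indicE memNset ?mulr0 //= => zw; case/eqP: wz.
    by apply: val_inj; rewrite /= -zw size_tuple.
  rewrite indicE mem_set ?mulr1 /= ?size_mkseq //; apply: hn.
  have nthE (t : seq bool) : size t = n -> mkseq (nth false t) n = t.
    by move=> <-; rewrite mkseq_nth.
  by rewrite nthE ?size_mkseq.
have bi (w : n.-tuple bool) (h : K -> cantor_space) :
    bounded_fct (fun x => v w * \1_[set z' | mkseq z' (size w) = w] (h x)).
  apply: bounded_fctM; first exact: bounded_fct_cst.
  exact: (bounded_fct_comp h (bounded_fct_indic _ _)).
have bis (w : n.-tuple bool) :
    bounded_fct (fun u => v w * \1_[set z' | mkseq z' (size w) = w] (s u)).
  apply: bounded_fctM; first exact: bounded_fct_cst.
  exact: (bounded_fct_comp s (bounded_fct_indic _ _)).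
have is_indic (w : n.-tuple bool) :
    (fun u => \1_[set z' | mkseq z' (size w) = w] (s u)) =
    \1_[set u : R | mkseq (s u) (size w) = w] :> (R -> R).
  by apply/funext => u; rewrite !indicE.
have mis (w : n.-tuple bool) : measurable_fun setT
    (fun u => v w * \1_[set z' | mkseq z' (size w) = w] (s u) : R).
  apply: measurable_funM; first exact: measurable_cst.
  by rewrite is_indic; exact: measurable_indic.
have Eap : \int[P]_u ap (s u) = L (ap \o rho).
  rewrite Rintegral_sum // (functional_sum HL) //; apply: eq_bigr => w _.
  rewrite RintegralZl //; last first.
    rewrite is_indic; apply: bounded_integrable; first by apply: measurable_indic; apply: ms_cyl.
    exact: bounded_fct_indic.
  rewrite is_indic Rintegral_indic ?[X in fine X](law w) /=; last exact: ms_cyl.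
  case: HL => _ LZ _ _; rewrite -LZ //.
  exact: bounded_fct_indic.
rewrite (splitr e) (_ : _ - _ = (\int[distribution P Z]_x g x - \int[P]_u ap (s u))
  + (L (ap \o rho) - L g)); last by rewrite Eap; ring.
rewrite (le_trans (ler_normD _ _)) // lerD //.
  rewrite Rintegral_distribution //; apply: Rintegral_close => //.
  - exact: measurableT_comp.
  - exact: bounded_fct_comp.
  - exact: measurable_sum.
  - exact: bounded_fct_sum.
  - by move=> u; exact: apP.
rewrite distrC; apply: functional_close => //.
- exact: bounded_fct_sum.
- by move=> x; rewrite -{1}(rhoK x); exact: apP.
Qed.

End riesz.

(** * Density of the continuous functions in L1 *)

Section metric_continuity.
Context (R : realType) (U : metricType R).

Lemma metric_continuousP (V : metricType R) (f : U -> V) :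
  continuous f <-> forall x e, 0 < e ->
    exists2 d, 0 < d & forall y, mdist x y < d -> mdist (f x) (f y) < e.
Proof.
split=> [cf x e e0|h x].
  have /metricType_numDomainType.cvgrPdist_lt/(_ e e0) := cf x.
  move=> /nbhs_ballP[d d0 hd]; exists d => // y xy.
  by apply: hd; rewrite /= ballEmdist.
apply/metricType_numDomainType.cvgrPdist_lt => e e0.
have [d d0 hd] := h x e e0; apply/nbhs_ballP; exists d => // y.
by rewrite /= ballEmdist; exact: hd.
Qed.

Lemma metric_continuous_real (f : U -> R) :
  (forall x e, 0 < e ->
    exists2 d, 0 < d & forall y, mdist x y < d -> `|f x - f y| < e) ->
  continuous f.
Proof.
move=> h x; apply/cvgrPdist_lt => e e0; have [d d0 hd] := h x e e0.
by apply/nbhs_ballP; exists d => // y; rewrite /= ballEmdist; exact: hd.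
Qed.

Lemma lipschitz_continuous (f : U -> R) (C : R) :
  (forall x y, `|f x - f y| <= C * mdist x y) -> continuous f.
Proof.
move=> h; apply: metric_continuous_real => x e e0.
have C0 : 0 < `|C| + 1 by rewrite ltr_wpDl.
exists (e / (`|C| + 1)); first exact: divr_gt0.
move=> y; rewrite ltr_pdivlMr // mulrC => hd.
apply: le_lt_trans hd; apply: le_trans (h x y) _.
rewrite ler_wpM2r ?mdist_ge0 //.
by rewrite (le_trans (ler_norm _)) // lerDl.
Qed.

Definition dist_to (E : set U) (x : U) : R := inf ((mdist x : U -> R) @` E).

Lemma dist_to_lbound (E : set U) (x : U) : has_lbound ((mdist x : U -> R) @` E).
Proof. by exists 0 => _ [z _ <-]; exact: mdist_ge0. Qed.

Lemma dist_to_le (E : set U) (x z : U) : E z -> dist_to E x <= mdist x z.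
Proof. by move=> Ez; apply: ge_inf; [exact: dist_to_lbound|exists z]. Qed.

Lemma dist_to_ge (E : set U) (x : U) (r : R) : E !=set0 -> (forall z, E z -> r <= mdist x z) ->
  r <= dist_to E x.
Proof.
move=> [z Ez] h; apply: lb_le_inf; first by exists (mdist x z), z.
by move=> _ [t Et <-]; exact: h.
Qed.

Lemma dist_to_lipschitz (E : set U) (x y : U) : E !=set0 ->
  `|dist_to E x - dist_to E y| <= mdist x y.
Proof.
move=> E0; have half (a b : U) : dist_to E a - dist_to E b <= mdist a b.
  rewrite lerBlDl -lerBlDr; apply: dist_to_ge => // z Ez; rewrite lerBlDr.
  by rewrite (le_trans (dist_to_le a Ez)) // addrC metric_triangle.
by rewrite ler_norml half andbT lerNl opprB metric_sym half.
Qed.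

End metric_continuity.

Section L1_density.
Context (R : realType) (Y : metricType R) (y0 : Y).
Variable tau : probability (borel y0) R.

Definition L1_approximable (f : borel y0 -> R) : Prop := forall e, 0 < e ->
  exists g : Y -> R, [/\ continuous g, bounded_fct g &
    \int[tau]_y `|f y - g y| <= e].

(** Approximants with values in [0, 1] can be multiplied without increasing errors, which gives
    stability under intersection. Measurability is included so that the class can be compared
    directly with the Borel sigma-algebra. *)
Definition unit_approximable (B : set (borel y0)) : Prop :=
  measurable B /\ forall e, 0 < e ->
  exists g : Y -> R, [/\ continuous g, forall y, 0 <= g y <= 1 &
    \int[tau]_y `|\1_B y - g y| <= e].

Lemma measurable_normB (f : borel y0 -> R) (g : Y -> R) :
  measurable_fun setT f -> continuous g ->
  measurable_fun setT (fun y => `|f y - g y|).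
Proof.
move=> mf cg; apply: measurableT_comp => //; apply: measurable_funB => //.
exact: continuous_borel_real.
Qed.

Lemma bounded_normB (f g : Y -> R) : bounded_fct f -> bounded_fct g ->
  bounded_fct (fun y => `|f y - g y|).
Proof.
move=> bf bg; have [M h] := bounded_fctB bf bg.
by exists M => y; rewrite normr_id.
Qed.

Lemma bounded_fct01 (g : Y -> R) : (forall y, 0 <= g y <= 1) -> bounded_fct g.
Proof.
by move=> g01; exists 1 => y; have /andP[g0 g1] := g01 y; rewrite ger0_norm.
Qed.

Lemma le_Rintegral_bounded (f g : borel y0 -> R) :
  measurable_fun setT f -> bounded_fct f ->
  measurable_fun setT g -> bounded_fct g ->
  (forall y, f y <= g y) -> \int[tau]_y f y <= \int[tau]_y g y.
Proof.
by move=> mf bf mg bg fg; apply: le_Rintegral => //; exact: bounded_integrable.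
Qed.

Lemma RintegralD_bounded (f g : borel y0 -> R) :
  measurable_fun setT f -> bounded_fct f ->
  measurable_fun setT g -> bounded_fct g ->
  \int[tau]_y (f y + g y) = \int[tau]_y f y + \int[tau]_y g y.
Proof.
by move=> mf bf mg bg; apply: RintegralD => //; exact: bounded_integrable.
Qed.

Lemma measure_bigcup_diff_small (B : (set (borel y0))^nat) (e : R) :
  (forall n, measurable (B n)) -> {homo B : n m / (n <= m)%N >-> n `<=` m} ->
  0 < e -> exists n, fine (tau ((\bigcup_k B k) `\` B n)) <= e.
Proof.
move=> mB iB e0.
have mU : measurable (\bigcup_k B k) by exact: bigcupT_measurable.
pose D n := (\bigcup_k B k) `\` B n.
have mD n : measurable (D n) by exact: measurableD.
have D0 : \bigcap_n D n = set0.
  apply/seteqP; split => // y hy; have [[k _ Bky] _] := hy 0%N I.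
  by have [_] := hy k I.
have cv : (tau \o D) n @[n --> \oo] --> (0%:E : \bar R).
  rewrite -[X in _ --> X](measure0 tau) -D0; apply: nonincreasing_cvg_mu => //.
  - by apply: le_lt_trans (probability_le1 tau (mD 0%N)) _; rewrite ltry.
  - by rewrite D0.
  - move=> n m nm; apply/subsetPset => y [Uy Bmy]; split => // Bny; apply: Bmy.
    exact: iB nm _ Bny.
have [_ /cvgrPdist_le /(_ e e0) [N _ /(_ N (leqnn N))]] := (fine_cvgP _ _).1 cv.
move=> /=; rewrite sub0r normrN => h; exists N.
exact: le_trans (ler_norm _) h.
Qed.

(** The functions min(1, n d(y, G^c)) increase to the indicator of [G], and they equal 1 on sets
    that exhaust [G]. The bound from below the indicator serves for comparing two measures on open
    sets. *)
Lemma open_lower_approx (G : set (borel y0)) (e : R) : @open Y G -> 0 < e ->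
  exists g : Y -> R, [/\ continuous g, forall y, 0 <= g y <= 1,
    forall y, g y <= \1_G y & \int[tau]_y `|\1_G y - g y| <= e].
Proof.
move=> oG e0; have mG : measurable G by exact: sub_sigma_algebra.
(* When the complement is empty, the distance to it is an infimum over the empty set and says
   nothing. *)
have [GC0|GC0] := pselect ((~` G) !=set0); last first.
  have G1 y : \1_G y = 1 :> R.
    by rewrite indicE mem_set //; apply: contrapT => Gy; apply: GC0; exists y.
  exists (fun=> 1); split => [|y|y|]; first exact: cst_continuous.
  - by rewrite ler01 lexx.
  - by rewrite G1.
  rewrite (_ : (fun y => _) = fun=> 0); first by rewrite Rintegral_prob_cst ltW.
  by apply/funext => y; rewrite G1 subrr normr0.
pose dG := dist_to (~` G).
have dG0 y : ~ G y -> dG y = 0.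
  move=> Gy; apply/eqP; rewrite eq_le -{1}(mdistxx y) dist_to_le //=.
  by apply: dist_to_ge => // z _; exact: mdist_ge0.
have dGp y : G y -> 0 < dG y.
  move=> Gy; have /nbhs_ballP[r /= r0 hr] : nbhs y G by exact: open_nbhs_nbhs.
  apply: lt_le_trans r0 _; apply: dist_to_ge => // z Gz; rewrite leNgt.
  by apply/negP => yz; apply: Gz; apply: hr; rewrite ballEmdist.
have dG_ge0 y : 0 <= dG y.
  by have [/dGp/ltW|/dG0->] := pselect (G y).
have cdG : continuous dG.
  by apply: (@lipschitz_continuous _ _ _ 1) => x y; rewrite mul1r dist_to_lipschitz.
pose B n : set (borel y0) := [set y | 1 <= n%:R * dG y].
have cn n : continuous (fun y => n%:R * dG y).
  by move=> y; apply: cvgM; [exact: cvg_cst|exact: cdG].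
have mB n : measurable (B n).
  have mn := @continuous_borel_real _ _ y0 _ (cn n).
  have := mn measurableT _ (measurable_itv `[1, +oo[); rewrite setTI.
  rewrite (_ : _ @^-1` _ = B n) //; apply/seteqP.
  by split => y; rewrite /B /= in_itv /= andbT.
have BG : \bigcup_n B n = G.
  apply/seteqP; split => y.
    move=> [n _]; rewrite /B /= => h; apply: contrapT => /dG0 Gy.
    by move: h; rewrite Gy mulr0 ler10.
  move=> Gy; exists (Num.truncn (dG y)^-1).+1 => //; rewrite /B /=.
  rewrite -ler_pdivrMr ?dGp // div1r ltW //.
  have /truncn_itv/andP[_] : 0 <= (dG y)^-1 by rewrite invr_ge0 ltW // dGp.
  by [].
have [|n hn] := @measure_bigcup_diff_small B e mB _ e0.
  move=> n m nm y; rewrite /B /= => h; apply: le_trans h _.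
  by rewrite ler_wpM2r // ler_nat.
pose g y := Num.min 1 (n%:R * dG y).
have cg : continuous g.
  move=> y; have c1 : {for y, continuous (fun _ : Y => 1 : R^o)} by exact: cvg_cst.
  exact: (continuous_min c1 (cn n y)).
have g01 y : 0 <= g y <= 1.
  by rewrite /g le_min ge_min ler01 lexx /= mulr_ge0.
exists g; split => //.
  move=> y; have /andP[_ g1] := g01 y; rewrite indicE.
  have [Gy|Gy] := pselect (G y); first by rewrite mem_set.
  by rewrite memNset // /g dG0 // mulr0 min_r.
apply: le_trans hn.
have mGB : measurable ((\bigcup_k B k) `\` B n).
  by apply: measurableD => //; exact: bigcupT_measurable.
rewrite -Rintegral_indic //; apply: le_Rintegral_bounded.
- by apply: measurable_normB => //; exact: measurable_indic.
- apply: bounded_normB; [exact: bounded_fct_indic|exact: bounded_fct01].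
- exact: measurable_indic.
- exact: bounded_fct_indic.
move=> y; rewrite BG.
have [Gy|Gy] := pselect (G y); last first.
  by rewrite !indicE !memNset // => [|[]//]; rewrite /g dG0 // mulr0 min_r // subrr normr0.
have [Bny|Bny] := pselect (B n y).
  rewrite !indicE mem_set // memNset => [|[]//].
  by rewrite /g min_l // subrr normr0.
rewrite !indicE !mem_set //; have /andP[g0 g1] := g01 y.
by rewrite ger0_norm ?subr_ge0 // gerBl.
Qed.

Lemma unit_approximable_open (G : set Y) : open G -> unit_approximable G.
Proof.
move=> oG; split; first exact: sub_sigma_algebra.
move=> e e0; have [g [cg g01 _ gG]] := open_lower_approx oG e0.
by exists g.
Qed.

Lemma unit_approximableC (B : set (borel y0)) :
  unit_approximable B -> unit_approximable (~` B).
Proof.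
move=> [mB aB]; split; first exact: measurableC.
move=> e /aB[g [cg g01 gB]]; exists (fun y => 1 - g y); split.
- by move=> y; apply: cvgB; [exact: cvg_cst|exact: cg].
- by move=> y; have /andP[g0 g1] := g01 y; rewrite subr_ge0 g1 gerBl.
- rewrite (_ : (fun y => `|_ - _|) = fun y => `|\1_B y - g y|) //.
  apply/funext => y; rewrite !indicE in_setC; case: (y \in B) => /=.
    by rewrite -normrN; congr `|_|; ring.
  by rewrite -normrN; congr `|_|; ring.
Qed.

Lemma unit_approximableI (B C : set (borel y0)) :
  unit_approximable B -> unit_approximable C -> unit_approximable (B `&` C).
Proof.
move=> [mB aB] [mC aC]; split; first exact: measurableI.
move=> e e0; have e20 : 0 < e / 2 by rewrite divr_gt0.
have [g [cg g01 gB]] := aB _ e20; have [h [ch h01 hC]] := aC _ e20.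
have gh01 y : 0 <= g y * h y <= 1.
  have /andP[g0 g1] := g01 y; have /andP[h0 h1] := h01 y.
  by rewrite mulr_ge0 //= mulr_ile1.
have cgh : continuous (fun y => g y * h y).
  by move=> y; apply: cvgM; [exact: cg|exact: ch].
exists (fun y => g y * h y); split => //.
have mk (E : set (borel y0)) (k : Y -> R) : measurable E -> continuous k ->
    measurable_fun setT (fun y => `|\1_E y - k y| : R).
  by move=> mE ck; apply: measurable_normB => //; exact: measurable_indic.
have bk (E : set (borel y0)) (k : Y -> R) : (forall y, 0 <= k y <= 1) ->
    bounded_fct (fun y => `|\1_E y - k y| : R).
  move=> k01; apply: bounded_normB; [exact: bounded_fct_indic|exact: bounded_fct01].
rewrite (splitr e); apply: le_trans (lerD gB hC).
rewrite -RintegralD_bounded; [|exact: mk|exact: bk|exact: mk|exact: bk].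
apply: le_Rintegral_bounded.
- by apply: mk => //; exact: measurableI.
- exact: bk.
- by apply: measurable_funD; exact: mk.
- by apply: bounded_fctD; exact: bk.
move=> y; rewrite indicI /=.
rewrite (_ : _ * _ - _ = (\1_B y - g y) * \1_C y + g y * (\1_C y - h y)); last by ring.
apply: le_trans (ler_normD _ _) _; apply: lerD; rewrite normrM.
  by rewrite ler_piMr // indicE normr_nat lern1 leq_b1.
by have /andP[g0 g1] := g01 y; rewrite ler_piMl // ger0_norm.
Qed.

(** Finite unions follow from complements and intersections; continuity of the measure leaves at
    most e / 2 outside a finite union. *)
Lemma unit_approximable_bigcup (B : (set (borel y0))^nat) :
  (forall n, unit_approximable (B n)) -> unit_approximable (\bigcup_n B n).
Proof.
move=> aB; have mB n : measurable (B n) by have [] := aB n.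
have mU : measurable (\bigcup_n B n) by exact: bigcupT_measurable.
split => // e e0; have e20 : 0 < e / 2 by rewrite divr_gt0.
have aUB n : unit_approximable (\big[setU/set0]_(k < n) B k).
  elim: n => [|n ih]; first by rewrite big_ord0; exact: unit_approximable_open open0.
  rewrite big_ord_recr /= -[_ `|` _]setCK setCU.
  by apply: unit_approximableC; apply: unit_approximableI; exact: unit_approximableC.
pose C n := \big[setU/set0]_(k < n.+1) B k.
have aC n : unit_approximable (C n) by exact: aUB.
have mC n : measurable (C n) by have [] := aC n.
have CB : \bigcup_n C n = \bigcup_n B n by rewrite bigcup_bigsetU_bigcup.
have [|n] := @measure_bigcup_diff_small C (e / 2) mC _ e20.
  by move=> n m nm; exact: subset_bigsetU.
rewrite CB => hn; have [_ /(_ _ e20)[g [cg g01 gC]]] := aC n.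
exists g; split => //.
have mUC : measurable ((\bigcup_n B n) `\` C n) by exact: measurableD.
rewrite (splitr e); apply: le_trans (lerD gC hn).
rewrite -(Rintegral_indic _ mUC) -RintegralD_bounded.
- apply: le_Rintegral_bounded.
  + by apply: measurable_normB => //; exact: measurable_indic.
  + apply: bounded_normB; [exact: bounded_fct_indic|exact: bounded_fct01].
  + apply: measurable_funD; last exact: measurable_indic.
    by apply: measurable_normB => //; exact: measurable_indic.
  + apply: bounded_fctD; last exact: bounded_fct_indic.
    apply: bounded_normB; [exact: bounded_fct_indic|exact: bounded_fct01].
  + move=> y; rewrite (_ : _ - _ = (\1_(C n) y - g y) +
        (\1_(\bigcup_n B n) y - \1_(C n) y)); last by ring.
    apply: le_trans (ler_normD _ _) _; rewrite lerD2l.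
    have CU : C n y -> (\bigcup_n B n) y by rewrite -CB => Cy; exists n.
    rewrite !indicE.
    have [Cy|Cy] := pselect (C n y).
      by rewrite (mem_set Cy) (mem_set (CU Cy)) subrr normr0 ler0n.
    rewrite (memNset Cy) subr0.
    have [Uy|Uy] := pselect ((\bigcup_n B n) y).
      by rewrite !mem_set // normr1.
    by rewrite (memNset Uy) normr0 ler0n.
- by apply: measurable_normB => //; exact: measurable_indic.
- apply: bounded_normB; [exact: bounded_fct_indic|exact: bounded_fct01].
- exact: measurable_indic.
- exact: bounded_fct_indic.
Qed.

Lemma borel_unit_approximable (B : set (borel y0)) :
  measurable B -> unit_approximable B.
Proof.
apply: smallest_sub; last exact: unit_approximable_open.
split.
- exact: unit_approximable_open open0.
- by move=> C aC; rewrite setTD; exact: unit_approximableC.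
- exact: unit_approximable_bigcup.
Qed.

Lemma L1_approximable_indicZ (B : set (borel y0)) (c : R) :
  measurable B -> L1_approximable (fun y => c * \1_B y).
Proof.
move=> mB e e0; have [_ aB] := borel_unit_approximable mB.
have c0 : 0 < `|c| + 1 by rewrite ltr_wpDl.
have [g [cg g01 gB]] := aB _ (divr_gt0 e0 c0).
exists (fun y => c * g y); split.
- by move=> y; apply: cvgM; [exact: cvg_cst|exact: cg].
- by apply: bounded_fctM; [exact: bounded_fct_cst|exact: bounded_fct01].
under eq_Rintegral do rewrite -mulrBr normrM.
rewrite RintegralZl //; last first.
  apply: bounded_integrable.
    by apply: measurable_normB => //; exact: measurable_indic.
  apply: bounded_normB; [exact: bounded_fct_indic|exact: bounded_fct01].
rewrite ler_pdivlMr // in gB; apply: le_trans gB; rewrite mulrC ler_wpM2l ?lerDl //.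
by apply: Rintegral_ge0 => y _.
Qed.

Lemma L1_approximableD (f g : borel y0 -> R) :
  measurable_fun setT f -> bounded_fct f ->
  measurable_fun setT g -> bounded_fct g ->
  L1_approximable f -> L1_approximable g -> L1_approximable (fun y => f y + g y).
Proof.
move=> mf bf mg bg af ag e e0; have e20 : 0 < e / 2 by rewrite divr_gt0.
have [h [ch bh hf]] := af _ e20; have [k [ck bk kg]] := ag _ e20.
exists (fun y => h y + k y); split.
- by move=> y; apply: cvgD; [exact: ch|exact: ck].
- exact: bounded_fctD.
rewrite (splitr e); apply: le_trans (lerD hf kg).
have chk : continuous (fun y => h y + k y).
  by move=> y; apply: cvgD; [exact: ch|exact: ck].
rewrite -RintegralD_bounded; [|exact: measurable_normB|exact: bounded_normB
  |exact: measurable_normB|exact: bounded_normB].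
apply: le_Rintegral_bounded.
- by apply: measurable_normB => //; exact: measurable_funD.
- by apply: bounded_normB; exact: bounded_fctD.
- by apply: measurable_funD; exact: measurable_normB.
- by apply: bounded_fctD; exact: bounded_normB.
move=> y; apply: le_trans (ler_normD _ _).
by rewrite (_ : _ - _ = f y - h y + (g y - k y)) //; ring.
Qed.

Lemma L1_approximable_sum (I : Type) (r : seq I) (f : I -> borel y0 -> R) :
  (forall i, measurable_fun setT (f i)) -> (forall i, bounded_fct (f i)) ->
  (forall i, L1_approximable (f i)) ->
  L1_approximable (fun y => \sum_(i <- r) f i y).
Proof.
move=> mf bf af; elim: r => [|i r ih].
  move=> e e0; exists (fun=> 0); split; [exact: cst_continuous|exact: bounded_fct_cst|].
  under eq_Rintegral do rewrite big_nil subrr normr0.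
  by rewrite Rintegral_prob_cst ltW.
rewrite (_ : (fun y => _) = fun y => f i y + \sum_(j <- r) f j y).
  apply: L1_approximableD => //; first exact: measurable_sum.
  exact: bounded_fct_sum.
by apply/funext => y; rewrite big_cons.
Qed.

Lemma L1_approximable_unif (f : borel y0 -> R) :
  measurable_fun setT f -> bounded_fct f ->
  (forall e, 0 < e -> exists h : borel y0 -> R,
    [/\ measurable_fun setT h, bounded_fct h, L1_approximable h &
      forall y, `|f y - h y| <= e]) ->
  L1_approximable f.
Proof.
move=> mf bf hf e e0; have e20 : 0 < e / 2 by rewrite divr_gt0.
have [h [mh bh ah fh]] := hf _ e20; have [g [cg bg gh]] := ah _ e20.
exists g; split => //; rewrite (splitr e).
apply: le_trans (lerD (lexx _) gh); rewrite -{1}(Rintegral_prob_cst tau (e / 2)).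
rewrite -RintegralD_bounded; [|exact: measurable_cst|exact: bounded_fct_cst
  |exact: measurable_normB|exact: bounded_normB].
apply: le_Rintegral_bounded.
- exact: measurable_normB.
- exact: bounded_normB.
- by apply: measurable_funD; [exact: measurable_cst|exact: measurable_normB].
- by apply: bounded_fctD; [exact: bounded_fct_cst|exact: bounded_normB].
move=> y; rewrite (_ : _ - _ = (f y - h y) + (h y - g y)); last by ring.
by rewrite (le_trans (ler_normD _ _)) // lerD2r.
Qed.

(** The function (f + M) / e is nonnegative and bounded, so its integer part takes finitely many
    values. This yields a combination of indicators of Borel sets uniformly within [e] of [f]. *)
Theorem continuous_L1_dense (f : borel y0 -> R) :
  measurable_fun setT f -> bounded_fct f -> L1_approximable f.
Proof.
move=> mf bf; apply: L1_approximable_unif => // e e0.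
have [M fM] := bf.
pose q y := (f y + M) / e.
have q0 y : 0 <= q y.
  apply: divr_ge0; last exact: ltW.
  rewrite -lerBlDr sub0r.
  by have := fM y; rewrite ler_norml => /andP[].
have qN y : (Num.truncn (q y) < (Num.truncn (2 * M / e)).+1)%N.
  rewrite truncn_lt_nat //; have M0 : 0 <= M by rewrite (le_trans _ (fM y0)).
  have /truncn_itv/andP[_] : 0 <= 2 * M / e by apply: divr_ge0; [exact: mulr_ge0|exact: ltW].
  apply: le_lt_trans; rewrite ler_pM2r ?invr_gt0 // mulr_natl mulr2n lerD2r.
  by have := fM y; rewrite ler_norml => /andP[].
set N := (Num.truncn _).+1 in qN.
have mq : measurable_fun setT (q : borel y0 -> R).
  apply: measurable_funM; last exact: measurable_cst.
  by apply: measurable_funD => //; exact: measurable_cst.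
pose B (k : 'I_N) : set (borel y0) := [set y | Num.truncn (q y) = k].
have mB k : measurable (B k).
  have := mq measurableT _ (measurable_itv `[k%:R, k.+1%:R[); rewrite setTI.
  rewrite (_ : _ @^-1` _ = B k) //; apply/seteqP.
  split => y; rewrite /B /= in_itv /=; first by move=> /truncn_def.
  by move=> <-; exact: truncn_itv.
have mt (k : 'I_N) : measurable_fun setT (fun y : borel y0 => (e * k%:R - M) * \1_(B k) y).
  by apply: measurable_funM; [exact: measurable_cst|exact: measurable_indic].
have bt (k : 'I_N) : bounded_fct (fun y : borel y0 => (e * k%:R - M) * \1_(B k) y).
  by apply: bounded_fctM; [exact: bounded_fct_cst|exact: bounded_fct_indic].
exists (fun y => \sum_(k < N) (e * k%:R - M) * \1_(B k) y); split.
- exact: measurable_sum.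
- exact: bounded_fct_sum.
- by apply: L1_approximable_sum => // k; exact: L1_approximable_indicZ.
move=> y; rewrite (bigD1 (Ordinal (qN y))) //= big1 ?addr0 => [|k ky].
  rewrite indicE mem_set // mulr1.
  have /andP[t1 t2] := truncn_itv (q0 y).
  have fq : f y = e * q y - M by rewrite /q mulrCA divff ?gt_eqF // mulr1 addrK.
  rewrite fq opprB addrA subrK -mulrBr normrM (gtr0_norm e0).
  apply: ler_piMr; first exact: ltW.
  rewrite ger0_norm ?subr_ge0 // lerBlDl; apply: ltW.
  by rewrite -natr1 in t2.
rewrite indicE memNset ?mulr0 //= => yk; case/eqP: ky; apply: val_inj => /=.
by rewrite yk.
Qed.

End L1_density.

Section determined_by_continuous.
Context (R : realType) (Y : metricType R) (y0 : Y).

(** An approximation g from below of the indicator of an open set G gives P G <= int g dP + e = int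
    g dQ + e <= Q G + e, and conversely. Open sets are stable under intersection, so equality on
    them suffices. *)
Lemma probability_eq_continuous (P Q : probability (borel y0) R) :
  (forall g : Y -> R, continuous g -> bounded_fct g ->
    \int[P]_y g y = \int[Q]_y g y) ->
  forall B, measurable B -> P B = Q B.
Proof.
move=> PQ; have half (P' Q' : probability (borel y0) R) :
    (forall g : Y -> R, continuous g -> bounded_fct g ->
      \int[P']_y g y = \int[Q']_y g y) ->
    forall G : set (borel y0), @open Y G -> fine (P' G) <= fine (Q' G).
  move=> PQ' G oG; apply/ler_addgt0Pr => e e0.
  have mG : measurable G by exact: sub_sigma_algebra.
  have [g [cg g01 gG gP]] := open_lower_approx P' oG e0.
  have mg : measurable_fun setT (g : borel y0 -> R) by exact: continuous_borel_real.
  have bg := bounded_fct01 g01.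
  have mI : measurable_fun setT (\1_G : borel y0 -> R) by exact: measurable_indic.
  have bI := bounded_fct_indic R G.
  rewrite -!Rintegral_indic //.
  apply: (@le_trans _ _ (\int[P']_y (g y + `|\1_G y - g y|))).
    apply: le_Rintegral_bounded => //.
    - by apply: measurable_funD => //; exact: measurable_normB.
    - by apply: bounded_fctD => //; exact: bounded_normB.
    - by move=> y; rewrite -lerBlDl ler_norm.
  rewrite RintegralD_bounded //; [|exact: measurable_normB|exact: bounded_normB].
  by apply: lerD => //; rewrite PQ' //; exact: le_Rintegral_bounded.
move=> B mB; apply: (@measure_unique _ _ (borel y0) (@open Y) (fun=> setT)) => //.
- by move=> C D; exact: openI.
- by move=> _; exact: openT.
- by rewrite bigcup_const //; exists 0%N.
- move=> G oG; have mG : measurable (G : set (borel y0)) by exact: sub_sigma_algebra.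
  have PG := fineK (fin_num_measure P _ mG); have QG := fineK (fin_num_measure Q _ mG).
  have PQG : fine (P G) = fine (Q G).
    by apply/eqP; rewrite eq_le !half // => g cg bg; rewrite PQ.
  by have := congr1 EFin PQG; rewrite PG QG.
- by move=> _; rewrite -ge0_fin_numE // fin_num_measure.
Qed.

End determined_by_continuous.

(** * Disintegration along the unstable fibres *)

Section symbolic_distance.
Context {R : realType} {I : Type} (wt : I -> nat) {A : finType} (S : set (I -> A)).
Implicit Types x y : symbolic R wt S.

Lemma ltr_half_expr (m n : nat) : (m < n)%N = ((2^-1 : R) ^+ n < 2^-1 ^+ m).
Proof.
by rewrite ltr_iXn2l // ?invr_gt0 // invf_lt1 // ltr1n.
Qed.

Lemma sym_dist_lt_eq x y (n : nat) i :
  mdist x y < (2^-1 : R) ^+ n -> (wt i <= n)%N -> x i = y i.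
Proof.
move=> xyn win; apply/eqP/negPn/negP => /(@sym_dist_ge R I wt A S x y i).
move=> h; have := le_lt_trans h xyn.
by rewrite -ltr_half_expr ltnNge win.
Qed.

Lemma eq_sym_dist_lt x y (n : nat) :
  (forall i, (wt i <= n)%N -> x i = y i) -> mdist x y < (2^-1 : R) ^+ n.
Proof.
move=> h; apply: (@le_lt_trans _ _ (2^-1 ^+ n.+1)); last by rewrite -ltr_half_expr.
apply: sym_dist_le => [|i]; first by rewrite exprn_ge0 ?invr_ge0.
move=> xy; have ni : (n < wt i)%N.
  by rewrite ltnNge; apply/negP => /h /eqP; apply/negP.
by rewrite ler_wiXn2l // ?invr_ge0 // invf_le1 // ler1n.
Qed.

Lemma half_expr_lt (e : R) : 0 < e -> exists n, (2^-1 : R) ^+ n < e.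
Proof.
move=> e0; have : (2^-1 : R) ^+ n @[n --> \oo] --> 0.
  by apply: cvg_expr; rewrite ger0_norm ?invr_ge0 // invf_lt1 // ltr1n.
move=> /cvgrPdist_lt/(_ e e0)[N _ /(_ N (leqnn N))] /=.
by rewrite sub0r normrN => h; exists N; exact: le_lt_trans (ler_norm _) h.
Qed.

End symbolic_distance.

Lemma mdist_prodE (R : realType) (U V : metricType R) (x y : U * V) :
  mdist x y = Num.max (mdist x.1 y.1) (mdist x.2 y.2).
Proof. by []. Qed.

Section shift_cylinders.
Context {R : realType} {A : finType} {M : rel A} {X : metricType R}.
Local Notation Sigma := (shift_space R M).
Local Notation K := (Sigma * X)%type.
Variable z0 : K.
Local Notation pi := (@unstable_proj R A M X).

(** Unlike [cylinder], this is indexed by words of all lengths, for inductions on the last letter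
    and countable unions over words, and it lives in the product with [X]. *)
Definition word_cyl (w : seq A) : set K :=
  [set z : K | mkseq (fun k : nat => z.1 k%:Z) (size w) = w].

Lemma open_coord (i : int) (a : A) : open [set z : K | z.1 i = a].
Proof.
rewrite openE => z za; apply/nbhs_ballP.
exists ((2^-1 : R) ^+ absz i); first by rewrite /= exprn_gt0 // invr_gt0.
move=> y; rewrite ballEmdist /= mdist_prodE gt_max => /andP[zy _].
by rewrite -za; apply/esym; exact: sym_dist_lt_eq zy (leqnn _).
Qed.

Lemma word_cyl_rcons w a : word_cyl (rcons w a) =
  word_cyl w `&` [set z : K | z.1 (size w)%:Z = a].
Proof.
apply/seteqP; split => z; rewrite /word_cyl /= size_rcons mkseqS.
  by move=> /rcons_inj[].
by move=> [-> ->].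
Qed.

Lemma open_word_cyl w : open (word_cyl w).
Proof.
elim/last_ind: w => [|w a ih].
  by rewrite (_ : word_cyl _ = setT); [exact: openT|apply/seteqP].
by rewrite word_cyl_rcons; apply: openI => //; exact: open_coord.
Qed.

Lemma measurable_word_cyl w : measurable (word_cyl w : set (borel z0)).
Proof. by apply: sub_sigma_algebra; exact: open_word_cyl. Qed.

Lemma word_cyl_inj n (w v : n.-tuple A) (z : K) :
  word_cyl w z -> word_cyl v z -> w = v.
Proof.
rewrite /word_cyl /= !size_tuple => hw hv.
by apply: val_inj; rewrite /= -hw -hv.
Qed.

Lemma word_cyl_tuple n (z : K) :
  exists w : n.-tuple A, word_cyl w z.
Proof.
have /eqP sw := size_mkseq (fun k : nat => z.1 k%:Z) n.
by exists (Tuple sw); rewrite /word_cyl /= size_mkseq.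
Qed.

(** A point is given by its image under [pi] and its letters at times at least 0, so these are the
    rectangles of the space: a measure on a fibre is described by its word probabilities. *)
Definition fibre_generator : set (set (borel z0)) :=
  [set word_cyl w `&` pi @^-1` B |
     w in [set: seq A] & B in [set B : set (borel (pi z0)) | measurable B]].

Lemma measurable_pi_preimage (B : set (borel (pi z0))) :
  measurable B -> measurable (pi @^-1` B : set (borel z0)).
Proof.
move=> mB; rewrite -[X in measurable X]setTI.
exact: (continuous_borel (@continuous_unstable_proj R A M X) measurableT).
Qed.

Lemma measurable_fibre_generator : fibre_generator `<=` measurable.
Proof.
move=> _ [w _ [B mB <-]]; apply: measurableI; first exact: measurable_word_cyl.
exact: measurable_pi_preimage.
Qed.

(** Two word cylinders are nested or disjoint, according to whether the shorter word is a prefix of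
    the longer one. *)
Lemma fibre_generator_setI : setI_closed fibre_generator.
Proof.
have main (w v : seq A) (B C : set (borel (pi z0))) : (size w <= size v)%N -> measurable B -> measurable C ->
    fibre_generator ((word_cyl w `&` pi @^-1` B) `&` (word_cyl v `&` pi @^-1` C)).
  move=> wv mB mC; rewrite setIACA -preimage_setI.
  have tk (z : K) : take (size w) (mkseq (fun k : nat => z.1 k%:Z) (size v)) =
      mkseq (fun k : nat => z.1 k%:Z) (size w).
    by rewrite -map_take take_iota (minn_idPl wv).
  have [vw|/eqP vw] := eqVneq (take (size w) v) w.
    exists v => //; exists (B `&` C); first exact: measurableI.
    congr (_ `&` _); apply/seteqP; split => [z vz|z []//]; split => //.
    by rewrite /word_cyl /= -tk vz vw.
  exists [::] => //; exists set0; first exact: measurable0.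
  rewrite preimage_set0 setI0; apply/seteqP; split => // z [[wz vz] _].
  by apply: vw; rewrite -[in LHS]vz tk wz.
move=> _ _ [w _ [B mB <-]] [v _ [C mC <-]].
have [wv|/ltnW vw] := leqP (size w) (size v); first exact: main.
by rewrite setIC; exact: main.
Qed.

(** An open [G] is a union of rectangles, one for each word [w]: taking for [U w] the union of all
    open sets that fit leaves only countably many pieces, whatever the number of open sets
    involved. *)
Lemma borel_fibre_generated (E : set (borel z0)) :
  measurable E -> <<s fibre_generator >> E.
Proof.
move: E; apply: smallest_sub; first exact: smallest_sigma_algebra.
move=> G oG.
pose U (w : seq A) : set (past_space R M * X) :=
  \bigcup_(V in [set V | open V /\ word_cyl w `&` pi @^-1` V `<=` G]) V.
have oU w : open (U w) by apply: bigcup_open => V [].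
have -> : G = \bigcup_(w : seq A) (word_cyl w `&` pi @^-1` U w).
  apply/seteqP; split => z; last first.
    by move=> [w _ [wz [V [oV VG] Vz]]]; exact: VG.
  move=> Gz; have /nbhs_ballP[r /= r0 rG] : nbhs z G by exact: open_nbhs_nbhs.
  have [n nr] := half_expr_lt r0.
  (* Indices 0 to [n] need n + 1 letters; together with a past at distance less than 2^-n they fix
     all coordinates of weight at most [n]. *)
  pose w := mkseq (fun k : nat => z.1 k%:Z) n.+1.
  exists w => //; split; first by rewrite /word_cyl /w /= size_map size_iota.
  exists (interior (ball (pi z) ((2^-1 : R) ^+ n))); last first.
    by apply: nbhsx_ballx; rewrite exprn_gt0 // invr_gt0.
  split; first exact: open_interior.
  move=> z' [wz' /interior_subset]; rewrite ballEmdist /= mdist_prodE gt_max /=.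
  move=> /andP[z1 z2].
  apply: rG; rewrite ballEmdist /= mdist_prodE gt_max (lt_trans z2 nr) andbT.
  apply: lt_trans nr; apply: eq_sym_dist_lt => i ni.
  have [i0|i0] := leP 0 i.
    have kn : (absz i < n.+1)%N by rewrite ltnS.
    have : mkseq (fun k : nat => z'.1 k%:Z) (size w) = w := wz'.
    rewrite {1}/w size_mkseq => {}wz'.
    have := congr1 (fun s => nth (z.1 0) s (absz i)) wz'.
    by rewrite !nth_mkseq // gez0_abs.
  have i1 : i <= -1 by lia.
  exact: (@sym_dist_lt_eq R _ _ _ _ _ _ n (exist _ i i1) z1 ni).
apply: (@countable_bigcupT_measurable _ (g_sigma_algebraType fibre_generator)).
  exact: countableP.
move=> w; apply: sub_sigma_algebra; exists w => //; exists (U w) => //.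
exact: sub_sigma_algebra.
Qed.
Lemma measurable_fibre_generated :
  @measurable _ (borel z0) = <<s fibre_generator >>.
Proof.
apply/seteqP; split => E; first exact: borel_fibre_generated.
by move: E; apply: smallest_sub; [exact: sigma_algebra_measurable|
  exact: measurable_fibre_generator].
Qed.

End shift_cylinders.

Section sampled_kernel.
Context d d' d'' (Y : measurableType d) (T : measurableType d')
  (U : measurableType d'') (R : realType) (P : probability T R).
Variable Z : Y * T -> U.

Definition sampled_law (mZ : measurable_fun setT Z) (y : Y) (E : set U) : \bar R :=
  P [set t | E (Z (y, t))].

Hypothesis mZ : measurable_fun setT Z.

Lemma measurable_sampled_section y E :
  measurable E -> measurable [set t | E (Z (y, t))].
Proof.
move=> mE; have := measurable_xsection y (mZ measurableT mE).
rewrite setTI (_ : xsection _ _ = [set t | E (Z (y, t))]) //.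
by apply/seteqP; split => t; rewrite /xsection /= inE.
Qed.

Let law0 y : sampled_law mZ y set0 = 0%E.
Proof. exact: measure0. Qed.

Let law_ge0 y E : (0 <= sampled_law mZ y E)%E.
Proof. exact: measure_ge0. Qed.

Let law_additive y : semi_sigma_additive (sampled_law mZ y).
Proof.
move=> F mF tF mU.
have -> : sampled_law mZ y (\bigcup_n F n) = P (\bigcup_n [set t | F n (Z (y, t))]).
  by [].
apply: measure_semi_sigma_additive.
- by move=> n; exact: measurable_sampled_section.
- apply/trivIsetP => i j _ _ ij; apply/seteqP; split => // t [Fi Fj].
  by move/trivIsetP : tF => /(_ i j I I ij); rewrite -subset0 => /(_ _ (conj Fi Fj)).
- apply: bigcupT_measurable => n; exact: measurable_sampled_section.
Qed.

HB.instance Definition _ y := isMeasure.Build _ _ _ (sampled_law mZ y)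
  (law0 y) (law_ge0 y) (@law_additive y).

Definition sampled_kernel : Y -> {measure set U -> \bar R} := sampled_law mZ.

Let measurable_sampled E :
  measurable E -> measurable_fun setT (sampled_kernel ^~ E).
Proof.
move=> mE; have mZE := mZ measurableT mE; rewrite setTI in mZE.
have := measurable_fun_xsection P mZE.
apply: eq_measurable_fun => y _; congr (P _).
by apply/seteqP; split => t; rewrite /xsection /= inE.
Qed.

HB.instance Definition _ := isKernel.Build _ _ _ _ _ sampled_kernel measurable_sampled.

Let sampled_prob y : sampled_kernel y setT = 1%E.
Proof. exact: probability_setT. Qed.

HB.instance Definition _ := Kernel_isProbability.Build _ _ _ _ _
  sampled_kernel sampled_prob.

End sampled_kernel.

Section cylinder_measure.
Context {R : realType} {A : finType} {M : rel A} {X : metricType R}.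
Local Notation Sigma := (shift_space R M).
Local Notation K := (Sigma * X)%type.
Variables (z0 : K) (eta : probability (borel z0) R) (w : seq A).
Local Notation pi := (@unstable_proj R A M X).

Definition cyl_measure (B : set (borel (pi z0))) : \bar R :=
  eta (word_cyl w `&` pi @^-1` B).

Let measurable_cylI (B : set (borel (pi z0))) : measurable B ->
  measurable (word_cyl w `&` pi @^-1` B : set (borel z0)).
Proof.
by move=> mB; apply: measurable_fibre_generator; exists w => //; exists B.
Qed.

Let cyl0 : cyl_measure set0 = 0%E.
Proof. by rewrite /cyl_measure preimage_set0 setI0 measure0. Qed.

Let cyl_ge0 B : (0 <= cyl_measure B)%E. Proof. exact: measure_ge0. Qed.

Let cyl_additive : semi_sigma_additive cyl_measure.
Proof.
move=> F mF tF mU; rewrite /cyl_measure preimage_bigcup setI_bigcupr.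
apply: measure_semi_sigma_additive.
- by move=> n; exact: measurable_cylI.
- apply/trivIsetP => i j _ _ ij; apply/seteqP; split => // z [[_ Fi] [_ Fj]].
  by move/trivIsetP : tF => /(_ i j I I ij); rewrite -subset0 => /(_ _ (conj Fi Fj)).
- by rewrite -setI_bigcupr -preimage_bigcup; exact: measurable_cylI.
Qed.

HB.instance Definition _ := isMeasure.Build _ _ _ cyl_measure
  cyl0 cyl_ge0 cyl_additive.

Let cyl_fin : fin_num_fun cyl_measure.
Proof. by move=> B mB; apply: fin_num_measure; exact: measurable_cylI. Qed.

HB.instance Definition _ := Measure_isFinite.Build _ _ _ cyl_measure cyl_fin.

(** [cyl_measure] is dominated by the transverse measure, so Radon-Nikodym applies; the density is
    the conditional probability of the word [w] given [pi]. *)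
Lemma cyl_measure_density : exists p : borel (pi z0) -> R,
  [/\ measurable_fun setT p, (forall y, 0 <= p y),
    (transverse eta).-integrable setT (EFin \o p) &
    forall B, measurable B ->
      cyl_measure B = (\int[transverse eta]_(y in B) (p y)%:E)%E].
Proof.
have dom : cyl_measure `<< transverse eta.
  apply/null_content_dominatesP => B mB h.
  apply/eqP; rewrite eq_le measure_ge0 andbT -[leRHS]h.
  apply: le_measure; rewrite ?inE; [exact: measurable_cylI| |by move=> z []].
  exact: measurable_pi_preimage.
have [f [f0 ffin If fE]] := radon_nikodym_sigma_finite dom.
exists (fine \o f); split.
- apply: measurableT_comp => //; exact: measurable_int If.
- by move=> y; exact: fine_ge0.
- by apply: eq_integrable If => // y _; rewrite /= fineK.
- by move=> B mB; rewrite fE //; apply: eq_integral => y _; rewrite fineK.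
Qed.

End cylinder_measure.

Section almost_everywhere.
Context d (T : measurableType d) (R : realType) (mu : {measure set T -> \bar R}).

Lemma ae_forall_count (I : countType) (Q : I -> T -> Prop) :
  (forall i, {ae mu, forall x, Q i x}) -> {ae mu, forall x, forall i, Q i x}.
Proof.
move=> aeQ; pose Q' (n : nat) x := if unpickle n is Some i then Q i x else True.
have : {ae mu, forall x, forall n, Q' n x}.
  apply: ae_foralln => n; rewrite /Q'.
  by case: unpickle => [i|]; [exact: aeQ|exact: aeW].
by apply: filterS => x Qx i; have := Qx (pickle i); rewrite /Q' pickleK.
Qed.

End almost_everywhere.

Lemma probability_ae1 d (T : measurableType d) (R : realType)
    (P : probability T R) (E : set T) :
  measurable E -> {ae P, forall x, E x} -> P E = 1%E.
Proof.
move=> mE [N [mN N0 EN]].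
have : P (~` E) = 0%E.
  by apply: (subset_measure0 _ mN EN N0); exact: measurableC.
rewrite probability_setC // => /eqP.
have := fin_num_measure P _ mE.
by case: (P E) => // r _; rewrite -EFinB eqe subr_eq0 => /eqP <-.
Qed.

Lemma probability_ae1P d (T : measurableType d) (R : realType)
    (P : probability T R) (E : set T) :
  measurable E -> P E = 1%E -> {ae P, forall x, E x}.
Proof.
move=> mE E1; exists (~` E); split => //; first exact: measurableC.
by rewrite probability_setC // E1 subee.
Qed.

Lemma measure_ae_eq_set d (T : measurableType d) (R : realType)
    (mu : {measure set T -> \bar R}) (E F : set T) :
  measurable E -> measurable F -> {ae mu, forall x, E x <-> F x} -> mu E = mu F.
Proof.
have half (C D : set T) : measurable C -> measurable D ->
    {ae mu, forall x, C x <-> D x} -> (mu C <= mu D)%E.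
  move=> mC mD [N [mN N0 NCD]].
  have CDN : C `<=` D `|` N.
    move=> x Cx; have [Dx|Dx] := pselect (D x); first by left.
    by right; apply: NCD => /= -[/(_ Cx)].
  apply: (@le_trans _ _ (mu (D `|` N))).
    by apply: le_measure; rewrite ?inE //; exact: measurableU.
  by rewrite -[leRHS]adde0 -N0; exact: measureU2.
move=> mE mF EF; apply/eqP; rewrite eq_le !half //.
by apply: filterS EF => x [EFx FEx]; split.
Qed.

Lemma measure_finType_bigcup d (T : measurableType d) (R : realType)
    (mu : {measure set T -> \bar R}) (I : finType) (F : I -> set T) :
  (forall i, measurable (F i)) -> trivIset setT F ->
  mu (\bigcup_i F i) = (\sum_i mu (F i))%E.
Proof.
move=> mF tF; rewrite measure_fin_bigcup //; last exact: finite_finset.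
rewrite (fsbigE (index_enum I)) ?index_enum_uniq //; last first.
  by move=> i _; rewrite mem_index_enum.
by apply: eq_bigl => i; rewrite in_setT.
Qed.

Section disintegration_existence.
Context {R : realType} {A : finType} {M : rel A} {X : metricType R}.
Local Notation Sigma := (shift_space R M).
Local Notation K := (Sigma * X)%type.
Local Notation Y := (past_space R M * X)%type.
Variables (z0 : K) (eta : probability (borel z0) R).
Local Notation pi := (@unstable_proj R A M X).
Local Notation tau := (transverse eta).

Lemma symbolic_inj (I : Type) (wt : I -> nat) (S : set (I -> A)) :
  injective (@Defs.coord R I wt A S).
Proof.
move=> x y xy; apply: sym_dist_eq0; apply/eqP; rewrite eq_le sym_dist_ge0 andbT.
by apply: sym_dist_le => // i; rewrite xy eqxx.
Qed.

Lemma Negz_le_m1 k : Negz k <= -1 :> int.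
Proof. by []. Qed.

Definition last_neg : neg_int := exist (fun i : int => i <= -1) (-1) (Negz_le_m1 0).

Definition glue (p : past_space R M) (s : nat -> A) (i : int) : A :=
  match i with
  | Posz k => s k
  | Negz k => p (exist (fun i : int => i <= -1) (Negz k) (Negz_le_m1 k))
  end.

Definition compatible (y : Y) (w : seq A) : bool := path M (y.1 last_neg) w.

Lemma path_mkseqP (a : A) (s : nat -> A) :
  (forall n, path M a (mkseq s n)) <-> M a (s 0%N) /\ forall k, M (s k) (s k.+1).
Proof.
have last_mk n : last a (mkseq s n.+1) = s n by rewrite mkseqS last_rcons.
split=> [h|[h0 h] n].
  split=> [|k]; first by have := h 1%N; rewrite /= andbT.
  by have := h k.+2; rewrite mkseqS rcons_path last_mk => /andP[].
elim: n => // n ih; rewrite mkseqS rcons_path ih /=.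
by case: n {ih} => // n; rewrite last_mk.
Qed.

Lemma glueP (y : Y) (s : nat -> A) :
  markov_seq M (glue y.1 s) <-> forall n, compatible y (mkseq s n).
Proof.
rewrite path_mkseqP; split => [h|[h0 h]].
  by split=> [|k]; [exact: (h (-1))|have := h k%:Z; rewrite /= addn1].
case=> [k|[|k]].
- by rewrite -[Posz k + 1]/(Posz (k + 1)) addn1; exact: h.
- exact: h0.
(* A past is the restriction of a bi-infinite admissible sequence and inherits its transitions. *)
have [v vM yv] := coordP y.1; rewrite (_ : Negz k.+1 + 1 = Negz k); last by lia.
have := vM (Negz k.+1); rewrite (_ : Negz k.+1 + 1 = Negz k); last by lia.
by rewrite /glue -yv.
Qed.

Lemma compatible_pi (z : K) w : word_cyl w z -> compatible (pi z) w.
Proof.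
move=> <-; apply: (path_mkseqP _ _).2; split; first exact: (coordP z.1 (-1)).
by move=> k; have := coordP z.1 k%:Z; rewrite -[_ + 1]/(Posz (k + 1)) addn1.
Qed.

Lemma measurable_compatible w :
  measurable [set y : borel (pi z0) | compatible y w].
Proof.
have mc a : measurable [set y : borel (pi z0) | y.1 last_neg = a].
  apply: sub_sigma_algebra; rewrite openE => y ya; apply/nbhs_ballP.
  exists ((2^-1 : R) ^+ 1); first by rewrite /= exprn_gt0 // invr_gt0.
  move=> y'; rewrite ballEmdist /= mdist_prodE gt_max => /andP[yy' _].
  by rewrite -ya; apply/esym; apply: (sym_dist_lt_eq yy').
rewrite (_ : [set _ | _] = \bigcup_(a in [set a : A | path M a w])
    [set y : borel (pi z0) | y.1 last_neg = a]).
  by apply: fin_bigcup_measurable => //; exact: finite_finset.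
apply/seteqP; split => y /= => [yw|[a aw ya]]; first by exists (y.1 last_neg).
by rewrite /compatible ya.
Qed.

Lemma measurable_fibre (y : borel (pi z0)) :
  measurable (pi @^-1` [set y] : set (borel z0)).
Proof.
apply: measurable_pi_preimage; rewrite -[X in measurable X]setCK.
apply: measurableC; apply: sub_sigma_algebra; apply: closed_openC.
apply: accessible_closed_set1; apply: hausdorff_accessible.
exact: metric_hausdorff.
Qed.

Section sampling.
Variables (a0 : A) (p : seq A -> borel (pi z0) -> R).
Hypothesis mp : forall w, measurable_fun setT (p w).

(** The past and the point of [X] are prescribed and the future is random. The default [z0] covers
    inadmissible gluings, which have probability zero over almost every [y]. *)
Definition sampled_point (yu : borel (pi z0) * R) : borel z0 :=
  match pselect (markov_seq M (glue yu.1.1 (random_seq a0 p yu))) with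
  | left h => (Symbolic h, yu.1.2)
  | right _ => z0
  end.

Definition sampled_good : set (borel (pi z0) * R) :=
  [set yu | forall n, compatible yu.1 (mkseq (random_seq a0 p yu) n)].

Lemma sampled_point_proj yu : sampled_good yu -> pi (sampled_point yu) = yu.1.
Proof.
move=> /glueP h; rewrite /sampled_point; case: pselect => // h'.
rewrite /unstable_proj /= [RHS]surjective_pairing; congr pair.
apply: symbolic_inj; apply/funext => -[i i1] /=; rewrite /restrict_neg /=.
case: i i1 => // k i1; congr (Defs.coord _ _).
by congr exist; exact: Prop_irrelevance.
Qed.

Lemma sampled_point_cyl yu w : sampled_good yu ->
  word_cyl w (sampled_point yu) <-> mkseq (random_seq a0 p yu) (size w) = w.
Proof.
by move=> /glueP h; rewrite /sampled_point; case: pselect => // h'.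
Qed.

Lemma sampled_point_bad yu : ~ sampled_good yu -> sampled_point yu = z0.
Proof.
move=> h; rewrite /sampled_point; case: pselect => // h'.
by case: h; apply/glueP.
Qed.

Lemma measurable_random_word w :
  measurable [set yu : borel (pi z0) * R | mkseq (random_seq a0 p yu) (size w) = w].
Proof.
elim/last_ind: w => [|w a ih].
  by rewrite (_ : [set _ | _] = setT) //; apply/seteqP.
rewrite (_ : [set _ | _] = [set yu | mkseq (random_seq a0 p yu) (size w) = w] `&`
    [set yu | random_seq a0 p yu (size w) = a]).
  by apply: measurableI => //; exact: measurable_random_seq.
apply/seteqP; split => yu /=; rewrite size_rcons mkseqS.
  by move=> /rcons_inj[].
by move=> [-> ->].
Qed.

Lemma measurable_random_word_section y w :
  measurable [set u : measurableTypeR R | mkseq (random_seq a0 p (y, u)) (size w) = w].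
Proof.
have := measurable_xsection y (measurable_random_word w).
rewrite (_ : xsection _ _ = [set u | mkseq (random_seq a0 p (y, u)) (size w) = w]) //.
by apply/seteqP; split => u; rewrite /xsection /= inE.
Qed.

Lemma measurable_sampled_good : measurable sampled_good.
Proof.
rewrite (_ : sampled_good = ~` \bigcup_(w : seq A)
    ([set yu : borel (pi z0) * R | mkseq (random_seq a0 p yu) (size w) = w] `&`
     [set yu : borel (pi z0) * R | ~ compatible yu.1 w])).
  apply: measurableC; apply: countable_bigcupT_measurable => [|w].
    exact: countableP.
  apply: measurableI; first exact: measurable_random_word.
  have := measurable_compatible w => /measurableC mC.
  by have := @measurable_fst _ _ _ R measurableT _ mC; rewrite setTI.
apply/seteqP; split => yu /=.
  by move=> h [w _ [/= <-]]; apply.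
move=> h n; apply: contrapT => nc; apply: h.
by exists (mkseq (random_seq a0 p yu) n) => //=; rewrite size_mkseq.
Qed.

Lemma measurable_sampled_point : measurable_fun setT sampled_point.
Proof.
apply: (measurability _ (measurable_fibre_generated z0)).
move=> _ [_ [w _ [B mB <-]] <-]; rewrite setTI.
rewrite (_ : _ @^-1` _ = (sampled_good `&`
    [set yu : borel (pi z0) * R | mkseq (random_seq a0 p yu) (size w) = w] `&`
    fst @^-1` B) `|` (~` sampled_good `&` [set _ | (word_cyl w `&` pi @^-1` B) z0])).
  apply: measurableU; last first.
    apply: measurableI; first by apply: measurableC; exact: measurable_sampled_good.
    have [h|h] := pselect ((word_cyl w `&` pi @^-1` B) z0).
      by rewrite (_ : [set _ | _] = setT) //; apply/seteqP; split.
    by rewrite (_ : [set _ | _] = set0) //; apply/seteqP; split.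
  apply: measurableI.
    apply: measurableI; first exact: measurable_sampled_good.
    exact: measurable_random_word.
  by have := @measurable_fst _ _ _ R measurableT _ mB; rewrite setTI.
apply/seteqP; split => yu /=.
  have [g|g] := pselect (sampled_good yu); last first.
    by rewrite sampled_point_bad // => h; right.
  by rewrite sampled_point_proj // sampled_point_cyl //; left; tauto.
case=> [[[g h] Bu]|[g h]]; last by rewrite sampled_point_bad.
by rewrite sampled_point_proj // sampled_point_cyl.
Qed.

End sampling.

(** The conditional word probabilities are consistent and vanish on words that cannot follow the
    past, outside a null set, because there are countably many words. Sampling the future with these
    probabilities gives a kernel, and its mixture agrees with [eta] on [fibre_generator], which
    determines a measure. *)
Theorem disintegration_exists : exists kappa, is_disintegration eta kappa.
Proof.
have /choice[p pP] : forall w, exists p : borel (pi z0) -> R,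
  [/\ measurable_fun setT p, (forall y, 0 <= p y),
    tau.-integrable setT (EFin \o p) &
    forall B : set (borel (pi z0)), measurable B ->
      eta (word_cyl w `&` pi @^-1` B) = (\int[tau]_(y in B) (p y)%:E)%E].
  by move=> w; exact: (cyl_measure_density eta w).
have mp w : measurable_fun setT (p w) by have [] := pP w.
have p0 w y : 0 <= p w y by have [] := pP w.
have Ip w : tau.-integrable setT (EFin \o p w) by have [] := pP w.
have pE w (B : set (borel (pi z0))) : measurable B ->
    eta (word_cyl w `&` pi @^-1` B) = (\int[tau]_(y in B) (p w y)%:E)%E.
  by have [_ _ _] := pP w; exact.
have ae_nil : {ae tau, forall y, p [::] y = 1}.
  have : ae_eq tau setT (EFin \o p [::]) (cst 1%E).
    apply: integral_ae_eq => // B _ mB; rewrite -pE // integral_cst // mul1e.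
    rewrite (_ : word_cyl [::] = setT) ?setTI //; exact/seteqP.
  by apply: filterS => y /(_ I) [].
have ae_rcons : {ae tau, forall y, forall w, p w y = \sum_a p (rcons w a) y}.
  apply: ae_forall_count => w.
  have : ae_eq tau setT (EFin \o p w)
      (fun y => \sum_(a : A) (p (rcons w a) y)%:E)%E.
    apply: integral_ae_eq => //.
      by apply: emeasurable_sum => a; exact/measurable_EFinP.
    move=> B _ mB; rewrite ge0_integral_sum //; last 2 first.
    - by move=> a; apply/measurable_EFinP; exact: measurable_funTS.
    - by move=> a y _; rewrite lee_fin.
    rewrite -pE //; under eq_bigr do rewrite -pE //.
    rewrite -[RHS](measure_finType_bigcup eta
        (F := fun a => word_cyl (rcons w a) `&` pi @^-1` B)).
    - congr (eta _); apply/seteqP; split => z.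
        move=> [wz Bz]; exists (z.1 (size w)%:Z) => //; split => //.
        by rewrite word_cyl_rcons.
      by move=> [a _ [+ Bz]]; rewrite word_cyl_rcons => -[wz _].
    - move=> a; apply: measurable_fibre_generator.
      by exists (rcons w a) => //; exists B.
    - apply/trivIsetP => a b _ _ ab; apply/seteqP; split => // z.
      rewrite !word_cyl_rcons => -[[[_ za] _] [[_ zb] _]].
      by case/eqP: ab; rewrite -za -zb.
  by apply: filterS => y /(_ I) /=; rewrite sumEFin => -[].
(* The cylinder of [w] does not meet the fibres over pasts that [w] cannot follow, so the density
   integrates to 0 on every set of such pasts. *)
have ae_compat : {ae tau, forall y, forall w, ~~ compatible y w -> p w y = 0}.
  apply: ae_forall_count => w.
  have mC : measurable [set y : borel (pi z0) | ~~ compatible y w].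
    have := measurableC (measurable_compatible w).
    by rewrite (_ : ~` _ = [set y | ~~ compatible y w]) //; apply/seteqP; split => y /= /negP.
  have : ae_eq tau [set y : borel (pi z0) | ~~ compatible y w] (EFin \o p w) (cst 0%E).
    apply: integral_ae_eq => //.
      by apply: integrableS (Ip w).
    move=> B BE mB; rewrite -pE // integral0 (_ : _ `&` _ = set0) ?measure0 //.
    by apply/seteqP; split => // z [/compatible_pi zw /BE /=]; rewrite zw.
  by apply: filterS => y /= h /h [].
pose a0 := z0.1 0 : A.
have [P Plaw] : exists P : probability (measurableTypeR R) R, forall y w,
    (forall v, 0 <= p v y) -> p [::] y = 1 ->
    (forall v, p v y = \sum_a p (rcons v a) y) ->
    P [set u | mkseq (random_seq a0 p (y, u)) (size w) = w] = (p w y)%:E.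
  by exists (uniform_prob (@ltr01 R)) => y w; exact: random_seq_law.
have mZ := measurable_sampled_point (p := p) a0 mp.
pose kappa : R.-pker borel (pi z0) ~> borel z0 := sampled_kernel P mZ.
exists kappa.
have law : {ae tau, forall y, forall w, 
    P [set u | mkseq (random_seq a0 p (y, u)) (size w) = w] = (p w y)%:E}.
  by apply: filterS2 ae_nil ae_rcons => y y1 y2 w; exact: Plaw.
(* Each incompatible word is sampled with probability zero, and a countable union of null events is
   null. *)
have good : {ae tau, forall y, {ae P, forall u, sampled_good a0 p (y, u)}}.
  apply: filterS2 law ae_compat => y ylaw yc.
  have : {ae P, forall u, forall w, 
      ~ (mkseq (random_seq a0 p (y, u)) (size w) = w /\ ~~ compatible y w)}.
    apply: ae_forall_count => w.
    have [cw|cw] := boolP (compatible y w); first by apply: aeW => u [_ /negP].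
    exists [set u | mkseq (random_seq a0 p (y, u)) (size w) = w]; split.
    - exact: measurable_random_word_section.
    - by rewrite [LHS](ylaw w) yc.
    - by move=> u /= /contrapT[].
  apply: (@filterS _ _ (ae_filter_ringOfSetsType P)) => u h n; apply/negPn/negP => nc.
  apply: (h (mkseq (random_seq a0 p (y, u)) n)).
  by rewrite size_mkseq.
split.
  apply: filterS good => y yg.
  have my := measurable_fibre y.
  have h : {ae P, forall u, (pi @^-1` [set y]) (sampled_point a0 p (y, u))}.
    apply: (@filterS _ _ (ae_filter_ringOfSetsType P)) yg => u.
    exact: sampled_point_proj.
  have mS := measurable_sampled_section mZ y my.
  exact: (@probability_ae1 _ (measurableTypeR R) _ P _ mS h).
move=> B mB.
(* Viewing [tau] as a constant kernel turns the mixture into a composition of kernels, hence into a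
   measure, as uniqueness on a generating class requires. *)
pose l : R.-pker unit ~> borel (pi z0) :=
  kprobability (measurable_cst (tau : pprobability (borel (pi z0)) R)).
pose m2 : measure _ R := mkcomp l (kernel.kernel_snd kappa) tt.
have -> : (\int[tau]_y kappa y B)%E = m2 B by [].
apply: (@measure_unique _ R (borel z0) _ (fun=> setT)
  (measurable_fibre_generated z0)) => //.
- exact: fibre_generator_setI.
- move=> _; exists [::] => //; exists setT; first exact: measurableT.
  by apply/seteqP; split.
- by rewrite bigcup_const //; exists 0%N.
- move=> _ [w _ [C mC <-]].
  transitivity (\int[tau]_(y in C) (p w y)%:E)%E; first exact: pE.
  have mwC : measurable (word_cyl w `&` pi @^-1` C : set (borel z0)).
    by apply: measurable_fibre_generator; exists w => //; exists C.
  transitivity (\int[tau]_y kappa y (word_cyl w `&` pi @^-1` C))%E; last by [].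
  rewrite integral_mkcond; apply: ae_eq_integral => //.
  - apply/(measurable_restrict _ mC measurableT); rewrite setTI.
    by apply/measurable_EFinP; exact: measurable_funTS.
  - exact: measurable_kernel.
  apply: filterS2 law good => y ylaw yg _; rewrite patchE.
  have mS := measurable_sampled_section mZ y mwC.
  have mW := measurable_random_word_section a0 mp y w.
  have [Cy|Cy] := pselect (C y).
    rewrite mem_set // -ylaw; apply/esym.
    apply: (@measure_ae_eq_set _ (measurableTypeR R) _ P _ _ mS mW).
    apply: (@filterS _ _ (ae_filter_ringOfSetsType P)) yg => u gu /=.
    rewrite sampled_point_proj // sampled_point_cyl //; tauto.
  rewrite memNset // -[LHS](measure0 P); apply/esym.
  apply: (@measure_ae_eq_set _ (measurableTypeR R) _ P _ _ mS measurable0).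
  apply: (@filterS _ _ (ae_filter_ringOfSetsType P)) yg => u gu /=.
  rewrite sampled_point_proj //; tauto.
- by move=> _; rewrite -ge0_fin_numE // fin_num_measure.
Qed.

Lemma disintegrationP : is_disintegration eta (disintegration eta).
Proof. exact: xgetPex disintegration_exists. Qed.

End disintegration_existence.

(** * Continuity and compactness of the skew product *)

Section shift_compact.
Context {R : realType} {A : finType} {M : rel A}.
Local Notation Sigma := (shift_space R M).

(** Along an ultrafilter each coordinate takes one of finitely many letters with full weight, which
    defines a limit sequence. It is admissible because a transition involves just two
    coordinates. *)
Lemma compact_shift_space : compact [set: Sigma].
Proof.
rewrite compact_ultra => F FU _.
have pick (i : int) : exists a, F [set w : Sigma | w i = a].
  apply: contrapT => /forallNP no.
  have {}no a : F [set w : Sigma | w i <> a].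
    by have [/no|] := in_ultra_setVsetC [set w : Sigma | w i = a] FU.
  have /filter_ex[w /(_ (w i))] : F [set w : Sigma | forall a, w i <> a].
    exact: filter_forall.
  by [].
have [c cF] := choice pick.
have cM : markov_seq M c.
  move=> i; have [w [wi wi1]] := filter_ex (filterI (cF i) (cF (i + 1))).
  by rewrite -[c i]wi -[c (i + 1)]wi1; exact: (coordP w).
exists (Symbolic cM); split => // B /nbhs_ballP[r /= r0 rB].
have [n nr] := half_expr_lt r0.
have : F [set w : Sigma | forall k : 'I_n.+1, w k%:Z = c k%:Z /\ w (- k%:Z) = c (- k%:Z)].
  have h (k : 'I_n.+1) : F [set w : Sigma | w k%:Z = c k%:Z /\ w (- k%:Z) = c (- k%:Z)].
    by apply: filterI; exact: cF.
  exact: filter_forall.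
apply: filterS => w hw; apply: rB; rewrite ballEmdist /=; apply: lt_trans nr.
apply: eq_sym_dist_lt => i /=; rewrite -ltnS => ni.
have [h1 h2] := hw (Ordinal ni); rewrite /= in h1 h2.
have [i0|i0] := leP 0 i; first by rewrite -(gez0_abs i0) h1.
by have -> : i = - (absz i)%:Z by lia.
Qed.

Lemma closed_cylinder n (u : n.-tuple A) : closed (cylinder u : set Sigma).
Proof.
rewrite (_ : cylinder u = \bigcap_(k in [set: 'I_n]) [set w : Sigma | w k%:Z = tnth u k]).
  apply: closed_bigI => k _; rewrite -[X in closed X]setCK; apply: open_closedC.
  rewrite openE => w wk; apply/nbhs_ballP.
  exists ((2^-1 : R) ^+ k); first by rewrite /= exprn_gt0 // invr_gt0.
  move=> v; rewrite ballEmdist /= => wv vk; apply: wk; rewrite /= -vk.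
  exact: (sym_dist_lt_eq wv).
by apply/seteqP; split => w /= h k; [move=> _|]; exact: h.
Qed.

End shift_compact.

Lemma powR_small (R : realType) (C b e : R) : 0 < b -> 0 < e ->
  exists2 d, 0 < d & forall r, 0 <= r < d -> C * r `^ b < e.
Proof.
move=> b0 e0; have C0 : 0 < `|C| + 1 by rewrite ltr_wpDl.
have eC0 : 0 < e / (`|C| + 1) by rewrite divr_gt0.
exists ((e / (`|C| + 1)) `^ b^-1); first by rewrite powR_gt0.
move=> r /andP[r0 rd].
have : r `^ b < e / (`|C| + 1).
  have := @gt0_ltr_powR R b b0 r _ r0 (powR_ge0 _ _) rd.
  by rewrite -powRrM mulVf ?gt_eqF // powRr1 // ltW.
rewrite ltr_pdivlMr // mulrC; apply: le_lt_trans.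
by rewrite ler_wpM2r ?powR_ge0 // (le_trans (ler_norm _)) // lerDl.
Qed.

Section dynamics.
Context {R : realType} {A : finType} {M : rel A} {X : metricType R}.
Local Notation Sigma := (shift_space R M).
Local Notation K := (Sigma * X)%type.
Variable (F : Sigma -> X -> X).
Hypothesis cX : compact [set: X].

Lemma compact_skew_space : compact [set: K].
Proof. by rewrite -setXTT; apply: compact_setX => //; exact: compact_shift_space. Qed.

Lemma continuous_holder (phi : K -> R) :
  holder_continuous (phi : K -> R^o) -> continuous phi.
Proof.
move=> [b /andP[b0 _] [C hC]]; apply: metric_continuous_real => z e e0.
have [d d0 hd] := powR_small C b0 e0; exists d => // z' zz'.
by rewrite distrC; apply: le_lt_trans (hC z z') _; apply: hd; rewrite mdist_ge0.
Qed.

(** [unif_dist] is a real supremum, which bounds its elements only if they are bounded above;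
    compactness of [X] supplies the bound. *)
Lemma mdist_le_unif_dist (f g : X -> X) t :
  continuous f -> continuous g -> mdist (f t) (g t) <= unif_dist f g.
Proof.
move=> cf cg; apply: ub_le_sup; last by exists t.
have bd (h : X -> X) : continuous h -> bounded_fct (fun s => mdist t (h s)).
  move=> ch; apply: continuous_bounded_fct => // s.
  apply: (@continuous_comp _ _ _ h (mdist t)); first exact: ch.
  apply: (@lipschitz_continuous _ _ _ 1) => x y; rewrite mul1r.
  have h1 := metric_triangle t y x; have h2 := metric_triangle t x y.
  rewrite (metric_sym y x) in h1; move: h1 h2.
  move: (mdist t x) (mdist t y) (mdist x y) => a a' c h1 h2.
  by rewrite ler_norml; apply/andP; split; lra.
have [B1 h1] := bd f cf; have [B2 h2] := bd g cg.
exists (B1 + B2) => _ [s _ <-]; apply: le_trans (metric_triangle _ t _) _.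
rewrite metric_sym; apply: lerD.
  exact: le_trans (ler_norm _) (h1 s).
exact: le_trans (ler_norm _) (h2 s).
Qed.

Hypothesis cF : forall w, continuous (F w).
Hypothesis hF : holder_family F.

Lemma continuous_left_shift : continuous (@left_shift R A M).
Proof.
apply/metric_continuousP => w e e0; have [n ne] := half_expr_lt e0.
exists ((2^-1 : R) ^+ n.+1); first by rewrite exprn_gt0 // invr_gt0.
move=> v wv; apply: lt_trans ne; apply: eq_sym_dist_lt => i ni /=.
have hi : (absz (i + 1)%R <= n.+1)%N by move: (ni : (absz i <= n)%N); lia.
exact: sym_dist_lt_eq wv hi.
Qed.

Lemma continuous_skew : continuous (Defs.skew F).
Proof.
apply/metric_continuousP => z e e0.
have e20 : 0 < e / 2 by rewrite divr_gt0.
have [d1 d10 h1] := (metric_continuousP _).1 continuous_left_shift z.1 e e0.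
have [d2 d20 h2] := (metric_continuousP _).1 (@cF z.1) z.2 (e / 2) e20.
have [b /andP[b0 _] [C hC]] := hF.
have [d3 d30 h3] := powR_small C b0 e20.
exists (Num.min d1 (Num.min d2 d3)); first by rewrite !lt_min d10 d20.
move=> y; rewrite !lt_min !mdist_prodE !gt_max => /and3P[/andP[a1 _] /andP[_ a2] /andP[a3 _]].
rewrite h1 //=; apply: le_lt_trans (metric_triangle _ (F z.1 y.2) _) _.
rewrite (splitr e); apply: ltrD; first exact: h2.
apply: le_lt_trans (mdist_le_unif_dist _ _ _) _ => //.
by apply: le_lt_trans (hC _ _) _; apply: h3; rewrite mdist_ge0.
Qed.

Lemma continuous_iter_skew k : continuous (iter k (Defs.skew F)).
Proof.
elim: k => [|k ih] z; first exact: cvg_id.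
by rewrite /=; apply: continuous_comp; [exact: ih|exact: continuous_skew].
Qed.

Lemma continuous_birkhoff (phi : K -> R) n :
  continuous phi -> continuous (birkhoff F phi n).
Proof.
move=> cphi; elim: n => [|n ih] z.
  rewrite (_ : birkhoff F phi 0 = fun=> 0); first exact: cvg_cst.
  by apply/funext => y; rewrite /birkhoff big_ord0.
rewrite (_ : birkhoff F phi n.+1 =
    fun y => birkhoff F phi n y + phi (iter n (Defs.skew F) y)).
  apply: cvgD; first exact: ih.
  by apply: continuous_comp; [exact: continuous_iter_skew|exact: cphi].
by apply/funext => y; rewrite /birkhoff big_ord_recr.
Qed.

Lemma iter_skew_coord k z i : (iter k (Defs.skew F) z).1 i = z.1 (i + k%:Z).
Proof.
elim: k i => [|k ih] i /=; first by rewrite addr0.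
by rewrite ih -addrA -[1%:Z + _]/(Posz (1 + k)) add1n.
Qed.

(** The maximum defining [theta] is attained, since the cylinder is compact and the Birkhoff sum is
    continuous, so on a nonempty cylinder the default of [xget] is avoided. *)
Lemma thetaP (z0 : K) (phi : K -> R) n (u : n.-tuple A) t w :
  continuous phi -> cylinder u w ->
  cylinder u (theta F z0 phi u t) /\
  birkhoff F phi n (w, t) <= birkhoff F phi n (theta F z0 phi u t, t).
Proof.
move=> cphi uw.
have [|tu tmax] := @xgetPex _ z0.1 [set w | cylinder u w /\ forall w', cylinder u w' ->
    birkhoff F phi n (w', t) <= birkhoff F phi n (w, t)].
  have cc : compact (cylinder u : set Sigma).
    by apply: (subclosed_compact (@closed_cylinder R A M n u) compact_shift_space).
  have cb : continuous (fun v : Sigma => birkhoff F phi n (v, t)).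
    have ct : continuous (fun v : Sigma => (v, t) : K).
      apply/metric_continuousP => v e e0; exists e => // v' vv'.
      by rewrite mdist_prodE gt_max vv' mdistxx e0.
    move=> v; apply: (@continuous_comp _ _ _ (fun v => (v, t)) (birkhoff F phi n)).
      exact: ct.
    exact: continuous_birkhoff.
  have [|v vu vmax] := compact_EVT_max _ cc (continuous_subspaceT cb).
    by exists w.
  by exists v; split; [exact: set_mem|move=> w' uw'; apply: vmax; exact: mem_set].
by split => //; exact: tmax.
Qed.

End dynamics.

(** * The upper bound *)

Section gibbs.
Context {R : realType}.

Lemma mul_ln_le (p r : R) : 0 <= p -> 0 <= r -> (0 < p -> 0 < r) ->
  p * (ln r - ln p) <= r - p.
Proof.
move=> p0 r0 pr; have [->|pn0] := eqVneq p 0; first by rewrite mul0r subr0.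
have pp : 0 < p by rewrite lt_def pn0.
have rp := pr pp.
rewrite -ln_div ?posrE //; have := le_ln1Dx (x := r / p - 1).
rewrite addrCA subrr addr0 => h.
have {}h : ln (r / p) <= r / p - 1.
  by apply: h; rewrite ltrBrDr addNr divr_gt0.
apply: le_trans (ler_wpM2l p0 h) _.
by rewrite mulrBr mulr1 mulrCA divff // mulr1.
Qed.

(** Summing p ln(r / p) <= r - p. Positivity of [r] wherever [p] is positive must be assumed because
    [ln] has a conventional finite value at 0. *)
Lemma gibbs (I : finType) (p r : I -> R) :
  (forall i, 0 <= p i) -> \sum_i p i = 1 ->
  (forall i, 0 <= r i) -> (forall i, 0 < p i -> 0 < r i) -> \sum_i r i <= 1 ->
  - (\sum_i p i * ln (p i)) <= - \sum_i p i * ln (r i).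
Proof.
move=> p0 p1 r0 pr r1; rewrite lerN2 -subr_le0 -sumrB.
apply: (@le_trans _ _ (\sum_i (r i - p i))); last by rewrite sumrB p1 subr_le0.
by apply: ler_sum => i _; rewrite -mulrBr; apply: mul_ln_le; auto.
Qed.

(** The Gibbs inequality against the normalised weights exp(Phi) / Z on [J]. *)
Lemma entropy_free_energy (I : finType) (J : pred I) (p Phi : I -> R) :
  (forall i, 0 <= p i) -> \sum_i p i = 1 -> (forall i, ~~ J i -> p i = 0) ->
  - (\sum_i p i * ln (p i)) + \sum_i p i * Phi i <=
    ln (\sum_(i | J i) expR (Phi i)).
Proof.
move=> p0 p1 pJ; set Z := \sum_(i | J i) _.
have [i0 Ji0] : exists i, J i.
  apply: contrapT => /forallNP noJ; suff: (0 : R) = 1 by move/eqP; rewrite eq_sym oner_eq0.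
  by rewrite -p1 big1 // => i _; apply: pJ; apply/negP/noJ.
have Z0 : 0 < Z.
  rewrite /Z (bigD1 i0) //= ltr_pwDl ?expR_gt0 //.
  by apply: sumr_ge0 => i _; exact: expR_ge0.
pose r i := if J i then expR (Phi i) / Z else 0.
have r0 i : 0 <= r i by rewrite /r; case: ifP => // _; rewrite divr_ge0 ?expR_ge0 // ltW.
rewrite -lerBrDr; apply: le_trans (gibbs p0 p1 r0 _ _) _.
- move=> i; rewrite /r; case: ifPn => [_ _|/pJ ->]; last by rewrite ltxx.
  by rewrite divr_gt0 ?expR_gt0.
- by rewrite /r -big_mkcond /= -mulr_suml divff // gt_eqF.
rewrite -[ln Z]mul1r -p1 mulr_suml -sumrB -sumrN; apply: ler_sum => i _.
rewrite /r; case: ifPn => [_|/pJ ->]; last by rewrite !mul0r subrr oppr0.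
rewrite ln_div ?posrE ?expR_gt0 // expRK mulrBr opprB.
by rewrite lexx.
Qed.

End gibbs.

Section word_partition.
Context {R : realType} {A : finType} {M : rel A} {X : metricType R}.
Local Notation Sigma := (shift_space R M).
Local Notation K := (Sigma * X)%type.
Variable (F : Sigma -> X -> X).

Lemma word_cyl_cylinder n (u : n.-tuple A) (z : K) :
  word_cyl u z <-> cylinder u z.1.
Proof.
rewrite /word_cyl /cylinder /= size_tuple; split => [h i|h].
  have := congr1 (fun s => nth (z.1 0) s i) h; rewrite nth_mkseq // => ->.
  by rewrite (tnth_nth (z.1 0)).
apply: (@eq_from_nth _ (z.1 0)); rewrite [size (mkseq _ _)]size_mkseq ?size_tuple //.
by move=> i ni; rewrite nth_mkseq // (h (Ordinal ni)) (tnth_nth (z.1 0)).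
Qed.

Lemma skew_partitionE n :
  skew_partition F n = range (fun u : n.-tuple A => word_cyl u : set K).
Proof.
(* The starting time [k] is generalised because removing the first factor of the join shifts all
   others by one. *)
pose from k m (u : m.-tuple A) : set K :=
  [set z : K | mkseq (fun j : nat => z.1 (k + j)%N%:Z) m = u].
have main k m : \big[join_partition/[set setT]]_(i < m)
    preimage_partition (iter (k + i) (Defs.skew F)) (@symbol_partition R A M X) =
    range (@from k m).
  elim: m k => [|m ih] k.
    rewrite big_ord0; apply/seteqP; split => B /=.
      move=> ->; exists [tuple] => //; exact/seteqP.
    by move=> [u _ <-]; rewrite (tuple0 u); exact/seteqP.
  rewrite big_ord_recl addn0; under eq_bigr do rewrite lift0 addnS -addSn.
  rewrite ih.
  have join (a : A) (u : m.-tuple A) :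
      iter k (Defs.skew F) @^-1` [set z : K | z.1 0 = a] `&` from k.+1 m u =
      from k m.+1 [tuple of a :: u].
    apply/seteqP; split => z; rewrite /from /= iter_skew_coord add0r.
      move=> [za zu]; rewrite /mkseq /= addn0 za; congr cons.
      rewrite -zu /mkseq -[1%N]/(1 + 0)%N iotaDl -map_comp.
      by apply: eq_map => j /=; rewrite addnA addn1.
    rewrite /mkseq /= addn0 => -[za zu]; split => //.
    rewrite -zu -[1%N]/(1 + 0)%N iotaDl -map_comp.
    by apply: eq_map => j /=; rewrite addnA addn1.
  apply/seteqP; split => B /=.
    move=> [_ [_ [a _ <-] <-] [_ [u _ <-] <-]].
    by exists [tuple of a :: u] => //; rewrite join.
  move=> [v _ <-]; case/tupleP: v => a u.
  exists (iter k (Defs.skew F) @^-1` [set z : K | z.1 0 = a]).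
    by exists [set z : K | z.1 0 = a] => //; exists a.
  by exists (from k.+1 m u); [exists u|rewrite join].
have fromE : from 0%N n = (fun u : n.-tuple A => word_cyl u : set K).
  apply/funext => u; apply/seteqP; split => z;
    by rewrite /from /word_cyl /= size_tuple.
by rewrite -fromE -main.
Qed.

(** The partition is a set of sets, so all words with empty cylinder give one and the same atom, of
    zero mass. Nonempty cylinders of distinct words are distinct, and the sum over atoms becomes a
    sum over words. *)
Lemma partition_entropyE (nu : set K -> \bar R) n : nu set0 = 0%E ->
  partition_entropy nu (skew_partition F n) =
  - \sum_(u : n.-tuple A)
      fine (nu (word_cyl u)) * ln (fine (nu (word_cyl u))).
Proof.
move=> nu0; rewrite /partition_entropy skew_partitionE; congr (- _).
pose cyl (u : n.-tuple A) : set K := word_cyl u.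
pose r := [seq cyl u | u <- index_enum _ & cyl u != set0].
have cinj u v : cyl u != set0 -> cyl u = cyl v -> u = v.
  move=> /set0P[z uz] uv; have vz : cyl v z by rewrite -uv.
  exact: word_cyl_inj uz vz.
rewrite (fsbigE r); last 3 first.
- rewrite map_inj_in_uniq ?filter_uniq ?index_enum_uniq // => u v.
  by rewrite mem_filter => /andP[u0 _] _; exact: cinj.
- by move=> B /= /mapP[u _ ->]; exists u.
- move=> B [u _ <-] ur; rewrite -/(cyl u); have [->|u0] := eqVneq (cyl u) set0.
    by rewrite nu0 mul0r.
  by case/negP: ur; apply: map_f; rewrite mem_filter u0 mem_index_enum.
rewrite big_map big_filter_cond [RHS](bigID (fun u => cyl u != set0)) /=.
rewrite [X in _ = _ + X]big1 ?addr0 => [|u]; last first.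
  by rewrite negbK -/(cyl u) => /eqP ->; rewrite nu0 mul0r.
by apply: eq_bigl => u; rewrite mem_set ?andbT //; exists u.
Qed.

End word_partition.

Section kernel_at.
Context d d' (Y : measurableType d) (U : measurableType d') (R : realType).
Variables (k : R.-pker Y ~> U) (y : Y).

(** A copy of [k y] carrying the structure of a probability, which the lemmas on expectations take
    as argument. *)
Definition kernel_at : set U -> \bar R := k y.

HB.instance Definition _ := Measure.on kernel_at.

Let kernel_at_setT : kernel_at setT = 1%E.
Proof. exact: prob_kernel. Qed.

HB.instance Definition _ := Measure_isProbability.Build _ _ _ kernel_at kernel_at_setT.

End kernel_at.

Section disintegrated_integral.
Context {R : realType} {A : finType} {M : rel A} {X : metricType R}.
Local Notation Sigma := (shift_space R M).
Local Notation K := (Sigma * X)%type.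
Variables (z0 : K) (eta : probability (borel z0) R).
Local Notation pi := (@unstable_proj R A M X).
Local Notation tau := (transverse eta).
Local Notation kappa := (disintegration eta).

Lemma ge0_integral_disintegration (f : borel z0 -> \bar R) :
  (forall z, (0 <= f z)%E) -> measurable_fun setT f ->
  (\int[eta]_z f z = \int[tau]_y \int[kappa y]_z f z)%E.
Proof.
move=> f0 mf.
pose l : R.-pker unit ~> borel (pi z0) :=
  kprobability (measurable_cst (tau : pprobability (borel (pi z0)) R)).
pose m2 : measure _ R := mkcomp l (kernel.kernel_snd kappa) tt.
rewrite (@eq_measure_integral _ _ _ _ m2) => [|B mB _].
  exact: (@integral_kcomp _ _ _ _ _ _ _ l (kernel.kernel_snd kappa) tt f f0 mf).
by have [_ h] := disintegrationP eta; exact: (h B mB).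
Qed.

(** A version of the conditional expectation of [g] given [pi], defined at every [y]. *)
Definition fibre_mean (g : borel z0 -> R) (y : borel (pi z0)) : R :=
  \int[kernel_at kappa y]_z g z.

Implicit Types g : borel z0 -> R.

Lemma fibre_mean_bounded g : measurable_fun setT g -> bounded_fct g ->
  bounded_fct (fibre_mean g).
Proof.
move=> mg [C gC]; exists C => y.
have := @Rintegral_close _ _ _ (kernel_at kappa y) g (fun=> 0) C mg
  (ex_intro _ C gC) (measurable_cst _) (bounded_fct_cst _ _).
rewrite Rintegral_prob_cst subr0; apply => z; rewrite subr0; exact: gC.
Qed.

(** Adding the bound of [g] reduces measurability and integration of conditional means to
    nonnegative functions, for which the kernel lemmas are stated. *)
Lemma fibre_mean_shift g (c : R) : measurable_fun setT g -> bounded_fct g ->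
  forall y, fibre_mean (fun z => g z + c) y = fibre_mean g y + c.
Proof.
move=> mg bg y; rewrite /fibre_mean RintegralD //.
- by rewrite Rintegral_prob_cst.
- exact: bounded_integrable.
- by apply: bounded_integrable; [exact: measurable_cst|exact: bounded_fct_cst].
Qed.

Lemma ge0_measurable_fibre_mean g : (forall z, 0 <= g z) ->
  measurable_fun setT g -> measurable_fun setT (fibre_mean g).
Proof.
move=> g0 mg; apply: measurableT_comp => //.
apply: measurable_fun_integral_kernel.
- by move=> E mE; exact: measurable_kernel.
- by move=> z; rewrite lee_fin.
- exact/measurable_EFinP.
Qed.

Lemma measurable_fibre_mean g : measurable_fun setT g -> bounded_fct g ->
  measurable_fun setT (fibre_mean g).
Proof.
move=> mg bg; have [C gC] := bg.
rewrite (_ : fibre_mean g = fun y => fibre_mean (fun z => g z + C) y - C).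
  apply: measurable_funB; last exact: measurable_cst.
  apply: ge0_measurable_fibre_mean => [z|].
    by have := gC z; rewrite ler_norml -lerBlDr sub0r => /andP[].
  by apply: measurable_funD => //; exact: measurable_cst.
by apply/funext => y; rewrite fibre_mean_shift // addrK.
Qed.

Lemma Rintegral_disintegration g : measurable_fun setT g -> bounded_fct g ->
  \int[eta]_z g z = \int[tau]_y fibre_mean g y.
Proof.
move=> mg bg; have [C gC] := bg.
have g0 z : 0 <= g z + C.
  by have := gC z; rewrite ler_norml -lerBlDr sub0r => /andP[].
have mgC : measurable_fun setT (fun z => g z + C).
  by apply: measurable_funD => //; exact: measurable_cst.
have bgC : bounded_fct (fun z => g z + C).
  by apply: bounded_fctD => //; exact: bounded_fct_cst.
apply: (addIr C).
have -> : \int[eta]_z g z + C = \int[eta]_z (g z + C).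
  rewrite RintegralD ?Rintegral_prob_cst //; first exact: bounded_integrable.
  by apply: bounded_integrable; [exact: measurable_cst|exact: bounded_fct_cst].
have -> : \int[tau]_y fibre_mean g y + C = \int[tau]_y fibre_mean (fun z => g z + C) y.
  under [RHS]eq_Rintegral do rewrite fibre_mean_shift //.
  rewrite RintegralD ?Rintegral_prob_cst //; apply: bounded_integrable.
  - exact: measurable_fibre_mean.
  - exact: fibre_mean_bounded.
  - exact: measurable_cst.
  - exact: bounded_fct_cst.
have ezC : forall z : borel z0, (0 <= (g z + C)%:E)%E by move=> z; rewrite lee_fin.
rewrite /Rintegral ge0_integral_disintegration //; last exact/measurable_EFinP.
congr fine; apply: eq_integral => y _.
exact: (@EFin_Rintegral _ _ _ (kernel_at kappa y)).
Qed.

Definition fibre_prob (u : seq A) (y : borel (pi z0)) : R := fine (kappa y (word_cyl u)).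

Lemma fibre_probE u y : fibre_prob u y = fibre_mean (\1_(word_cyl u)) y.
Proof.
by rewrite /fibre_mean Rintegral_indic //; exact: measurable_word_cyl.
Qed.

Lemma fibre_prob_ge0 u y : 0 <= fibre_prob u y.
Proof. exact/fine_ge0/measure_ge0. Qed.

Lemma measurable_fibre_prob u : measurable_fun setT (fibre_prob u).
Proof.
apply: measurableT_comp => //; apply: measurable_kernel; exact: measurable_word_cyl.
Qed.

Lemma fibre_prob_rcons u y :
  fibre_prob u y = \sum_a fibre_prob (rcons u a) y.
Proof.
rewrite fibre_probE; under eq_bigr do rewrite fibre_probE.
rewrite /fibre_mean -Rintegral_sum; last 2 first.
- by move=> a; apply: measurable_indic; exact: measurable_word_cyl.
- by move=> a; exact: bounded_fct_indic.
apply: eq_Rintegral => z _.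
rewrite (bigD1 (z.1 (size u)%:Z)) //= big1 ?addr0 => [|a az].
  rewrite word_cyl_rcons indicI /= [X in _ * X]indicE mem_set ?mulr1 //.
rewrite word_cyl_rcons indicI /= [X in _ * X]indicE memNset ?mulr0 //= => za.
by rewrite za eqxx in az.
Qed.

Lemma fibre_prob_sum n y : \sum_(u : n.-tuple A) fibre_prob u y = 1.
Proof.
under eq_bigr do rewrite fibre_probE.
rewrite /fibre_mean -Rintegral_sum; last 2 first.
- by move=> u; apply: measurable_indic; exact: measurable_word_cyl.
- by move=> u; exact: bounded_fct_indic.
rewrite -[RHS](Rintegral_prob_cst (kernel_at kappa y) 1).
apply: eq_Rintegral => z _; have [u zu] := word_cyl_tuple n z.
rewrite (bigD1 u) //= big1 ?addr0 => [|v vu].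
  by rewrite indicE mem_set.
rewrite indicE memNset //= => zv; case/eqP: vu.
exact: word_cyl_inj zv zu.
Qed.

Lemma fibre_prob_le1 u y : fibre_prob u y <= 1.
Proof.
have := fibre_prob_sum (size u) y; rewrite (bigD1 (in_tuple u)) //= => <-.
by rewrite lerDl sumr_ge0 // => v _; exact: fibre_prob_ge0.
Qed.

Lemma bounded_fibre_prob u : bounded_fct (fibre_prob u).
Proof.
by apply: bounded_fct01 => y; rewrite fibre_prob_ge0 fibre_prob_le1.
Qed.

Lemma ae_fibre : {ae tau, forall y, {ae kernel_at kappa y, forall z, pi z = y}}.
Proof.
have [h _] := disintegrationP eta; apply: filterS h => y hy.
exact: (@probability_ae1P _ _ _ (kernel_at kappa y) _ (measurable_fibre y) hy).
Qed.

Lemma Rintegral_ae_eq d (T : measurableType d) (P : probability T R) (f g : T -> R) :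
  measurable_fun setT f -> measurable_fun setT g ->
  {ae P, forall x, f x = g x} -> \int[P]_x f x = \int[P]_x g x.
Proof.
move=> mf mg fg; congr fine; apply: ae_eq_integral => //.
- exact/measurable_EFinP.
- exact/measurable_EFinP.
- by apply: filterS fg => x + _ => /= ->.
Qed.

(** [g] may be replaced by the maximum of [f] and [g], equal to it almost everywhere, and then the
    inequality holds everywhere. *)
Lemma Rintegral_ae_le d (T : measurableType d) (P : probability T R) (f g : T -> R) :
  measurable_fun setT f -> bounded_fct f ->
  measurable_fun setT g -> bounded_fct g ->
  {ae P, forall x, f x <= g x} -> \int[P]_x f x <= \int[P]_x g x.
Proof.
move=> mf [Mf bf] mg [Mg bg] fg.
have mfg : measurable_fun setT (f \max g) by exact: measurable_maxr.
rewrite [leRHS](@Rintegral_ae_eq _ _ P g (f \max g)) //; last first.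
  by apply: filterS fg => x fgx /=; rewrite (max_idPr fgx).
apply: le_Rintegral => //.
- by apply: bounded_integrable => //; exists Mf.
- apply: bounded_integrable => //; exists (Num.max Mf Mg) => x /=.
  by rewrite le_max; case: (leP (f x) (g x)) => _; rewrite ?bf ?bg ?orbT.
- by move=> x _ /=; rewrite le_max lexx.
Qed.

(** On almost every fibre [pi] is almost surely constant, so a function of [pi] factors out of the
    conditional expectation. *)
Lemma fibre_mean_pi (g : borel (pi z0) -> R) (h : borel z0 -> R) :
  measurable_fun setT g -> bounded_fct g ->
  measurable_fun setT h -> bounded_fct h ->
  {ae tau, forall y, fibre_mean (fun z => g (pi z) * h z) y = g y * fibre_mean h y}.
Proof.
move=> mg bg mh bh; apply: filterS ae_fibre => y hy.
rewrite /fibre_mean -RintegralZl //; last exact: bounded_integrable.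
apply: Rintegral_ae_eq.
- apply: measurable_funM => //.
  apply: (measurableT_comp mg).
  exact: (@continuous_borel _ _ z0 (pi z0) _ (@continuous_unstable_proj R A M X)).
- by apply: measurable_funM => //; exact: measurable_cst.
- apply: (@filterS _ _ (ae_filter_ringOfSetsType (kernel_at kappa y))) hy => z.
  by move=> ->.
Qed.

End disintegrated_integral.

Section limn_esup_lemmas.
Context {R : realType}.
Implicit Types u a : (\bar R)^nat.

(** Only positive indices are compared: the sequences of interest carry a factor 1 / n, which is
    meaningless at n = 0. *)
Lemma limn_esup_leD u a (c : R) :
  (forall n, (0 < n)%N -> (u n + c%:E <= a n)%E) ->
  (limn_esup u + c%:E <= limn_esup a)%E.
Proof.
move=> ua; apply: le_ereal_inf_tmp => _ [V [N _ NV] <-].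
rewrite -leeBrDr //; apply: (@le_trans _ _ (ereal_sup (u @` [set n | (N.+1 <= n)%N]))).
  apply: ereal_inf_lbound; exists [set n | (N.+1 <= n)%N] => //; exact: nbhs_infty_ge.
apply: ge_ereal_sup => _ [n Nn <-]; rewrite leeBrDr //.
apply: le_trans (ua n (leq_ltn_trans (leq0n N) Nn)) _.
by apply: ereal_sup_ubound; exists n => //; apply: NV => /=; exact: ltnW.
Qed.

Lemma limn_esup_ge u (l : \bar R) :
  (forall n, (0 < n)%N -> (l <= u n)%E) -> (l <= limn_esup u)%E.
Proof.
move=> lu; apply: le_ereal_inf_tmp => _ [V [N _ NV] <-].
apply: le_trans (lu N.+1 isT) _.
by apply: ereal_sup_ubound; exists N.+1 => //; apply: NV => /=.
Qed.

Lemma limn_esup_le u (l : \bar R) :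
  (forall n, (0 < n)%N -> (u n <= l)%E) -> (limn_esup u <= l)%E.
Proof.
move=> lu; apply: (@le_trans _ _ (ereal_sup (u @` [set n | (1 <= n)%N]))).
  apply: ereal_inf_lbound; exists [set n | (1 <= n)%N] => //; exact: nbhs_infty_ge.
by apply: ge_ereal_sup => _ [n n0 <-]; exact: lu.
Qed.

Lemma limn_esup_frequently u (l : R) (N : nat) (e : R) : 0 < e ->
  (l%:E <= limn_esup u)%E -> exists2 n, (N <= n)%N & ((l - e)%:E < u n)%E.
Proof.
move=> e0 lu; apply: contrapT => no.
have : (limn_esup u <= (l - e)%:E)%E.
  apply: (@le_trans _ _ (ereal_sup (u @` [set n | (N <= n)%N]))).
    apply: ereal_inf_lbound; exists [set n | (N <= n)%N] => //; exact: nbhs_infty_ge.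
  apply: ge_ereal_sup => _ [n Nn <-]; rewrite leNgt; apply/negP => h.
  by apply: no; exists n.
by move=> /(le_trans lu); rewrite lee_fin leNgt ltrBlDr ltrDl e0.
Qed.

End limn_esup_lemmas.

Section upper_bound.
Context {R : realType} {A : finType} {M : rel A} {X : metricType R}.
Local Notation Sigma := (shift_space R M).
Local Notation K := (Sigma * X)%type.
Variables (z0 : K) (eta : probability (borel z0) R).
Variables (F : Sigma -> X -> X) (phi : K -> R).
Local Notation pi := (@unstable_proj R A M X).
Local Notation tau := (transverse eta).
Local Notation kappa := (disintegration eta).

Definition word_entropy n (y : borel (pi z0)) : R :=
  - \sum_(u : n.-tuple A) fibre_prob eta u y * ln (fibre_prob eta u y).

Lemma partition_entropy_fibre n y :
  partition_entropy (kappa y) (skew_partition F n) = word_entropy n y.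
Proof. by apply: partition_entropyE; exact: measure0. Qed.

Lemma measurable_word_entropy n : measurable_fun setT (word_entropy n).
Proof.
apply: measurableT_comp => //; apply: measurable_sum => u.
apply: measurable_funM; first exact: measurable_fibre_prob.
by apply: measurableT_comp => //; exact: measurable_fibre_prob.
Qed.

Lemma mul_ln_bound (p : R) : 0 <= p <= 1 -> 0 <= - (p * ln p) <= 1.
Proof.
move=> /andP[p0 p1]; apply/andP; split.
  by rewrite -mulrN mulr_ge0 // oppr_ge0 ln_le0.
have := @mul_ln_le R p 1 p0 ler01 (fun=> ltr01).
by rewrite ln1 sub0r mulrN => h; apply: le_trans h _; rewrite gerBl.
Qed.

Lemma bounded_word_entropy n : bounded_fct (word_entropy n).
Proof.
apply: bounded_fctN; apply: bounded_fct_sum => u; exists 1 => y.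
have := @mul_ln_bound (fibre_prob eta u y).
rewrite fibre_prob_ge0 fibre_prob_le1 => /(_ isT)/andP[h0 h1].
by rewrite -normrN ger0_norm.
Qed.

Lemma word_entropy_ge0 n y : 0 <= word_entropy n y.
Proof.
rewrite /word_entropy -sumrN; apply: sumr_ge0 => u _.
have := @mul_ln_bound (fibre_prob eta u y).
by rewrite fibre_prob_ge0 fibre_prob_le1 => /(_ isT)/andP[].
Qed.

Definition mean_entropy n : R := \int[tau]_y word_entropy n y.

Lemma metric_entropyE : metric_entropy F eta =
  limn_esup (fun n => (n%:R^-1 * mean_entropy n)%:E).
Proof.
rewrite /metric_entropy; congr limn_esup; apply/funext => n.
under eq_integral do rewrite partition_entropy_fibre.
rewrite EFin_Rintegral.
- rewrite RintegralZl //; apply: bounded_integrable.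
    exact: measurable_word_entropy.
  exact: bounded_word_entropy.
- by apply: measurable_funM; [exact: measurable_cst|exact: measurable_word_entropy].
- by apply: bounded_fctM; [exact: bounded_fct_cst|exact: bounded_word_entropy].
Qed.

Hypothesis cX : compact [set: X].
Hypothesis cF : forall w, continuous (F w).
Hypothesis hF : holder_family F.
Hypothesis cphi : continuous phi.

Let cS n : continuous (birkhoff F phi n).
Proof. exact: continuous_birkhoff. Qed.

Let mS n : measurable_fun setT (birkhoff F phi n : borel z0 -> R).
Proof. exact: continuous_borel_real. Qed.

Let bS n : bounded_fct (birkhoff F phi n).
Proof. by apply: continuous_bounded_fct => //; exact: compact_skew_space. Qed.

Let mphi : measurable_fun setT (phi : borel z0 -> R).
Proof. exact: continuous_borel_real. Qed.

Let bphi : bounded_fct phi.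
Proof. by apply: continuous_bounded_fct => //; exact: compact_skew_space. Qed.

Definition partition_function n (t : X) : R :=
  \sum_(u : n.-tuple A | `[< @cylinder R A M n u !=set0 >])
     expR (birkhoff F phi n (theta F z0 phi u t, t)).

Lemma fibre_free_energy n :
  {ae tau, forall y, word_entropy n y + fibre_mean eta (birkhoff F phi n) y
     <= ln (partition_function n y.2)}.
Proof.
apply: filterS (ae_fibre eta) => y hy.
pose Phi (u : n.-tuple A) := birkhoff F phi n (theta F z0 phi u y.2, y.2).
have mI (u : n.-tuple A) : measurable_fun setT
    (fun z : borel z0 => Phi u * \1_(word_cyl u) z).
  apply: measurable_funM; first exact: measurable_cst.
  by apply: measurable_indic; exact: measurable_word_cyl.
have bI (u : n.-tuple A) : bounded_fct (fun z : borel z0 => Phi u * \1_(word_cyl u) z).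
  by apply: bounded_fctM; [exact: bounded_fct_cst|exact: bounded_fct_indic].
have le1 : fibre_mean eta (birkhoff F phi n) y <=
    \sum_(u : n.-tuple A) fibre_prob eta u y * Phi u.
  have -> : \sum_(u : n.-tuple A) fibre_prob eta u y * Phi u =
      \int[kernel_at kappa y]_z (\sum_(u : n.-tuple A) Phi u * \1_(word_cyl u) z).
    rewrite Rintegral_sum //; apply: eq_bigr => u _.
    have Iu : (kernel_at kappa y).-integrable setT
        (EFin \o (\1_(word_cyl u) : borel z0 -> R)).
      apply: bounded_integrable; last exact: bounded_fct_indic.
      by apply: measurable_indic; exact: measurable_word_cyl.
    by rewrite (RintegralZl _ measurableT Iu) fibre_probE mulrC.
  apply: Rintegral_ae_le => //.
  - exact: measurable_sum.
  - exact: bounded_fct_sum.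
  apply: (@filterS _ _ (ae_filter_ringOfSetsType (kernel_at kappa y))) hy => z zy.
  have [u zu] := word_cyl_tuple n z.
  rewrite (bigD1 u) //= big1 ?addr0 => [|v vu]; last first.
    rewrite indicE memNset ?mulr0 //= => zv; case/eqP: vu.
    exact: word_cyl_inj zv zu.
  rewrite indicE mem_set // mulr1 /Phi.
  (* The fibre over [y] has a single point of [X], namely [y.2], so the maximiser at [y.2] dominates
     all points of the fibre in the same cylinder. *)
  have z2 : z.2 = y.2 by rewrite -zy.
  have /word_cyl_cylinder zc := zu.
  have [_] := thetaP cX cF hF z0 z.2 cphi zc.
  by rewrite -surjective_pairing z2.
apply: le_trans (lerD (lexx _) le1) _.
apply: entropy_free_energy.
- by move=> u; exact: fibre_prob_ge0.
- exact: fibre_prob_sum.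
- move=> u /negP nu; rewrite /fibre_prob (_ : word_cyl u = set0) ?measure0 //.
  apply/seteqP; split => // z /word_cyl_cylinder zu; apply: nu.
  by apply/asboolP; exists z.1.
Qed.

Hypothesis inv : invariant_measure F eta.

Lemma Rintegral_invariant (g : K -> R) : continuous g ->
  \int[eta]_z g (Defs.skew F z) = \int[eta]_z g z.
Proof.
move=> cg.
have mT : measurable_fun setT (Defs.skew F : borel z0 -> borel z0).
  by apply: continuous_borel; exact: continuous_skew.
pose T : {mfun borel z0 >-> borel z0} := mfun_Sub (mem_set mT).
have mg : measurable_fun setT (g : borel z0 -> R) by exact: continuous_borel_real.
have bg : bounded_fct g.
  by apply: continuous_bounded_fct => //; exact: compact_skew_space.
rewrite -[LHS](Rintegral_distribution eta T mg bg); congr fine.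
by apply: eq_measure_integral => B mB _; exact: inv.
Qed.

Lemma Rintegral_birkhoff n :
  \int[eta]_z birkhoff F phi n z = n%:R * \int[eta]_z phi z.
Proof.
have ck k : continuous (fun z => phi (iter k (Defs.skew F) z)).
  move=> z; apply: (@continuous_comp _ _ _ (iter k (Defs.skew F)) phi).
    exact: continuous_iter_skew.
  exact: cphi.
have Ek k : \int[eta]_z phi (iter k (Defs.skew F) z) = \int[eta]_z phi z.
  elim: k => // k ih; rewrite -{}ih -[RHS]Rintegral_invariant //.
  by apply: eq_Rintegral => z _; rewrite -iterSr.
rewrite /birkhoff Rintegral_sum; last 2 first.
- by move=> k; apply: continuous_borel_real; exact: ck.
- move=> k; apply: continuous_bounded_fct; last exact: ck.
  exact: compact_skew_space.
under eq_bigr do rewrite Ek.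
by rewrite sumr_const card_ord mulr_natl.
Qed.

Theorem entropy_le_pressure :
  (metric_entropy F eta + (\int[eta]_z phi z)%:E <= pressure F z0 phi)%E.
Proof.
rewrite metric_entropyE; apply: limn_esup_leD => n n0.
set a := ereal_sup _.
have ha t : ((n%:R^-1 * ln (partition_function n t))%:E <= a)%E.
  by apply: ereal_sup_ubound; exists t.
(* If the supremum is infinite, it is plus infinity, where the bound is trivial: the value at [z0.2]
   excludes minus infinity. *)
case: a ha => [r| |] ha; last 2 first.
- by rewrite leey.
- by have := ha z0.2.
have n0' : (0 < n%:R :> R) by rewrite ltr0n.
rewrite -EFinD lee_fin (_ : _ + _ = n%:R^-1 *
    \int[tau]_y (word_entropy n y + fibre_mean eta (birkhoff F phi n) y)).
  rewrite ler_pdivrMl // -(Rintegral_prob_cst tau (n%:R * r)).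
  apply: Rintegral_ae_le.
  - apply: measurable_funD; first exact: measurable_word_entropy.
    exact: measurable_fibre_mean.
  - apply: bounded_fctD; first exact: bounded_word_entropy.
    exact: fibre_mean_bounded.
  - exact: measurable_cst.
  - exact: bounded_fct_cst.
  apply: filterS (fibre_free_energy n) => y /le_trans; apply.
  by rewrite -ler_pdivrMl // -lee_fin.
rewrite RintegralD //; last 2 first.
- apply: bounded_integrable; first exact: measurable_word_entropy.
  exact: bounded_word_entropy.
- apply: bounded_integrable; first exact: measurable_fibre_mean.
  exact: fibre_mean_bounded.
rewrite -Rintegral_disintegration // Rintegral_birkhoff mulrDr mulKf //.
by rewrite gt_eqF.
Qed.

End upper_bound.

(** * The equilibrium measure *)

Section prefix_weights.
Context {R : realType} {A : finType}.
Variable rho : seq A -> A -> R.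
Hypothesis rho_ge0 : forall w a, 0 <= rho w a.
Hypothesis rho_sum : forall w, \sum_a rho w a <= 1.

(** The weight of reading [u] letter by letter once [w] has been read, [rho] giving the weight of
    the next letter after each prefix. *)
Fixpoint prefix_weight (w u : seq A) : R :=
  if u is a :: u' then rho w a * prefix_weight (rcons w a) u' else 1.

Lemma prefix_weight_ge0 w u : 0 <= prefix_weight w u.
Proof. by elim: u w => //= a u ih w; rewrite mulr_ge0. Qed.

Lemma sum_prefix_weight n w : \sum_(u : n.-tuple A) prefix_weight w u <= 1.
Proof.
elim: n w => [|n ih] w.
  by rewrite (big_pred1 [tuple]) //= => u; apply/esym/eqP; exact: tuple0.
pose h (p : A * n.-tuple A) : n.+1.-tuple A := [tuple of p.1 :: p.2].
have hb : bijective h.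
  exists (fun u => (thead u, [tuple of behead u])) => [[a u]|u].
    by rewrite /h /= theadE; congr pair; apply: val_inj.
  by rewrite /h /= -tuple_eta.
rewrite (reindex h) /=; last exact: onW_bij.
rewrite -(pair_bigA _ (fun a (u : n.-tuple A) => rho w a * prefix_weight (rcons w a) u)) /=.
apply: le_trans (rho_sum w); apply: ler_sum => a _.
by rewrite -mulr_sumr ler_piMr.
Qed.

Lemma prefix_weightE (a0 : A) w u : prefix_weight w u =
  \prod_(k < size u) rho (w ++ take k u) (nth a0 u k).
Proof.
elim: u w => [|a u ih] w /=; first by rewrite big_ord0.
rewrite big_ord_recl /= cats0 ih; congr (_ * _).
by apply: eq_bigr => k _; rewrite cat_rcons.
Qed.

End prefix_weights.

Section base_points.
Context {R : realType} {A : finType} {M : rel A}.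
Local Notation Sigma := (shift_space R M).
Variable w0 : Sigma.

(* One past is fixed for all words starting with [a], so that the future letters
   are not determined by the past of a base point. *)
Definition past_of (a : A) : Sigma := xget w0 [set w : Sigma | w 0 = a].

Definition splice (w : Sigma) (i : int) : A :=
  if i is Negz _ then past_of (w 0) i else w i.

Lemma spliceP (w : Sigma) : markov_seq M (splice w).
Proof.
have p0 : past_of (w 0) 0 = w 0.
  by apply: (@xgetPex _ w0 [set v : Sigma | v 0 = w 0]); exists w.
case=> [k|[|k]].
- by have := coordP w (Posz k); rewrite -[Posz k + 1]/(Posz (k + 1)).
- by have := coordP (past_of (w 0)) (-1); rewrite /= p0.
have := coordP (past_of (w 0)) (Negz k.+1).
by rewrite (_ : Negz k.+1 + 1 = Negz k); last by lia.
Qed.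

Definition base (w : Sigma) : Sigma := Symbolic (spliceP w).

Lemma base_ge0 w (i : int) : 0 <= i -> base w i = w i.
Proof. by case: i. Qed.

(** The negative coordinates of a base point depend on letter 0 alone, so one common letter already
    gives equal pasts; hence [0 < n]. *)
Lemma base_agree (w v : Sigma) n : (0 < n)%N ->
  (forall k, (k < n)%N -> w k%:Z = v k%:Z) ->
  forall i : int, i < n%:Z -> base w i = base v i.
Proof.
move=> n0 wv [k|k] kn /=; first by apply: wv; rewrite -ltz_nat.
by rewrite (wv 0%N n0).
Qed.

End base_points.

Section past_dependence.
Context {R : realType} {A : finType} {M : rel A} {X : metricType R}.
Local Notation Sigma := (shift_space R M).
Local Notation K := (Sigma * X)%type.
Variable (F : Sigma -> X -> X).
Hypothesis dF : depends_on_past F.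

(** At time j the map applied to the point of [X] reads coordinates up to j only, and the last time
    used is k - 1. *)
Lemma iter_skew_past k (w v : Sigma) t :
  (forall i : int, i < k%:Z -> w i = v i) ->
  (iter k (Defs.skew F) (w, t)).2 = (iter k (Defs.skew F) (v, t)).2.
Proof.
elim: k => // k ih wv /=; rewrite ih => [|i ik]; last first.
  by apply: wv; rewrite (lt_trans ik) // ltz_nat.
suff -> : F (iter k (Defs.skew F) (w, t)).1 = F (iter k (Defs.skew F) (v, t)).1 by [].
apply: dF => i i0; rewrite !iter_skew_coord /=; apply: wv.
by lia.
Qed.

Lemma unstable_proj_iter k (w v : Sigma) t :
  (forall i : int, i < k%:Z -> w i = v i) ->
  unstable_proj (iter k (Defs.skew F) (w, t)) =
  unstable_proj (iter k (Defs.skew F) (v, t)).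
Proof.
move=> wv; rewrite /unstable_proj (iter_skew_past _ wv); congr pair.
apply: symbolic_inj; apply/funext => -[i i1] /=; rewrite /restrict_neg /=.
rewrite !iter_skew_coord /=; apply: wv.
by move: (i1); rewrite -ltzD1 addNr => i0; rewrite gtrDr.
Qed.

End past_dependence.

Section finite_estimate.
Context {R : realType} {A : finType} {M : rel A} {X : metricType R}.
Local Notation Sigma := (shift_space R M).
Local Notation K := (Sigma * X)%type.
Local Notation Y := (past_space R M * X)%type.
Variables (z0 : K) (F : Sigma -> X -> X) (phi : K -> R).
Local Notation pi := (@unstable_proj R A M X).
Hypothesis cX : compact [set: X].
Hypothesis cF : forall w, continuous (F w).
Hypothesis hF : holder_family F.
Hypothesis cphi : continuous phi.

Definition window_fct n (G : seq A -> A -> Y -> R) (z : K) : R :=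
  G (mkseq (fun k : nat => z.1 k%:Z) n) (z.1 n%:Z) (pi z).

Lemma cardA_gt0 : (0 < #|A|%:R :> R).
Proof. by rewrite ltr0n; apply/card_gt0P; exists (z0.1 0). Qed.

Section weights.
Hypothesis dF : depends_on_past F.
Variables (n : nat) (G : seq A -> A -> Y -> R) (B : R) (t : X).
Hypothesis G_sum : forall w y, \sum_a expR (- G w a y) <= 1.
Hypothesis G_bound : forall z, `|window_fct n G z| <= B.

(** Any point starting with [w] serves: by [unstable_proj_iter] the choice does not affect the
    weights below. *)
Definition point_of (w : seq A) : Sigma :=
  xget z0.1 [set v : Sigma | mkseq (fun k : nat => v k%:Z) (size w) = w].

(* The first [n.+1] letters get uniform weights, as the window of [G] must start
   at a time [>= 1]: at time [0] the past of the base point reveals [w 0]. *)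
Definition conditional_weight (w : seq A) (a : A) : R :=
  if (size w <= n)%N then #|A|%:R^-1 else
  expR (- G (drop (size w - n) w) a
    (pi (iter (size w - n) (Defs.skew F) (base z0.1 (point_of w), t)))).

Lemma conditional_weight_ge0 w a : 0 <= conditional_weight w a.
Proof.
rewrite /conditional_weight; case: ifP => _; last exact: expR_ge0.
by rewrite invr_ge0 ltW // cardA_gt0.
Qed.

Lemma conditional_weight_sum w : \sum_a conditional_weight w a <= 1.
Proof.
rewrite /conditional_weight; case: (size w <= n)%N; last exact: G_sum.
by rewrite sumr_const -[X in X <= _]mulr_natr mulVf ?gt_eqF ?cardA_gt0.
Qed.

(** The base points of [v] and of the representative of the prefix agree on all coordinates below
    [k], hence have the same projection after k - n steps. The weight thus depends on the prefix
    alone while being the value of exp(- g) along the orbit from [v]. *)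
Lemma conditional_weightE N (u : N.-tuple A) (v : Sigma) (a0 : A) k :
  cylinder u v -> (n < k)%N -> (k < N)%N ->
  conditional_weight (take k u) (nth a0 u k) =
  expR (- window_fct n G (iter (k - n) (Defs.skew F) (base z0.1 v, t))).
Proof.
move=> uv nk kN.
have uE j : (j < N)%N -> nth a0 u j = v j%:Z.
  by move=> jN; rewrite (uv (Ordinal jN)) (tnth_nth a0).
have sk : size (take k u) = k by rewrite size_take size_tuple kN.
have takeE : take k u = mkseq (fun j : nat => v j%:Z) k.
  apply: (@eq_from_nth _ a0) => [|j]; rewrite sk ?size_mkseq // => jk.
  by rewrite nth_mkseq // nth_take // uE // (ltn_trans jk).
rewrite /conditional_weight sk leqNgt nk /=; congr (expR (- _)).
rewrite /window_fct; congr (G _ _ _).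
- rewrite takeE; apply: (@eq_from_nth _ a0).
    by rewrite size_drop !size_mkseq subKn // ltnW.
  rewrite size_drop size_mkseq subKn ?(ltnW nk) // => j jn.
  rewrite nth_drop !nth_mkseq //; last by rewrite -ltn_subRL subKn // ltnW.
  by rewrite iter_skew_coord base_ge0 //= addnC.
- rewrite uE // iter_skew_coord base_ge0 //=.
  by congr (v _); rewrite -PoszD subnKC // ltnW.
- apply: (unstable_proj_iter dF) => i ik; apply: (@base_agree _ _ _ _ _ _ k).
  + exact: leq_ltn_trans nk.
  + have := @xgetPex _ z0.1 [set v : Sigma |
      mkseq (fun k : nat => v k%:Z) (size (take k u)) = take k u].
    rewrite -/(point_of _) sk => /(_ (ex_intro _ v (esym takeE))) h j jk.
    have := congr1 (fun s => nth a0 s j) h.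
    by rewrite /= takeE !nth_mkseq.
  + by apply: lt_le_trans ik _; rewrite lez_nat leq_subr.
Qed.

(** The weights of letters n + 1, ..., n + m match [g] at times 1, ..., m. The n + 1 initial letters
    cost ln #|A| each. Of the Birkhoff sum there remain time 0 and the last n times, whose windows
    overrun the word: n + 1 terms of size at most [B]. *)
Definition estimate_cst : R := n.+1%:R * ln #|A|%:R + n.+1%:R * B.

Lemma prefix_weight_ge m (u : (n.+1 + m).-tuple A) (v : Sigma) : cylinder u v ->
  expR (- (birkhoff F (window_fct n G) (n.+1 + m) (base z0.1 v, t) + estimate_cst))
    <= prefix_weight conditional_weight [::] u.
Proof.
move=> uv; pose gg j := window_fct n G (iter j (Defs.skew F) (base z0.1 v, t)).
pose f k := if (k <= n)%N then ln (#|A|%:R : R) else gg (k - n)%N.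
have -> : prefix_weight conditional_weight [::] u = expR (- \sum_(k < n.+1 + m) f k).
  rewrite (prefix_weightE _ (z0.1 0)) size_tuple -sumrN expR_sum.
  apply: eq_bigr => k _; rewrite cat0s /f; case: leqP => [kn|nk]; last first.
    exact: conditional_weightE.
  rewrite /conditional_weight size_take size_tuple ltn_ord kn.
  by rewrite expRN lnK ?posrE // cardA_gt0.
rewrite ler_expR lerN2 big_split_ord /=.
rewrite (eq_bigr (fun=> ln #|A|%:R)) => [|k _]; last by rewrite /f /= -ltnS ltn_ord.
rewrite (eq_bigr (fun i : 'I_m => gg i.+1)) => [|i _]; last first.
  by rewrite /f /= leqNgt ltnS leq_addr /= addSn -addnS addKn.
have -> : birkhoff F (window_fct n G) (n.+1 + m) (base z0.1 v, t) =
    gg 0%N + (\sum_(i < m) gg i.+1 + \sum_(i < n) gg (m + i).+1).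
  by rewrite /birkhoff addSn addnC big_ord_recl big_split_ord.
have gB j : - B <= gg j.
  by have := G_bound (iter j (Defs.skew F) (base z0.1 v, t)); rewrite ler_norml => /andP[].
have s1 : - (n%:R * B) <= \sum_(i < n) gg (m + i).+1.
  rewrite -mulrN -[n in leLHS]card_ord mulr_natl -sumr_const.
  by apply: ler_sum => i _; exact: gB.
have g0 := gB 0%N; rewrite sumr_const card_ord -[_ *+ n.+1]mulr_natl /estimate_cst -natr1.
by lra.
Qed.

End weights.

Definition gibbs_weight N (t : X) (u : N.-tuple A) : R :=
  if `[< @cylinder R A M N u !=set0 >] then
    expR (birkhoff F phi N (theta F z0 phi u t, t)) / partition_function z0 F phi N t
  else 0.

Definition empirical N (t : X) (f : K -> R) : R :=
  N%:R^-1 * \sum_(u : N.-tuple A)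
    gibbs_weight t u * birkhoff F f N (base z0.1 (theta F z0 phi u t), t).

Lemma partition_function_gt0 N t : 0 < partition_function z0 F phi N t.
Proof.
have [u uz] := word_cyl_tuple N z0.
rewrite /partition_function (bigD1 u) /=; last first.
  by apply/asboolP; exists z0.1; apply/word_cyl_cylinder.
rewrite ltr_pwDl ?expR_gt0 //.
by apply: sumr_ge0 => v _; exact: expR_ge0.
Qed.

Lemma gibbs_weight_ge0 N t (u : N.-tuple A) : 0 <= gibbs_weight t u.
Proof.
rewrite /gibbs_weight; case: ifP => // _.
by rewrite divr_ge0 ?expR_ge0 // ltW // partition_function_gt0.
Qed.

Lemma gibbs_weight_sum N t : \sum_(u : N.-tuple A) gibbs_weight t u = 1.
Proof.
rewrite /gibbs_weight -big_mkcond /= -mulr_suml divff //.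
by rewrite gt_eqF // partition_function_gt0.
Qed.

Lemma birkhoffD f g N z :
  birkhoff F (fun z => f z + g z) N z = birkhoff F f N z + birkhoff F g N z.
Proof. by rewrite /birkhoff big_split. Qed.

Lemma empirical_positive N t : (0 < N)%N -> positive_functional (empirical N t).
Proof.
move=> N0; have N0' : N%:R != 0 :> R by rewrite pnatr_eq0 -lt0n.
split.
- move=> f g _ _; rewrite /empirical -mulrDr -big_split /=; congr (_ * _).
  by apply: eq_bigr => u _; rewrite birkhoffD mulrDr.
- move=> c f _; rewrite /empirical mulrCA; congr (_ * _); rewrite mulr_sumr.
  by apply: eq_bigr => u _; rewrite /birkhoff -mulr_sumr mulrCA.
- move=> f _ f0; rewrite mulr_ge0 ?invr_ge0 // sumr_ge0 // => u _.
  by rewrite mulr_ge0 ?gibbs_weight_ge0 // sumr_ge0.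
rewrite /empirical (eq_bigr (fun u => gibbs_weight t u * N%:R)).
  by rewrite -mulr_suml gibbs_weight_sum mul1r mulVf.
by move=> u _; rewrite /birkhoff sumr_const card_ord.
Qed.

(** Along each orbit, the sum of the differences telescopes to two boundary values, which the factor
    1 / N makes small. *)
Lemma empirical_invariant N t f B : (0 < N)%N -> (forall z, `|f z| <= B) ->
  `|empirical N t (fun z => f (Defs.skew F z)) - empirical N t f| <= N%:R^-1 * (B + B).
Proof.
move=> N0 fB; have N0' : 0 <= N%:R^-1 :> R by rewrite invr_ge0.
rewrite /empirical -mulrBr normrM (ger0_norm N0') ler_wpM2l // -sumrB.
apply: le_trans (ler_norm_sum _ _ _) _.
rewrite -[B + B]mul1r -(gibbs_weight_sum N t) mulr_suml; apply: ler_sum => u _.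
rewrite -mulrBr normrM (ger0_norm (gibbs_weight_ge0 _ _)).
rewrite ler_wpM2l ?gibbs_weight_ge0 //.
set z := (_, t).
have -> : birkhoff F (fun z => f (Defs.skew F z)) N z - birkhoff F f N z =
    f (iter N (Defs.skew F) z) - f z.
  rewrite /birkhoff -sumrB -(big_mkord xpredT (fun k =>
    f (iter k.+1 (Defs.skew F) z) - f (iter k (Defs.skew F) z))).
  by rewrite telescope_sumr.
by rewrite (le_trans (ler_normB _ _)) // lerD.
Qed.

(** For each word of positive weight, ln Z is the Birkhoff sum at [theta] minus ln q. Averaging over
    q brings in the entropy of the Gibbs weights, which the subprobability r bounds through - ln r,
    that is, through the Birkhoff sum of [g]. *)
Lemma pressure_estimate (C : R) n (G : seq A -> A -> Y -> R) (B : R) t m :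
  depends_on_past F ->
  (forall n (t : X) (w w' : Sigma),
    (forall i : int, 0 <= i <= n%:Z -> w i = w' i) ->
    `|birkhoff F phi n (w, t) - birkhoff F phi n (w', t)| <= C) ->
  (forall w y, \sum_a expR (- G w a y) <= 1) ->
  (forall z, `|window_fct n G z| <= B) ->
  (n.+1 + m)%:R^-1 * ln (partition_function z0 F phi (n.+1 + m) t) <=
    empirical (n.+1 + m) t (fun z => phi z + window_fct n G z)
    + (n.+1 + m)%:R^-1 * (C + estimate_cst n B).
Proof.
move=> dF hol GS GB; rewrite /empirical -mulrDr ler_wpM2l ?invr_ge0 //.
set N := (n.+1 + m)%N; set Z := partition_function _ _ _ _ _.
have Z0 : 0 < Z by exact: partition_function_gt0.
pose q (u : N.-tuple A) := gibbs_weight t u.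
pose r (u : N.-tuple A) := prefix_weight (conditional_weight n G t) [::] u.
pose b (u : N.-tuple A) := (base z0.1 (theta F z0 phi u t), t) : K.
have cyl_theta (u : N.-tuple A) : `[< @cylinder R A M N u !=set0 >] ->
    cylinder u (theta F z0 phi u t).
  by move=> /asboolP[v uv]; have [] := thetaP cX cF hF z0 t cphi uv.
have q_adm (u : N.-tuple A) : 0 < q u -> `[< @cylinder R A M N u !=set0 >].
  by rewrite /q /gibbs_weight; case: ifP => //; rewrite ltxx.
have r_ge (u : N.-tuple A) : 0 < q u ->
    expR (- (birkhoff F (window_fct n G) N (b u) + estimate_cst n B)) <= r u.
  by move=> /q_adm/cyl_theta uv; exact: prefix_weight_ge.
have := @gibbs R (N.-tuple A) q r (gibbs_weight_ge0 t) (gibbs_weight_sum N t).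
move=> /(_ _ _ _)/wrap[u||| h].
- by apply: prefix_weight_ge0; exact: conditional_weight_ge0.
- by move=> u /r_ge; apply: lt_le_trans; exact: expR_gt0.
- by apply: sum_prefix_weight; [exact: conditional_weight_ge0|exact: conditional_weight_sum].
have q1 : \sum_u q u = 1 by exact: gibbs_weight_sum.
rewrite -[ln Z]mul1r -[C + _]mul1r -q1 !mulr_suml -big_split /=.
rewrite -subr_ge0 -sumrB.
apply: (@le_trans _ _ (\sum_u q u * (ln (q u) - ln (r u)))).
  move: h; under [X in _ -> _ <= X]eq_bigr do rewrite mulrBr.
  by rewrite sumrB subr_ge0 lerN2.
apply: ler_sum => u _; rewrite -!mulrDr -mulrBr.
rewrite -/(q u); have [q0|qn0] := eqVneq (q u) 0; first by rewrite q0 !mul0r.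
have q_ge0 : 0 <= q u by exact: gibbs_weight_ge0.
have qp : 0 < q u by rewrite lt_def qn0.
rewrite ler_wpM2l //.
have -> : ln (q u) = birkhoff F phi N (theta F z0 phi u t, t) - ln Z.
  rewrite /q /gibbs_weight (q_adm _ qp) ln_div ?posrE ?expR_gt0 //.
  by rewrite expRK.
have lnr : - ln (r u) <= birkhoff F (window_fct n G) N (b u) + estimate_cst n B.
  rewrite lerNl -[leLHS]expRK ler_ln ?posrE ?expR_gt0 //; first exact: r_ge.
  by apply: lt_le_trans (r_ge _ qp); exact: expR_gt0.
(* The base point differs from [theta] only at negative coordinates, so the holonomy bound
   applies. *)
have := hol N t (theta F z0 phi u t) (base z0.1 (theta F z0 phi u t)).
move=> /(_ (fun i => _))/wrap[i /andP[i0 _]|]; first by rewrite base_ge0.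
rewrite ler_norml => /andP[_]; rewrite birkhoffD -/(b u) => h1.
by lra.
Qed.

End finite_estimate.

Section ultralimit.
Context {R : realType} (U : set_system nat).
Context {FU : UltraFilter U}.
Hypothesis Uoo : \oo `<=` U.

Lemma ultra_bounded_cvg (u : nat -> R) : bounded_fct u -> exists l : R, u j @[j --> U] --> l.
Proof.
move=> [B uB].
have [|x [_ cx]] := @segment_compact R (- B) B (u @ U) _.
  apply: (@filterS _ U _ setT); last exact: filterT.
  by move=> j _ /=; rewrite in_itv /= -ler_norml.
exists x => V xV; have [//|nV] := in_ultra_setVsetC (u @^-1` V) FU.
have [y [/= yV Vy]] := cx (~` V) V nV xV.
by [].
Qed.

(** A fixed ultrafilter gives limits of all bounded sequences at once, so the limit functional is
    linear on all bounded functions, including the discontinuous ones that the Riesz theorem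
    evaluates. *)
Definition ultralim (u : nat -> R) : R := xget 0 [set l : R | u j @[j --> U] --> l].

Lemma ultralimP u : bounded_fct u -> u j @[j --> U] --> ultralim u.
Proof.
by move=> /ultra_bounded_cvg h; exact: (@xgetPex _ 0 [set l : R | u j @[j --> U] --> l]).
Qed.

Lemma ultralim_unique (u : nat -> R) (l : R) : u j @[j --> U] --> l -> ultralim u = l.
Proof.
move=> ul; apply: (@cvg_unique R (@Rhausdorff R) (u @ U)) => //.
by apply: (@xgetPex _ 0 [set l : R | u j @[j --> U] --> l]); exists l.
Qed.

Lemma ultralim_ge0 u : bounded_fct u -> (forall j, 0 <= u j) -> 0 <= ultralim u.
Proof.
by move=> bu u0; apply: cvgr_to_ge (ultralimP bu) _; exact: nearW.
Qed.

Lemma ultralim_le u v (e : nat -> R) : bounded_fct u -> bounded_fct v ->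
  e j @[j --> \oo] --> 0 -> (\forall j \near \oo, u j <= v j + e j) ->
  ultralim u <= ultralim v.
Proof.
move=> bu bv e0 uv.
have eU : e j @[j --> U] --> 0 by apply: cvg_trans e0; exact: cvg_app.
have h : v j + e j - u j @[j --> U] --> ultralim v + 0 - ultralim u.
  by apply: cvgB; [apply: cvgD => //|]; exact: ultralimP.
rewrite -subr_ge0 -[ultralim v]addr0; apply: cvgr_to_ge h _; apply: Uoo.
by apply: filterS uv => j; rewrite subr_ge0.
Qed.

Variables (K : Type) (E : nat -> (K -> R) -> R).
Hypothesis E_pos : forall j, positive_functional (E j).

Lemma bounded_functionals f : bounded_fct f -> bounded_fct (fun j => E j f).
Proof.
move=> bf; have [B fB] := bf; exists B => j.
have := functional_close (E_pos j) bf (bounded_fct_cst K 0) (e := B).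
rewrite functional_cst // subr0; apply => x.
by rewrite subr0.
Qed.

Definition limit_functional (f : K -> R) : R := ultralim (fun j => E j f).

Lemma limit_functional_positive : positive_functional limit_functional.
Proof.
split.
- move=> f g bf bg; apply: ultralim_unique.
  rewrite (_ : (fun j => _) = fun j => E j f + E j g).
    by apply: cvgD; apply: ultralimP; exact: bounded_functionals.
  by apply/funext => j; case: (E_pos j) => + _ _ _; apply.
- move=> c f bf; apply: ultralim_unique.
  rewrite (_ : (fun j => _) = fun j => c * E j f).
    by apply: cvgM; [exact: cvg_cst|apply: ultralimP; exact: bounded_functionals].
  by apply/funext => j; case: (E_pos j) => _ + _ _; apply.
- move=> f bf f0; apply: ultralim_ge0; first exact: bounded_functionals.
  by move=> j; case: (E_pos j) => _ _ + _; apply.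
- apply: ultralim_unique; rewrite (_ : (fun j => _) = fun=> 1); first exact: cvg_cst.
  by apply/funext => j; case: (E_pos j).
Qed.

End ultralimit.

Section equilibrium_measure.
Context {R : realType} {A : finType} {M : rel A} {X : metricType R}.
Local Notation Sigma := (shift_space R M).
Local Notation K := (Sigma * X)%type.
Local Notation Y := (past_space R M * X)%type.
Variables (z0 : K) (F : Sigma -> X -> X) (phi : K -> R).
Local Notation pi := (@unstable_proj R A M X).
Hypothesis cX : compact [set: X].
Hypothesis cF : forall w, continuous (F w).
Hypothesis hF : holder_family F.
Hypothesis cphi : continuous phi.

(** The n + 1 letters are locally constant: within 2^-n of [z] a single function [G w a] is
    involved. *)
Lemma continuous_window_fct n (G : seq A -> A -> Y -> R) :
  (forall w a, continuous (G w a)) -> continuous (window_fct n G).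
Proof.
move=> cG; apply: metric_continuous_real => z e e0.
set w := mkseq (fun k : nat => z.1 k%:Z) n.
have [d d0 hd] : exists2 d, 0 < d & forall y, mdist (pi z) y < d ->
    `|G w (z.1 n%:Z) (pi z) - G w (z.1 n%:Z) y| < e.
  have /cvgrPdist_lt/(_ e e0)/nbhs_ballP[d d0 hd] := @cG w (z.1 n%:Z) (pi z).
  by exists d => // y zy; apply: hd; rewrite ballEmdist.
exists (Num.min d ((2^-1 : R) ^+ n)).
  by rewrite lt_min d0 exprn_gt0 // invr_gt0.
move=> z'; rewrite lt_min => /andP[zd]; rewrite mdist_prodE gt_max => /andP[zn _].
have zz k : (k <= n)%N -> z.1 k%:Z = z'.1 k%:Z.
  by move=> kn; exact: (sym_dist_lt_eq zn).
rewrite /window_fct -(zz n) //.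
have -> : mkseq (fun k : nat => z'.1 k%:Z) n = w.
  apply: (@eq_from_nth _ (z.1 0)); rewrite !size_mkseq // => k kn.
  by rewrite !nth_mkseq // zz // ltnW.
by apply: hd; apply: le_lt_trans (unstable_proj_le z z') zd.
Qed.

Hypothesis hol : holonomies F phi.
Hypothesis dF : depends_on_past F.

(** With [B] a bound of [phi], the partition function has between 1 and #|A|^n terms, each between
    exp(- n B) and exp(n B). *)
Lemma pressure_bounded : exists P, pressure F z0 phi = P%:E.
Proof.
have [B phiB] : bounded_fct phi.
  by apply: continuous_bounded_fct => //; exact: compact_skew_space.
have SB n z : `|birkhoff F phi n z| <= n%:R * B.
  apply: le_trans (ler_norm_sum _ _ _) _.
  by rewrite -[n in leRHS]card_ord mulr_natl -sumr_const; apply: ler_sum.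
have lo n : (0 < n)%N -> (((- B)%:E : \bar R) <= ereal_sup
    [set (n%:R^-1 * ln (partition_function z0 F phi n t))%:E | t in [set: X]])%E.
  move=> n0; have n0' : 0 < n%:R :> R by rewrite ltr0n.
  apply: le_trans (ereal_sup_ubound (ex_intro2 _ _ z0.2 I erefl)).
  rewrite lee_fin ler_pdivlMl // mulrN -[leLHS]expRK ler_ln ?posrE ?expR_gt0 //; last first.
    exact: partition_function_gt0.
  have [u uz] := word_cyl_tuple n z0.
  rewrite /partition_function (bigD1 u) /=; last first.
    by apply/asboolP; exists z0.1; apply/word_cyl_cylinder.
  rewrite -[leLHS]addr0 lerD //; last by apply: sumr_ge0 => v _; exact: expR_ge0.
  by rewrite ler_expR; have := SB n (theta F z0 phi u z0.2, z0.2); rewrite ler_norml => /andP[].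
have hi n : (0 < n)%N -> (ereal_sup
    [set (n%:R^-1 * ln (partition_function z0 F phi n t))%:E | t in [set: X]] <=
    (ln #|A|%:R + B)%:E)%E.
  move=> n0; have n0' : 0 < n%:R :> R by rewrite ltr0n.
  apply: ge_ereal_sup => _ [t _ <-]; rewrite lee_fin ler_pdivrMl //.
  rewrite -[leRHS]expRK ler_ln ?posrE ?expR_gt0 //; last exact: partition_function_gt0.
  rewrite mulrDr expRD expRM_natl lnK ?posrE ?(cardA_gt0 z0) //.
  apply: (@le_trans _ _ (\sum_(u : n.-tuple A) expR (n%:R * B))).
    rewrite /partition_function big_mkcond; apply: ler_sum => u _.
    case: ifP => _; last exact: expR_ge0.
    by rewrite ler_expR (le_trans (ler_norm _)).
  by rewrite sumr_const card_tuple -natrX -[leLHS]mulr_natl.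
have h1 : ((- B)%:E <= pressure F z0 phi)%E by apply: limn_esup_ge.
have h2 : (pressure F z0 phi <= (ln #|A|%:R + B)%:E)%E by apply: limn_esup_le.
exists (fine (pressure F z0 phi)); rewrite fineK // fin_numE.
by apply/andP; split; apply/eqP => e; move: h1 h2; rewrite e.
Qed.

(** The measure is chosen before [n] and [G]; this order allows [G] to approximate conditional
    probabilities of [eta] itself. *)
Theorem equilibrium_measure (P : R) : pressure F z0 phi = P%:E ->
  exists eta : probability (borel z0) R, invariant_measure F eta /\
  forall n (G : seq A -> A -> Y -> R),
    (forall w a, continuous (G w a)) -> 
    (forall w y, \sum_a expR (- G w a y) <= 1) ->
    P <= \int[eta]_z (phi z + window_fct n G z).
Proof.
move=> PE; have cK : compact [set: K] by exact: compact_skew_space.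
pose e j : R := j.+1%:R^-1.
have e0 j : 0 < e j by rewrite invr_gt0.
(* The pressure is an upper limit of suprema over [t], so a length and a point nearly realising it
   are chosen together, with lengths tending to infinity. *)
have /choice[Nt NtP] : forall j, exists Nt : nat * X, (j < Nt.1)%N /\
    P - e j < Nt.1%:R^-1 * ln (partition_function z0 F phi Nt.1 Nt.2).
  move=> j; have := @limn_esup_frequently R _ P j.+1 (e j) (e0 j) _.
  move=> /(_ (fun n => ereal_sup
    [set (n%:R^-1 * ln (partition_function z0 F phi n t))%:E | t in [set: X]])).
  rewrite -[limn_esup _]/(pressure F z0 phi) PE => /(_ (lexx _))[n jn].
  by move=> /ereal_sup_gt[_ [t _ <-]]; rewrite lte_fin => h; exists (n, t).
pose E j := empirical z0 F phi (Nt j).1 (Nt j).2.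
have N0 j : (0 < (Nt j).1)%N by have [jN _] := NtP j; exact: leq_ltn_trans jN.
have Epos j : positive_functional (E j) by exact: empirical_positive.
have [U [UU Uoo]] := ultraFilterLemma (eventually_filter).
pose L := limit_functional U E.
have Lpos : positive_functional L by exact: limit_functional_positive.
have [eta etaL] := riesz_representation z0 cK Lpos.
have Leta g : continuous g -> \int[eta]_z g z = L g.
  by move=> cg; rewrite /Rintegral etaL.
have Nle j (c : R) : 0 <= c -> (Nt j).1%:R^-1 * c <= e j * c.
  move=> c0; rewrite ler_wpM2r // lef_pV2 ?posrE ?ltr0n // ler_nat.
  by have [] := NtP j.
have cvge (c : R) : e j * c @[j --> \oo] --> 0.
  rewrite -[X in _ --> X](mul0r c); apply: cvgM; last exact: cvg_cst.
  exact: cvg_harmonic.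
exists eta; split.
  have cT := continuous_skew cX cF hF.
  have mT : measurable_fun setT (Defs.skew F : borel z0 -> borel z0).
    exact: continuous_borel.
  pose T : {mfun borel z0 >-> borel z0} := mfun_Sub (mem_set mT).
  (* Invariance is tested on continuous functions, for which the defect at stage j is at most 2 C /
     N_j and vanishes in the limit. *)
  move=> B mB; apply: (probability_eq_continuous (P := distribution eta T)) mB.
  move=> g cg bg; rewrite Rintegral_distribution //; last exact: continuous_borel_real.
  have cgT : continuous (g \o Defs.skew F).
    by move=> z; apply: continuous_comp; [exact: cT|exact: cg].
  rewrite (Leta _ cgT) (Leta _ cg).
  have bgT : bounded_fct (g \o Defs.skew F) by exact: bounded_fct_comp.
  have [C gC] := bg.
  have close j := empirical_invariant z0 F phi (Nt j).2 (N0 j) gC.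
  have C0 : 0 <= C + C by rewrite addr_ge0 // (le_trans _ (gC z0)).
  apply/eqP; rewrite eq_le; apply/andP; split.
    apply: (ultralim_le Uoo _ _ (cvge (C + C))).
    - exact: bounded_functionals.
    - exact: bounded_functionals.
    - apply: nearW => j; have := close j; rewrite ler_norml => /andP[_].
      rewrite lerBlDl => /le_trans; apply.
      by rewrite lerD2l Nle.
  apply: (ultralim_le Uoo _ _ (cvge (C + C))).
  - exact: bounded_functionals.
  - exact: bounded_functionals.
  - apply: nearW => j; have := close j; rewrite ler_norml => /andP[+ _].
    rewrite lerBrDl lerBlDr => /le_trans; apply.
    by rewrite lerD2l Nle.
move=> n G cG GS.
have cg : continuous (window_fct n G) by exact: continuous_window_fct.
have cpg : continuous (fun z => phi z + window_fct n G z).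
  by move=> z; apply: cvgD; [exact: cphi|exact: cg].
have [B gB] := continuous_bounded_fct cK cg.
have bpg := continuous_bounded_fct cK cpg.
have [C _ hC] := hol.
rewrite (Leta _ cpg) -(ultralim_unique (U := U) (cvg_cst P)).
set c := `|C + estimate_cst (A := A) n B|.
apply: (ultralim_le Uoo _ _ (cvge (1 + c))).
- exact: bounded_fct_cst.
- exact: bounded_functionals.
(* From this stage on, N_j is at least n + 1 and has the form n + 1 + m of the finite estimate. *)
exists n.+1 => // j /= nj; have [jN hP] := NtP j.
have nN : (n.+1 <= (Nt j).1)%N by exact: leq_trans nj (ltnW jN).
have := pressure_estimate z0 cX cF hF cphi (Nt j).2 ((Nt j).1 - n.+1) dF hC GS gB.
rewrite subnKC // => h.
have h' : (Nt j).1%:R^-1 * (C + estimate_cst (A := A) n B) <= e j * c.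
  apply: le_trans (Nle j c (normr_ge0 _)); rewrite ler_wpM2l ?invr_ge0 //.
  exact: ler_norm.
have {}h := lt_le_trans hP h; rewrite mulrDr mulr1; move: h' h; rewrite -/(E j _).
move: (E j _) (_^-1 * (C + _)) (e j) (e j * c) => a b e' c' h1 h2.
by rewrite ltrBlDr in h2; lra.
Qed.

End equilibrium_measure.

(** * The entropy of the equilibrium measure *)

Section log_sum_exp.
Context {R : realType} {I : finType}.
Implicit Types f g : I -> R.

(** The normalising term: [log_sum_exp f - f i] meets the constraint on [G] for any [f]. It moves by
    at most D when [f] does, so approximating [f] is enough. *)
Definition log_sum_exp f : R := ln (\sum_i expR (f i)).

Lemma sum_exp_gt0 (i0 : I) f : 0 < \sum_i expR (f i).
Proof.
rewrite (bigD1 i0) //= ltr_pwDl ?expR_gt0 //.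
by apply: sumr_ge0 => v _; exact: expR_ge0.
Qed.

Lemma sum_exp_sub_log_sum_exp (i0 : I) f :
  \sum_i expR (- (log_sum_exp f - f i)) = 1.
Proof.
have s0 := sum_exp_gt0 i0 f.
under eq_bigr do rewrite opprB expRB lnK ?posrE //.
by rewrite -mulr_suml divff // gt_eqF.
Qed.

Lemma log_sum_exp_le (i0 : I) f g D :
  (forall i, f i <= g i + D) -> log_sum_exp f <= log_sum_exp g + D.
Proof.
move=> fg; have sf := sum_exp_gt0 i0 f; have sg := sum_exp_gt0 i0 g.
rewrite /log_sum_exp -[D in leRHS]expRK -lnM ?posrE ?expR_gt0 //.
rewrite ler_ln ?posrE ?mulr_gt0 ?expR_gt0 // mulr_suml; apply: ler_sum => i _.
by rewrite -expRD ler_expR.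
Qed.

Lemma continuous_log_sum_exp (T : topologicalType) (i0 : I) (f : I -> T -> R) :
  (forall i, continuous (f i)) -> continuous (fun x => log_sum_exp (f ^~ x)).
Proof.
move=> cf x; apply: (@continuous_comp _ _ _ (fun x => \sum_i expR (f i x)) (@ln R)).
  elim: (index_enum I) => [|i r ih].
    rewrite (_ : (fun x => _) = fun=> 0); first exact: cvg_cst.
    by apply/funext => y; rewrite big_nil.
  rewrite (_ : (fun x => _) = fun y => expR (f i y) + \sum_(j <- r) expR (f j y)).
    apply: cvgD => //; apply: continuous_comp; first exact: cf.
    exact: continuous_expR.
  by apply/funext => y; rewrite big_cons.
by apply: continuous_ln; exact: sum_exp_gt0.
Qed.

End log_sum_exp.

Lemma big_tuple_rcons (R : realType) (A : finType) n (h : seq A -> R) :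
  \sum_(u : n.+1.-tuple A) h u = \sum_(w : n.-tuple A) \sum_a h (rcons w a).
Proof.
pose k (p : n.-tuple A * A) : n.+1.-tuple A := [tuple of rcons p.1 p.2].
rewrite (reindex k) /=; last first.
  apply: onW_bij; apply: inj_card_bij; last by rewrite card_prod !card_tuple expnSr.
  move=> [w a] [v b] /(congr1 val) /= /rcons_inj[wv ->]; congr pair.
  exact: val_inj.
by rewrite -(pair_bigA _ (fun (w : n.-tuple A) a => h (rcons w a))).
Qed.

Section entropy_increment.
Context {R : realType} {A : finType} {M : rel A} {X : metricType R}.
Local Notation Sigma := (shift_space R M).
Local Notation K := (Sigma * X)%type.
Local Notation Y := (past_space R M * X)%type.
Variables (z0 : K) (eta : probability (borel z0) R).
Local Notation pi := (@unstable_proj R A M X).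
Local Notation tau := (transverse eta).
Local Notation prob := (fibre_prob eta).
Hypothesis cX : compact [set: X].

(** Where the word [w] has probability zero the quotient is 0, so the sum over letters is only at
    most 1. *)
Definition cond_prob (w : seq A) (a : A) (y : borel (pi z0)) : R :=
  prob (rcons w a) y / prob w y.

(** The cutoff at [e] makes the logarithm bounded, as L1 approximation requires. *)
Definition log_cond_prob (e : R) (w : seq A) (a : A) (y : borel (pi z0)) : R :=
  ln (Num.max (cond_prob w a y) e).

Lemma fibre_prob_rcons_le w a y : prob (rcons w a) y <= prob w y.
Proof.
rewrite (fibre_prob_rcons eta w) (bigD1 a) //= lerDl.
by apply: sumr_ge0 => b _; exact: fibre_prob_ge0.
Qed.

Lemma cond_prob_ge0 w a y : 0 <= cond_prob w a y.
Proof. by rewrite divr_ge0 // fibre_prob_ge0. Qed.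

Lemma cond_prob_sum w y : \sum_a cond_prob w a y <= 1.
Proof.
rewrite -mulr_suml -fibre_prob_rcons.
have [->|p0] := eqVneq (prob w y) 0; first by rewrite mul0r.
by rewrite divff.
Qed.

Lemma cond_prob_le1 w a y : cond_prob w a y <= 1.
Proof.
apply: le_trans (cond_prob_sum w y); rewrite (bigD1 a) //= lerDl.
by apply: sumr_ge0 => b _; exact: cond_prob_ge0.
Qed.

Section truncated.
Variable e : R.
Hypothesis e01 : 0 < e <= 1.

Lemma bounded_log_cond_prob w a : bounded_fct (log_cond_prob e w a).
Proof.
have /andP[e0 e1] := e01; exists (- ln e) => y; rewrite ler_norml opprK.
have m0 : 0 < Num.max (cond_prob w a y) e by rewrite lt_max e0 orbT.
apply/andP; split; first by rewrite ler_ln ?posrE // le_max lexx orbT.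
apply: (@le_trans _ _ 0); last by rewrite oppr_ge0 ln_le0.
by rewrite ln_le0 // ge_max cond_prob_le1.
Qed.

Lemma measurable_log_cond_prob w a : measurable_fun setT (log_cond_prob e w a).
Proof.
apply: (measurableT_comp (@measurable_ln R)); apply: measurable_maxr; last first.
  exact: measurable_cst.
apply: measurable_funM; first exact: measurable_fibre_prob.
rewrite (_ : (fun y => _) = fun y => prob w y `^ (-1)).
  by apply: (measurableT_comp (measurable_powR (-1))); exact: measurable_fibre_prob.
by apply/funext => y; rewrite powR_inv1 // fibre_prob_ge0.
Qed.

(** The cutoff increases the total mass to at most 1 + #|A| e, and ln(1 + x) <= x; this is the price
    of the cutoff in the normalisation. *)
Lemma log_sum_log_cond_prob w y :
  log_sum_exp (fun a => log_cond_prob e w a y) <= #|A|%:R * e.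
Proof.
have /andP[e0 e1] := e01.
apply: (@le_trans _ _ (ln (1 + #|A|%:R * e))); last first.
  apply: le_ln1Dx; rewrite (@lt_le_trans _ _ 0) ?ltrN10 //.
  by rewrite mulr_ge0 // ltW.
have s0 := sum_exp_gt0 (z0.1 0) (fun a => log_cond_prob e w a y).
rewrite ler_ln ?posrE //; last by rewrite ltr_pwDl // mulr_ge0 // ltW.
apply: (@le_trans _ _ (\sum_a (cond_prob w a y + e))).
  apply: ler_sum => a _; rewrite lnK ?posrE ?lt_max ?e0 ?orbT //.
  by rewrite ge_max lerDl lerDr cond_prob_ge0 ltW.
by rewrite big_split /= sumr_const -[e *+ _]mulr_natl lerD2r cond_prob_sum.
Qed.

(** The cutoff can only raise the logarithm, so the information it measures is at most the true
    one. *)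
Lemma mul_log_cond_prob w a y :
  - (prob (rcons w a) y * log_cond_prob e w a y) <=
  - (prob (rcons w a) y * ln (prob (rcons w a) y)) + prob (rcons w a) y * ln (prob w y).
Proof.
have /andP[e0 e1] := e01.
have [->|p0] := eqVneq (prob (rcons w a) y) 0; first by rewrite !mul0r oppr0 addr0.
have pp : 0 < prob (rcons w a) y by rewrite lt_def p0 fibre_prob_ge0.
have pw : 0 < prob w y by apply: lt_le_trans pp (fibre_prob_rcons_le _ _ _).
rewrite -mulrN -mulrN -mulrDr ler_wpM2l ?(ltW pp) //.
rewrite addrC -lerN2 opprK opprB -ln_div ?posrE //.
by rewrite ler_ln ?posrE ?divr_gt0 ?lt_max ?e0 ?orbT // le_max lexx.
Qed.

(** The chain rule for entropy: summing over the last letter recovers the probability of [w]. It is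
    an inequality because of the cutoff. *)
Lemma sum_log_cond_prob n y :
  \sum_(w : n.-tuple A) \sum_a - (prob (rcons w a) y * log_cond_prob e w a y) <=
  word_entropy eta n.+1 y - word_entropy eta n y.
Proof.
apply: (@le_trans _ _ (\sum_(w : n.-tuple A) \sum_a
    (- (prob (rcons w a) y * ln (prob (rcons w a) y)) +
     prob (rcons w a) y * ln (prob w y)))).
  by apply: ler_sum => w _; apply: ler_sum => a _; exact: mul_log_cond_prob.
under eq_bigr do rewrite big_split /= -mulr_suml -fibre_prob_rcons.
rewrite big_split /= /word_entropy opprK lerD2r.
rewrite (big_tuple_rcons n (fun u => prob u y * ln (prob u y))) -sumrN.
by apply: ler_sum => w _; rewrite sumrN.
Qed.

(** The information function - ln P(x_n | x_0 ... x_(n-1), pi), with the cutoff; as a sum of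
    indicators with coefficients depending on [pi], it can be integrated fibre by fibre. *)
Definition surprise n (z : borel z0) : R :=
  \sum_(w : n.-tuple A) \sum_a - log_cond_prob e w a (pi z) * \1_(word_cyl (rcons w a)) z.

Let mpi : measurable_fun setT (pi : borel z0 -> borel (pi z0)).
Proof. exact: (@continuous_borel _ _ z0 (pi z0) _ (@continuous_unstable_proj R A M X)). Qed.

Let mterm w a : measurable_fun setT (fun z : borel z0 =>
  - log_cond_prob e w a (pi z) * \1_(word_cyl (rcons w a)) z).
Proof.
apply: measurable_funM; last by apply: measurable_indic; exact: measurable_word_cyl.
apply: measurableT_comp => //; apply: measurableT_comp mpi.
exact: measurable_log_cond_prob.
Qed.

Let bterm w a : bounded_fct (fun z : borel z0 =>
  - log_cond_prob e w a (pi z) * \1_(word_cyl (rcons w a)) z).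
Proof.
apply: bounded_fctM; last exact: bounded_fct_indic.
by apply: bounded_fctN; exact: (bounded_fct_comp pi (bounded_log_cond_prob w a)).
Qed.

Lemma measurable_surprise n : measurable_fun setT (surprise n).
Proof. by apply: measurable_sum => w; exact: measurable_sum. Qed.

Lemma bounded_surprise n : bounded_fct (surprise n).
Proof. by apply: bounded_fct_sum => w; exact: bounded_fct_sum. Qed.

Lemma Rintegral_surprise n :
  \int[eta]_z surprise n z <= mean_entropy eta n.+1 - mean_entropy eta n.
Proof.
have mlp w a : measurable_fun setT (fun y => prob (rcons w a) y * log_cond_prob e w a y).
  apply: measurable_funM; first exact: measurable_fibre_prob.
  exact: measurable_log_cond_prob.
have blp w a : bounded_fct (fun y => prob (rcons w a) y * log_cond_prob e w a y).
  apply: bounded_fctM; first exact: bounded_fibre_prob.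
  exact: bounded_log_cond_prob.
have mnlp w a : measurable_fun setT (fun y => - (prob (rcons w a) y * log_cond_prob e w a y)).
  exact: measurableT_comp.
have bnlp w a : bounded_fct (fun y => - (prob (rcons w a) y * log_cond_prob e w a y)).
  exact: bounded_fctN.
have -> : \int[eta]_z surprise n z = \int[tau]_y
    (\sum_(w : n.-tuple A) \sum_a - (prob (rcons w a) y * log_cond_prob e w a y)).
  rewrite Rintegral_sum; last 2 first.
  - by move=> w; exact: measurable_sum.
  - by move=> w; exact: bounded_fct_sum.
  rewrite Rintegral_sum; last 2 first.
  - by move=> w; exact: measurable_sum.
  - by move=> w; exact: bounded_fct_sum.
  apply: eq_bigr => w _; rewrite !Rintegral_sum //; apply: eq_bigr => a _.
  rewrite Rintegral_disintegration //.
  have ml : measurable_fun setT (fun y => - log_cond_prob e w a y).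
    by apply: measurableT_comp => //; exact: measurable_log_cond_prob.
  have bl : bounded_fct (fun y => - log_cond_prob e w a y).
    by apply: bounded_fctN; exact: bounded_log_cond_prob.
  have mI : measurable_fun setT (\1_(word_cyl (rcons w a)) : borel z0 -> R).
    by apply: measurable_indic; exact: measurable_word_cyl.
  have bI := bounded_fct_indic R (word_cyl (rcons w a) : set (borel z0)).
  apply: Rintegral_ae_eq => //.
    by apply: measurable_fibre_mean; [exact: mterm|exact: bterm].
  apply: filterS (fibre_mean_pi eta ml bl mI bI) => y ->.
  by rewrite -fibre_probE mulNr mulrC.
have me n' := measurable_word_entropy eta n'.
have be n' := bounded_word_entropy eta n'.
rewrite /mean_entropy -RintegralB //; [|exact: bounded_integrable|exact: bounded_integrable].
apply: le_Rintegral_bounded.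
- by apply: measurable_sum => w; exact: measurable_sum.
- by apply: bounded_fct_sum => w; exact: bounded_fct_sum.
- exact: measurable_funB.
- exact: bounded_fctB.
- by move=> y; exact: sum_log_cond_prob.
Qed.

End truncated.

Variables (phi : K -> R) (P : R).
Hypothesis cphi : continuous phi.
Hypothesis P_le : forall n (G : seq A -> A -> Y -> R),
  (forall w a, continuous (G w a)) ->
  (forall w y, \sum_a expR (- G w a y) <= 1) ->
  P <= \int[eta]_z (phi z + window_fct n G z).

(** [P_le] is applied to the renormalised continuous approximations of [log_cond_prob]. The cutoff
    costs #|A| e and the approximation costs e. *)
Lemma entropy_increment_trunc n e : 0 < e <= 1 ->
  P - \int[eta]_z phi z <=
    mean_entropy eta n.+1 - mean_entropy eta n + (#|A|%:R + 1) * e.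
Proof.
move=> e01; have /andP[e0 e1] := e01.
have cK : compact [set: K] by exact: compact_skew_space.
(* N counts the pairs of a word of length [n] and a letter. The tolerance e / (2 N) for each makes
   the total error [D] integrate to at most e / 2. *)
pose N : R := (#|A| ^ n)%N%:R * #|A|%:R.
have N0 : 0 < N by rewrite mulr_gt0 ?(cardA_gt0 z0) // natrX exprn_gt0 ?(cardA_gt0 z0).
pose del := e / (2 * N).
have del0 : 0 < del by rewrite divr_gt0 // mulr_gt0.
have /choice[f fP] : forall wa : seq A * A, exists f : Y -> R,
    [/\ continuous f, bounded_fct f &
      \int[tau]_y `|log_cond_prob e wa.1 wa.2 y - f y| <= del].
  move=> [w a]; apply: (@continuous_L1_dense _ _ (pi z0) tau) => //.
    exact: measurable_log_cond_prob.
  exact: bounded_log_cond_prob.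
have cf w a : continuous (f (w, a)) by have [] := fP (w, a).
have bf w a : bounded_fct (f (w, a)) by have [] := fP (w, a).
pose G (w : seq A) (a : A) (y : Y) : R := log_sum_exp (fun b => f (w, b) y) - f (w, a) y.
have cG w a : continuous (G w a).
  move=> y; apply: cvgB; last exact: cf.
  exact: (continuous_log_sum_exp (z0.1 0) (f := fun b => f (w, b))).
have := P_le n cG (fun w y => _).
move=> /(_ _)/wrap[w y|].
  by rewrite (sum_exp_sub_log_sum_exp (z0.1 0) (fun b => f (w, b) y)).
have cg : continuous (window_fct n G) by exact: continuous_window_fct.
have mg : measurable_fun setT (window_fct n G : borel z0 -> R).
  exact: continuous_borel_real.
have bg := continuous_bounded_fct cK cg.
have mphi : measurable_fun setT (phi : borel z0 -> R) by exact: continuous_borel_real.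
have bphi := continuous_bounded_fct cK cphi.
rewrite RintegralD_bounded // -lerBlDl => /le_trans; apply.
pose D (y : borel (pi z0)) : R := \sum_(w : n.-tuple A) \sum_a
  `|log_cond_prob e w a y - f (val w, a) y|.
have mDt w a : measurable_fun setT (fun y : borel (pi z0) =>
    `|log_cond_prob e w a y - f (w, a) y|).
  by apply: measurable_normB => //; exact: measurable_log_cond_prob.
have bDt w a : bounded_fct (fun y : borel (pi z0) =>
    `|log_cond_prob e w a y - f (w, a) y|).
  by apply: bounded_normB => //; exact: bounded_log_cond_prob.
have mD : measurable_fun setT D.
  by apply: measurable_sum => w; apply: measurable_sum => a; exact: mDt.
have bD : bounded_fct D.
  by apply: bounded_fct_sum => w; apply: bounded_fct_sum => a; exact: bDt.
have mDpi : measurable_fun setT (fun z : borel z0 => D (pi z)).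
  apply: (measurableT_comp mD).
  exact: (@continuous_borel _ _ z0 (pi z0) _ (@continuous_unstable_proj R A M X)).
have bDpi : bounded_fct (fun z : borel z0 => D (pi z)) by exact: (bounded_fct_comp pi bD).
have ID : \int[eta]_z D (pi z) <= N * del.
  rewrite -(Rintegral_distribution eta
    (@unstable_borel R A M X z0 : {mfun borel z0 >-> borel (pi z0)}) mD bD).
  rewrite Rintegral_sum; last 2 first.
  - by move=> w; apply: measurable_sum => a; exact: mDt.
  - by move=> w; apply: bounded_fct_sum => a; exact: bDt.
  apply: (@le_trans _ _ (\sum_(w : n.-tuple A) \sum_(a : A) del)).
    apply: ler_sum => w _; rewrite Rintegral_sum //.
    by apply: ler_sum => a _; have [_ _] := fP (val w, a).
  rewrite !sumr_const card_tuple -mulrnA -[leLHS]mulr_natl mulnC natrM.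
  exact: lexx.
(* [D] occurs twice: once for the normalising term, once for the letter actually read. *)
pose S z := surprise e n z + (#|A|%:R * e + (D (pi z) + D (pi z))).
have mS := measurable_surprise e n; have bS := bounded_surprise e01 n.
have mc : measurable_fun setT (fun z : borel z0 => #|A|%:R * e + (D (pi z) + D (pi z))).
  by apply: measurable_funD; [exact: measurable_cst|exact: measurable_funD].
have bc : bounded_fct (fun z : borel z0 => #|A|%:R * e + (D (pi z) + D (pi z))).
  by apply: bounded_fctD; [exact: bounded_fct_cst|exact: bounded_fctD].
apply: (@le_trans _ _ (\int[eta]_z S z)).
  apply: le_Rintegral_bounded => //.
  - exact: measurable_funD.
  - exact: bounded_fctD.
  move=> z; have [u zu] := word_cyl_tuple n z.
  set a := z.1 n%:Z.
  have zu' : mkseq (fun k : nat => z.1 k%:Z) n = u by rewrite -[RHS]zu size_tuple.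
  have zua : word_cyl (rcons u a) z.
    by rewrite word_cyl_rcons; split => //=; rewrite size_tuple.
  rewrite /S.
  have -> : surprise e n z = - log_cond_prob e u a (pi z).
    rewrite /surprise (bigD1 u) //= [X in _ + X]big1 ?addr0 => [|v vu].
      rewrite (bigD1 a) //= big1 ?addr0 => [|b ba].
        by rewrite indicE mem_set // mulr1.
      rewrite indicE memNset ?mulr0 // word_cyl_rcons => -[_ /= zb].
      by move: ba; rewrite -zb size_tuple eqxx.
    apply: big1 => b _; rewrite indicE memNset ?mulr0 // word_cyl_rcons => -[zv _].
    by case/eqP: vu; exact: word_cyl_inj zv zu.
  rewrite /window_fct zu' -/a /G.
  have Dle b : `|log_cond_prob e u b (pi z) - f (val u, b) (pi z)| <= D (pi z).
    rewrite /D (bigD1 u) //= (bigD1 b) //= -addrA lerDl addr_ge0 //.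
      by apply: sumr_ge0.
    by apply: sumr_ge0 => v _; apply: sumr_ge0.
  have le1 : log_sum_exp (fun b => f (val u, b) (pi z)) <=
      log_sum_exp (fun b => log_cond_prob e u b (pi z)) + D (pi z).
    apply: (log_sum_exp_le (z0.1 0)) => b; rewrite -lerBlDl.
    by apply: le_trans (Dle b); rewrite distrC ler_norm.
  have le2 := log_sum_log_cond_prob e01 u (pi z).
  have le3 := le_trans (ler_norm _) (Dle a).
  by move: le1 le2 le3; lra.
rewrite /S RintegralD_bounded // lerD ?Rintegral_surprise //.
rewrite RintegralD_bounded; [|exact: measurable_cst|exact: bounded_fct_cst
  |exact: measurable_funD|exact: bounded_fctD].
rewrite Rintegral_prob_cst mulrDl mul1r lerD2l RintegralD_bounded //.
apply: le_trans (lerD ID ID) _; rewrite -mulr2n -mulr_natl mulrA /del.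
by rewrite mulrCA divff ?mulr1 // gt_eqF // mulr_gt0.
Qed.

Lemma entropy_increment n :
  P - \int[eta]_z phi z <= mean_entropy eta n.+1 - mean_entropy eta n.
Proof.
apply/ler_addgt0Pr => e e0.
have c0 : 0 < #|A|%:R + 1 :> R by rewrite ltr_wpDl.
pose d := Num.min 1 (e / (#|A|%:R + 1)).
have d01 : 0 < d <= 1 by rewrite /d lt_min ltr01 divr_gt0 //= ge_min lexx.
apply: le_trans (entropy_increment_trunc n d01) _; rewrite lerD2l.
by rewrite -ler_pdivlMl // mulrC /d ge_min lexx orbT.
Qed.

(** Increments are summed from length 0, where the entropy is nonnegative. *)
Lemma mean_entropy_ge n : n%:R * (P - \int[eta]_z phi z) <= mean_entropy eta n.
Proof.
elim: n => [|n ih].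
  by rewrite mul0r; apply: Rintegral_ge0 => y _; exact: word_entropy_ge0.
rewrite -natr1 mulrDl mul1r; have := entropy_increment n.
by rewrite lerBrDl; apply: le_trans; rewrite lerD2r.
Qed.

End entropy_increment.

Theorem theorem6p7 (R : realType) (A : finType) (M : rel A) (X : metricType R)
  (z0 : shift_space R M * X) (alpha : R)
  (F : shift_space R M -> X -> X) (phi : shift_space R M * X -> R) :
  topologically_transitive (@left_shift R A M) ->
  compact [set: X] ->
  0 < alpha <= 1 ->
  (forall w, holder alpha (F w)) ->
  (forall w, homeomorphism (F w)) ->
  holder_family F ->
  holder_continuous (phi : shift_space R M * X -> R^o) ->
  holonomies F phi ->
  depends_on_past F ->
  is_maximum
    [set (metric_entropy F eta + \int[eta]_z (phi z)%:E)%E | eta in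
       [set eta : probability (borel z0) R | invariant_measure F eta]]
    (pressure F z0 phi).
Proof.
move=> _ cX _ _ homF hF hphi hol dF.
have cF w : continuous (F w) by have [] := homF w.
have cphi := continuous_holder hphi.
have cK : compact [set: shift_space R M * X] by exact: compact_skew_space.
have intE (eta : probability (borel z0) R) :
    (\int[eta]_z (phi z)%:E)%E = (\int[eta]_z phi z)%:E.
  apply: EFin_Rintegral; first exact: continuous_borel_real.
  exact: continuous_bounded_fct.
have ub (eta : probability (borel z0) R) : invariant_measure F eta ->
    (metric_entropy F eta + \int[eta]_z (phi z)%:E <= pressure F z0 phi)%E.
  by move=> inv; rewrite intE; exact: entropy_le_pressure.
split; last by move=> _ [eta inv <-]; exact: ub.
(* A real value of the pressure allows the subtraction of the integral in the extended reals. *)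
have [P PE] : exists P, pressure F z0 phi = P%:E by exact: pressure_bounded.
have [eta [inv P_le]] := equilibrium_measure cX cF hF cphi hol dF PE.
exists eta => //; apply/eqP; rewrite eq_le ub //= PE intE -leeBlDr // -EFinB.
rewrite metric_entropyE; apply: limn_esup_ge => n n0.
rewrite lee_fin ler_pdivlMl ?ltr0n //.
exact: mean_entropy_ge.
Qed.
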